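(* Let $K\subset\mathbb R^2$ be a convex body and let $u\in\mathbb R^2$ be a unit vector. Let $p_u$ be the pushforward of the normalized area measure on $K$ under the map $x\mapsto\langle x,u\rangle$, and let $q_u$ be the pushforward of the normalized arclength measure on $\partial K$ under the same map. Then $$\mathcal D(q_u)\ge \mathcal D(p_u).$$
   Context: A convex body is a compact convex set with nonempty interior. ''Normalized'' means scaled to be a probability measure. For a probability measure $\rho$ on $\mathbb R$, the Gini mean difference is $$\mathcal D(\rho)=\iint_{\mathbb R^2}|x-y|\,d\rho(x)\,d\rho(y).$$ *)

(* Defs.v *)
From HB Require Import structures.
From mathcomp Require Import all_boot all_order all_algebra.
From mathcomp Require Import all_classical all_reals all_analysis.
From mathcomp Require Import measurable_realfun.

Set Implicit Arguments.
Unset Strict Implicit.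
Unset Printing Implicit Defensive.

Import Order.TTheory GRing.Theory Num.Theory.
Import numFieldNormedType.Exports.

Local Open Scope classical_set_scope.
Local Open Scope ring_scope.

(* [lebesgue_measure] lives on [measurableTypeR R], so the Borel plane is the
   product of two copies of it; as a type it is [R * R]. *)
Notation plane R := (measurableTypeR R * measurableTypeR R)%type.

Section euclidean_plane.
Context {R : realType}.
Implicit Types x y u : R * R.

Definition dotp u x : R := x.1 * u.1 + x.2 * u.2.

(* The library norm on [R * R] is the sup norm; lengths need the Euclidean
   one. *)
Definition eucl_norm x : R := Num.sqrt (dotp x x).

Definition eucl_dist x y : R := eucl_norm (x - y).

Definition convex_body (K : set (R * R)) :=
  [/\ compact K, convex_set (K : set (R^o * R^o)) & K° !=set0].

Definition frontier (K : set (R * R)) : set (R * R) := closure K `\` K°.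

End euclidean_plane.

Section hausdorff_measure.
Context {R : realType}.
Implicit Types A B U V : set (R * R).
Local Open Scope ereal_scope.

(* The point 0 is added so that the empty set has diameter 0, not -oo. *)
Definition diam U : \bar R :=
  ereal_sup (0 |` [set (eucl_dist z.1 z.2)%:E | z in U `*` U]).

Definition hausdorff1_pre (delta : R) A : \bar R :=
  ereal_inf [set \sum_(k <oo) diam (F k) | F in
    [set F : (set (R * R))^nat |
      A `<=` \bigcup_k F k /\ forall k, diam (F k) <= delta%:E]].

(* One-dimensional Hausdorff (outer) measure, normalized so that it is the
   length on segments. *)
Definition hausdorff1 A : \bar R :=
  ereal_sup [set hausdorff1_pre delta A | delta in [set delta : R | (0 < delta)%R]].

Lemma diam_ge0 U : 0 <= diam U.
Proof. by apply: ereal_sup_ubound; left. Qed.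

Lemma diam0 : diam set0 = 0.
Proof.
rewrite /diam; apply/eqP; rewrite eq_le diam_ge0 andbT.
by apply: ge_ereal_sup => _ [->//|[z [[] ]]].
Qed.

Lemma le_diam U V : U `<=` V -> diam U <= diam V.
Proof.
move=> UV; apply: ge_ereal_sup => _ [->|[z [z1 z2] <-]]; first exact: diam_ge0.
by apply: ereal_sup_ubound; right; exists z => //; split; exact: UV.
Qed.

Lemma eucl_dist_le_diam U x y : U x -> U y -> (eucl_dist x y)%:E <= diam U.
Proof. by move=> Ux Uy; apply: ereal_sup_ubound; right; exists (x, y). Qed.

Let T : measurableType _ := g_sigma_algebraType (@setT (set (R * R))).

Let mT (A : set T) : measurable A.
Proof. exact: sub_sigma_algebra. Qed.

Let pen (delta : R) A : \bar R :=
  if diam A <= delta%:E then diam A else +oo.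

Let pen_ge0 delta A : 0 <= pen delta A.
Proof. by rewrite /pen; case: ifPn => // _; exact: diam_ge0. Qed.

Let pen0 (delta : R) : (0 < delta)%R -> pen delta set0 = 0.
Proof. by move=> d0; rewrite /pen diam0 lee_fin ltW. Qed.

Let hausdorff1_preE delta A :
  hausdorff1_pre delta A = mu_ext (pen delta : set T -> \bar R) A.
Proof.
apply/eqP; rewrite eq_le; apply/andP; split; apply: le_ereal_inf_tmp.
- move=> _ [F [_ AF] <-].
  have [dF|] := pselect (forall k, diam (F k) <= delta%:E).
    apply: ereal_inf_lbound; exists F => //.
    by apply: eq_eseriesr => k _; rewrite /pen dF.
  move/existsNP => [k /negP dk].
  rewrite (@eseries_pinfty _ _ xpredT k) ?leey// /pen ?(negbTE dk)// => n _.
  by rewrite -ltNye (lt_le_trans _ (pen_ge0 _ _)).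
- move=> _ [F [AF dF] <-]; apply: ereal_inf_lbound; exists F => //.
  by apply: eq_eseriesr => k _; rewrite /pen dF.
Qed.

Lemma hausdorff1_pre_ge0 delta A : 0 <= hausdorff1_pre delta A.
Proof. by rewrite hausdorff1_preE; exact: mu_ext_ge0. Qed.

Lemma hausdorff1_pre_le delta delta' A : (delta <= delta')%R ->
  hausdorff1_pre delta' A <= hausdorff1_pre delta A.
Proof.
move=> dd; apply: le_ereal_inf_tmp => _ [F [AF dF] <-].
apply: ereal_inf_lbound; exists F => //; split => // k.
by rewrite (le_trans (dF k))// lee_fin.
Qed.

Lemma hausdorff1_pre_ub delta A : (0 < delta)%R ->
  hausdorff1_pre delta A <= hausdorff1 A.
Proof. by move=> d0; apply: ereal_sup_ubound; exists delta. Qed.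

Lemma hausdorff1_ge0 A : 0 <= hausdorff1 A.
Proof. exact: le_trans (hausdorff1_pre_ge0 1 A) (hausdorff1_pre_ub _ ltr01). Qed.

Lemma hausdorff1_set0 : hausdorff1 set0 = 0.
Proof.
apply/eqP; rewrite eq_le hausdorff1_ge0 andbT.
apply: ge_ereal_sup => _ [delta d0 <-]; rewrite hausdorff1_preE mu_ext0//.
exact: pen0.
Qed.

Lemma le_hausdorff1 : {homo hausdorff1 : A B / A `<=` B >-> A <= B}.
Proof.
move=> A B AB; apply: ge_ereal_sup => _ [delta d0 <-].
by apply: le_trans (hausdorff1_pre_ub _ d0); rewrite !hausdorff1_preE le_mu_ext.
Qed.

Lemma hausdorff1_sigma_subadditive : sigma_subadditive hausdorff1.
Proof.
move=> F; apply: ge_ereal_sup => _ [delta d0 <-].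
rewrite hausdorff1_preE (le_trans (mu_ext_sigma_subadditive _ _))//.
by apply: lee_nneseries => k *; rewrite -?hausdorff1_preE;
  [exact: hausdorff1_pre_ge0|exact: hausdorff1_pre_ub].
Qed.

HB.instance Definition _ := isOuterMeasure.Build R (R * R)%type hausdorff1
  hausdorff1_set0 hausdorff1_ge0 le_hausdorff1 hausdorff1_sigma_subadditive.

Section metric_outer_measure.
Variable f : R * R -> R.
Hypothesis f_lip : forall x y, (`|f x - f y| <= eucl_dist x y)%R.

Lemma hausdorff1_pre_separated A B (e delta : R) : (0 < e)%R -> (delta < e)%R ->
  (forall x y, A x -> B y -> f y + e <= f x)%R ->
  hausdorff1_pre delta A + hausdorff1_pre delta B <=
  hausdorff1_pre delta (A `|` B).
Proof.
move=> e0 de AB; apply: le_ereal_inf_tmp => _ [F [ABF dF] <-].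
apply: (@le_trans _ _
  (\sum_(k <oo) diam (F k `&` A) + \sum_(k <oo) diam (F k `&` B))).
  apply: leeD; apply: ereal_inf_lbound; (eexists; last reflexivity); split.
  - by move=> x Ax; have [k _ Fk] := ABF x (or_introl Ax); exists k.
  - by move=> k; rewrite (le_trans _ (dF k))//; apply: le_diam => x [].
  - by move=> x Bx; have [k _ Fk] := ABF x (or_intror Bx); exists k.
  - by move=> k; rewrite (le_trans _ (dF k))//; apply: le_diam => x [].
rewrite -nneseriesD; [|by move=> *; exact: diam_ge0..].
apply: lee_nneseries => k *; first by rewrite adde_ge0 ?diam_ge0.
have [[x [Fx Ax]]|/set0P/negP/negPn/eqP ->] := pselect (F k `&` A !=set0);
    last by rewrite diam0 add0e; apply: le_diam => ? [].
have [[y [Fy By]]|/set0P/negP/negPn/eqP ->] := pselect (F k `&` B !=set0);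
    last by rewrite diam0 adde0; apply: le_diam => ? [].
have := le_trans (eucl_dist_le_diam Fx Fy) (dF k); rewrite lee_fin => xyd.
have := le_lt_trans (le_trans (f_lip x y) xyd) de.
rewrite ltNge => /negP; case; rewrite (le_trans _ (ler_norm _))//.
by rewrite lerBrDl AB.
Qed.

Lemma hausdorff1_separated A B (e : R) : (0 < e)%R ->
  (forall x y, A x -> B y -> f y + e <= f x)%R ->
  hausdorff1 A + hausdorff1 B <= hausdorff1 (A `|` B).
Proof.
move=> e0 AB.
have H (d1 d2 : R) : (0 < d1)%R -> (0 < d2)%R ->
    hausdorff1_pre d1 A + hausdorff1_pre d2 B <= hausdorff1 (A `|` B).
  move=> d10 d20; pose d := (Num.min (Num.min d1 d2) (e / 2))%R.
  have d0 : (0 < d)%R by rewrite !lt_min d10 d20 divr_gt0.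
  apply: le_trans (hausdorff1_pre_ub _ d0).
  apply: le_trans (@hausdorff1_pre_separated A B e d e0 _ AB).
    by apply: leeD; apply: hausdorff1_pre_le; rewrite !ge_min lexx ?orbT.
  rewrite /d gt_min; apply/orP; right.
  by rewrite ltr_pdivrMr// ltr_pMr// ltr1n.
have := hausdorff1_ge0 (A `|` B).
case: (hausdorff1 (A `|` B)) H => [c H _|_ _|//]; last exact: leey.
have pA d : (0 < d)%R -> hausdorff1_pre d A \is a fin_num.
  move=> d0; rewrite ge0_fin_numE ?hausdorff1_pre_ge0//.
  apply: le_lt_trans (ltry c); apply: le_trans (H _ _ d0 d0).
  by rewrite leeDl ?hausdorff1_pre_ge0.
have pB d : (0 < d)%R -> hausdorff1 B <= c%:E - hausdorff1_pre d A.
  move=> d0; apply: ge_ereal_sup => _ [d' d'0 <-].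
  by rewrite leeBrDl ?pA// H.
have fB : hausdorff1 B \is a fin_num.
  rewrite ge0_fin_numE ?hausdorff1_ge0// (le_lt_trans (pB _ ltr01))//.
  by move: (pA _ ltr01) => /fineK <-; rewrite -EFinB ltry.
rewrite -leeBrDr//; apply: ge_ereal_sup => _ [d d0 <-].
by rewrite leeBrDr// addeC -leeBrDr ?pA ?pB.
Qed.

Section half_plane.
Variables (X : set (R * R)) (a : R).

Let t (k : nat) : R := a + k.+1%:R^-1.

Let tS k : (t k.+1 < t k)%R.
Proof. by rewrite ltrD2l ltf_pV2 ?posrE// ltr_nat. Qed.

Let t_le m n : (m <= n)%N -> (t n <= t m)%R.
Proof. by move=> mn; rewrite lerD2l lef_pV2 ?posrE// ler_nat. Qed.

Let above k : set (R * R) := X `&` [set x | t k < f x]%R.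

Let shell k : set (R * R) := X `&` [set x | t k.+1 < f x <= t k]%R.

Let sum_shell2 p n :
  \sum_(0 <= k < n.+1) hausdorff1 (shell (k.*2 + p)) <=
  hausdorff1 (above (n.*2 + p).+1).
Proof.
elim: n => [|n ih].
  by rewrite big_nat1; apply: le_hausdorff1 => x [Xx /andP[]].
rewrite big_nat_recr//=; apply: le_trans (leeD ih (lexx _)) _.
rewrite doubleS !addSn; set m := (n.*2 + p)%N.
have e0 : (0 < t m.+1 - t m.+2)%R by rewrite subr_gt0.
apply: le_trans (hausdorff1_separated e0 _) _.
  move=> x y [_ /= mx] [_ /= /andP[_ ym]].
  by rewrite (le_trans _ (ltW mx))// addrCA gerDl subr_le0.
apply: le_hausdorff1 => x [] [Xx /=].
  move=> mx; split; first exact: Xx.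
  by apply: le_lt_trans mx; apply: t_le; rewrite ltnW.
by move=> /andP[mx _]; split.
Qed.

Let sum_shell n :
  \sum_(0 <= k < n) hausdorff1 (shell k) <= hausdorff1 X + hausdorff1 X.
Proof.
have sub p m : \sum_(0 <= k < m) hausdorff1 (shell (k.*2 + p)) <= hausdorff1 X.
  case: m => [|m]; first by rewrite big_geq// hausdorff1_ge0.
  by apply: le_trans (sum_shell2 _ _) _; apply: le_hausdorff1 => x [].
have split_parity m : \sum_(0 <= k < m.*2) hausdorff1 (shell k) =
    \sum_(0 <= k < m) hausdorff1 (shell (k.*2 + 0)) +
    \sum_(0 <= k < m) hausdorff1 (shell (k.*2 + 1)).
  elim: m => [|m ih]; first by rewrite !big_geq// adde0.
  by rewrite doubleS !big_nat_recr//= ih addn0 addn1 -!addeA; congr (_ + _);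
    rewrite addeCA.
apply: (@le_trans _ _ (\sum_(0 <= k < n.*2) hausdorff1 (shell k))).
  apply: lee_sum_nneg_natr => //; first by move=> *; exact: hausdorff1_ge0.
  by rewrite -addnn leq_addr.
by rewrite split_parity leeD.
Qed.

Lemma hausdorff1_half_plane_le :
  hausdorff1 (X `&` [set x | a < f x]%R) +
  hausdorff1 (X `&` ~` [set x | a < f x]%R) <= hausdorff1 X.
Proof.
have [->|Xoo] := eqVneq (hausdorff1 X) +oo; first exact: leey.
have shell_fin : \sum_(0 <= k <oo) hausdorff1 (shell k) < +oo.
  apply: (@le_lt_trans _ _ (hausdorff1 X + hausdorff1 X)).
    apply: lime_le; first by apply: is_cvg_nneseries => *; exact: hausdorff1_ge0.
    by apply: nearW => n; exact: sum_shell.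
  by rewrite lte_add_pinfty// ltey.
have tail0 := nneseries_tail_cvg shell_fin (fun k _ => hausdorff1_ge0 (shell k)).
have lim_rhs : (hausdorff1 X + \sum_(n <= k <oo) hausdorff1 (shell k))
    @[n --> \oo] --> hausdorff1 X.
  rewrite -[X in _ --> X]adde0; apply: cvgeD => //; last exact: cvg_cst.
  by rewrite fin_num_adde_defl.
rewrite -(cvg_lim _ lim_rhs)//; apply: lime_ge; first by apply/cvg_ex; eexists; exact: lim_rhs.
apply: nearW => n.
have above_le : hausdorff1 (X `&` [set x | a < f x]%R) <=
    hausdorff1 (above n) + \sum_(n <= k <oo) hausdorff1 (shell k).
  apply: le_trans (leeD (lexx _)
    (outer_measure_sigma_subadditive_tail hausdorff1 n shell)).
  apply: le_trans (outer_measureU2 hausdorff1 _ _).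
  apply: le_hausdorff1 => x [Xx /= ax].
  have [tx|xt] := ltP (t n) (f x); [by left|right].
  have ex_t : exists k, (t k < f x)%R.
    have /Num.Theory.archi_boundP : (0 <= (f x - a)^-1)%R.
      by rewrite invr_ge0 subr_ge0 ltW.
    set k := Num.bound _ => kP; exists k; rewrite /t -ltrBrDl.
    rewrite invf_plt ?posrE ?subr_gt0//.
    by rewrite (lt_trans kP)// ltr_nat.
  case: (ex_minnP ex_t) => -[|m] tm mP.
    by have := le_lt_trans (le_trans xt (t_le (leq0n n))) tm; rewrite ltxx.
  have nm : (n <= m)%N.
    rewrite leqNgt; apply/negP => mn.
    by have := le_lt_trans (le_trans xt (t_le mn)) tm; rewrite ltxx.
  exists m; first by move=> /=; apply/negP; rewrite -leqNgt.
  split => //=; rewrite tm leNgt /=; apply/negP => /mP.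
  by rewrite ltnn.
apply: le_trans (leeD above_le (lexx _)) _.
rewrite -addeA [X in _ + X]addeC addeA leeD2r//.
apply: (@le_trans _ _ (hausdorff1 (above n `|` (X `&` ~` [set x | a < f x]%R)))).
  apply: (@hausdorff1_separated _ _ (n.+1%:R^-1)) => //.
  move=> x y [_ /= tx] [_ /= /negP]; rewrite -leNgt => ya.
  by rewrite (le_trans _ (ltW tx))// lerD2r.
by apply: le_hausdorff1 => x [[]|[]].
Qed.

End half_plane.

Lemma caratheodory_half_plane (a : R) :
  hausdorff1.-caratheodory [set x | a < f x]%R.
Proof.
by apply: le_caratheodory_measurable => X; exact: hausdorff1_half_plane_le.
Qed.

Lemma caratheodory_preimage (B : set (measurableTypeR R)) : measurable B ->
  hausdorff1.-caratheodory (f @^-1` B).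
Proof.
move=> mB0.
have mB : (@RGenOInfty.G R).-sigma.-measurable B.
  by rewrite -RGenOInfty.measurableE.
suff : <<s @RGenOInfty.G R >> `<=`
    [set C | hausdorff1.-caratheodory (f @^-1` C)] by exact.
apply: smallest_sub.
  split => /=.
  - by rewrite preimage_set0; exact: caratheodory_measurable_set0.
  - by move=> C mC; rewrite setTD preimage_setC; exact: caratheodory_measurable_setC.
  - move=> F mF; rewrite preimage_bigcup.
    exact: caratheodory_measurable_bigcup.
move=> _ [a ->] /=.
rewrite (_ : _ @^-1` _ = [set x | a < f x]%R); first exact: caratheodory_half_plane.
by apply/seteqP; split => x /=; rewrite in_itv/= andbT.
Qed.

End metric_outer_measure.

Lemma borel_caratheodory (A : set (plane R)) : measurable A ->
  hausdorff1.-caratheodory A.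
Proof.
apply: smallest_sub.
  split => /=; first exact: caratheodory_measurable_set0.
  - by move=> C mC; rewrite setTD; exact: caratheodory_measurable_setC.
  - by move=> F mF; exact: caratheodory_measurable_bigcup.
move=> C [[B mB <-]|[B mB <-]]; rewrite setTI; apply: caratheodory_preimage => //.
- by move=> x y; rewrite -sqrtr_sqr ler_wsqrtr// lerDl -expr2 sqr_ge0.
- by move=> x y; rewrite -sqrtr_sqr ler_wsqrtr// lerDr -expr2 sqr_ge0.
Qed.

Let hausdorff1_semi_sigma_additive :
  semi_sigma_additive (hausdorff1 : set (plane R) -> \bar R).
Proof.
move=> F mF tF mUF.
by apply: (@caratheodory_measure_sigma_additive R _ hausdorff1) => //;
  do ?move=> i; exact: borel_caratheodory.
Qed.

HB.instance Definition _ := isMeasure.Build _ (plane R) R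
  (hausdorff1 : set (plane R) -> \bar R)
  hausdorff1_set0 hausdorff1_ge0 hausdorff1_semi_sigma_additive.

End hausdorff_measure.

Section borel_plane.
Context {R : realType}.

Lemma open_measurable_plane (U : set (R * R)) : open U ->
  measurable (U : set (plane R)).
Proof.
move=> oU.
pose box (p : (rat * rat) * (rat * rat)) : set (plane R) :=
  `]ratr p.1.1, ratr p.1.2[%classic `*` `]ratr p.2.1, ratr p.2.2[%classic.
have -> : U = \bigcup_a \bigcup_b \bigcup_c \bigcup_d
    (if `[< box (a, b, (c, d)) `<=` U >] then box (a, b, (c, d)) else set0).
  apply/seteqP; split => [[x y] Uxy|z]; last first.
    by move=> [a _ [b _ [c _ [d _]]]]; case: ifPn => // /asboolP; exact.
  have := open_nbhs_nbhs (conj oU Uxy) => /nbhs_ballP[e /= e0 xyU].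
  have ex (v : R) : exists a b : rat, `]ratr a, ratr b[%classic v /\
      `]ratr a, ratr b[%classic `<=` ball v e.
    have /rat_in_itvoo[a /itvP av] : v - e < v by rewrite ltrBlDr ltrDl.
    have /rat_in_itvoo[b /itvP bv] : v < v + e by rewrite ltrDl.
    exists a, b; split; first by rewrite /= in_itv/= av bv.
    move=> w /=; rewrite in_itv/= => /andP[aw wb].
    rewrite /ball/= ltr_distlC; apply/andP; split.
      by rewrite (lt_trans _ aw)// av.
    by rewrite (lt_trans wb)// bv.
  have [a [b [xab abx]]] := ex x; have [c [d [ycd cdy]]] := ex y.
  exists a => //; exists b => //; exists c => //; exists d => //.
  rewrite ifT//; apply/asboolP => -[x' y'] [/= x'ab y'cd].
  by apply: xyU; split; [exact: abx|exact: cdy].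
do 4 (apply: bigcupT_measurable_rat => ?).
by case: ifPn => // _; apply: measurableX; exact: measurable_itv.
Qed.

Lemma closed_measurable_plane (C : set (R * R)) : closed C ->
  measurable (C : set (plane R)).
Proof.
move=> /closed_openC /open_measurable_plane.
by rewrite -[in X in _ -> X](setCK C) => /measurableC.
Qed.

Lemma measurable_dotp (u : R * R) :
  measurable_fun [set: plane R] (dotp u : plane R -> R).
Proof.
apply: measurable_funD; apply: measurable_funM;
  by [exact: measurable_cst|exact: measurable_fst|exact: measurable_snd].
Qed.

HB.instance Definition _ (u : R * R) :=
  isMeasurableFun.Build _ _ (plane R) R (dotp u : plane R -> R)
    (measurable_dotp u).

Definition projection (u : R * R) : {mfun plane R >-> R} :=
  [the {mfun plane R >-> R} of (dotp u : plane R -> R)].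

Lemma measurable_convex_body (K : set (R * R)) : convex_body K ->
  measurable (K : set (plane R)).
Proof.
by move=> [cK _ _]; apply: closed_measurable_plane; exact: compact_closed.
Qed.

Lemma measurable_frontier (K : set (R * R)) :
  measurable (frontier K : set (plane R)).
Proof.
apply: measurableD.
- by apply: closed_measurable_plane; exact: closed_closure.
- by apply: open_measurable_plane; exact: open_interior.
Qed.

End borel_plane.

Section gini.
Context {R : realType}.
Local Open Scope ereal_scope.

Definition area : {measure set (plane R) -> \bar R} :=
  (lebesgue_measure \x lebesgue_measure)%E.

(* The arclength measure on a boundary curve is the restriction of
   one-dimensional Hausdorff measure to it. *)
Definition arclength : {measure set (plane R) -> \bar R} :=
  [the {measure set (plane R) -> \bar R} of
    (hausdorff1 : set (plane R) -> \bar R)].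

(* [mnormalize] requires a default probability, used only when the total mass is
   0 or +oo; this does not happen for the area of a convex body nor for the
   length of its boundary. *)
Definition normalized_on d (T : measurableType d)
    (mu : {measure set T -> \bar R}) (D : set T) (mD : measurable D) :
    probability T R :=
  mnormalize (mrestr mu mD) (dirac point).

Definition area_projection (K : set (R * R)) (hK : convex_body K) (u : R * R) :
    probability R R :=
  distribution (normalized_on area (measurable_convex_body hK))
    (projection u).

Definition arclength_projection (K : set (R * R)) (u : R * R) :
    probability R R :=
  distribution (normalized_on arclength (measurable_frontier K))
    (projection u).

Definition gini_mean_difference (rho : probability R R) : \bar R :=
  \int[rho \x rho]_z `|z.1 - z.2|%:E.

End gini.

(* Main.v *)
From HB Require Import structures.
Require Import Defs.
From mathcomp Require Import all_boot all_order all_algebra.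
From mathcomp Require Import all_classical all_reals all_analysis.
From mathcomp Require Import measurable_realfun ring lra.
Set Implicit Arguments.
Unset Strict Implicit.
Unset Printing Implicit Defensive.
Import Order.TTheory GRing.Theory Num.Theory.
Import numFieldNormedType.Exports.
Local Open Scope classical_set_scope.
Local Open Scope ring_scope.

(** Let [L] be the width of [K] along [u]. In coordinates adapted to [u], with the
    projection of [K] rescaled to [0, 1], the body is the region between the
    graphs of a convex function [B] and a concave function [T]. Put [f = T - B] and
    [kappa t = ((1 - t) ^ 3 + t ^ 3) / 3]. Both Gini mean differences are compared with the
    number [2 L (int f kappa) / (int f)], integrals being over [0, 1]. The link
    between them and geometry is the formula [D(rho) = 2 int F (1 - F)], where [F] is
    the distribution function of [rho] ([gini_cdf]).

    For the area, [F s] is the integral of [f] over [0, s] divided by [int f]. Since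
    [F (1 - F) <= (1 - s) ^ 2 F + s ^ 2 (1 - F)], the difference being [(F - s) ^ 2], an
    integration by parts gives the upper bound [2 L (int f kappa) / (int f)]
    ([gini_area_projection_le]).

    For the boundary, the Euclidean norm is within a factor [k] close to 1 of a
    finite sum of absolute values of linear functionals ([finite_crofton]). Along
    the upper boundary a functional is a concave function of the projection,
    increasing and then decreasing, and along the lower boundary it is, up to sign,
    of the same kind. Its variation along the part of the boundary to the left of
    [t] is therefore an explicit expression [W + D t], and [W - D t] to the right
    ([arc_length_ge], [graph_length_le], [boundary_directions]). Up to the factor [k],
    [F] and [1 - F] are at least averages of the functions [(1 + D / W) / 2] and
    [(1 - D / W) / 2], and as [x (1 - x)] is concave it is enough to bound
    [int (1 - (D / W) ^ 2) / 4] below by [(int f kappa) / (int f)] for a single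
    functional; then [k] tends to 1
    ([gini_arclength_projection_ge]).

    For one functional, [D / W = a - c] with [a] concave nondecreasing, [c] concave
    nonincreasing, [a 1 = 1 = c 0], and [a + c - 1] proportional to [f]. What is
    needed is [concave_pair_inequality]. It is proved by writing [a]
    and [c] as limits of mixtures of piecewise linear functions with one kink
    ([tent_approx]). For mixtures the quadratic terms are controlled by
    integrals of products of two tents, everything else is a polynomial in the
    first three moments of the mixing weights, and the claim becomes an inequality
    between moments that follows from Cauchy-Schwarz ([moment_inequality]). *)

(** * Integrals over subintervals of [0, 1] *)

Section unit_integral.
Context {R : realType}.
Implicit Types (f g : R -> R) (a b r : R).

Definition integ a b g : R := (\int[@lebesgue_measure R]_(x in `[a, b]) g x)%R.

(** Boundedness is required on [0, 1] only, so that polynomials qualify. *)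
Definition bmeas g := measurable_fun [set: R] g /\
  exists M, forall x, 0 <= x <= 1 -> `|g x| <= M.

Lemma bmeas_cst r : bmeas (fun=> r).
Proof. by split; [exact: measurable_cst|exists `|r|]. Qed.

Lemma bmeas_id : bmeas (fun x => x).
Proof.
by split; [exact: measurable_id|exists 1 => x /andP[x0 x1]; rewrite ger0_norm].
Qed.

Lemma bmeasD f g : bmeas f -> bmeas g -> bmeas (fun x => f x + g x).
Proof.
move=> [mf [M fM]] [mg [N gN]]; split; first exact: measurable_funD.
by exists (M + N) => x x01; rewrite (le_trans (ler_normD _ _))// lerD ?fM ?gN.
Qed.

Lemma bmeasN f : bmeas f -> bmeas (fun x => - f x).
Proof.
move=> [mf [M fM]]; split; first exact: measurable_funN.
by exists M => x x01; rewrite normrN fM.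
Qed.

Lemma bmeasB f g : bmeas f -> bmeas g -> bmeas (fun x => f x - g x).
Proof. by move=> bf bg; apply: bmeasD => //; exact: bmeasN. Qed.

Lemma bmeasM f g : bmeas f -> bmeas g -> bmeas (fun x => f x * g x).
Proof.
move=> [mf [M fM]] [mg [N gN]]; split; first exact: measurable_funM.
by exists (M * N) => x x01; rewrite normrM ler_pM ?fM ?gN.
Qed.

Lemma bmeasX f n : bmeas f -> bmeas (fun x => f x ^+ n).
Proof.
move=> bf; elim: n => [|n ih].
  by under eq_fun do rewrite expr0; exact: bmeas_cst.
by under eq_fun do rewrite exprS; exact: bmeasM.
Qed.

Lemma bmeas_norm f : bmeas f -> bmeas (fun x => `|f x|).
Proof.
move=> [mf [M fM]]; split; first exact: measurableT_comp.
by exists M => x x01; rewrite normr_id fM.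
Qed.

Lemma bmeas_sum (I : finType) (F : I -> R -> R) :
  (forall i, bmeas (F i)) -> bmeas (fun x => \sum_i F i x).
Proof.
move=> bF; rewrite (_ : (fun x => _) = \sum_i F i); last first.
  by apply/funext => x; rewrite fct_sumE.
elim/big_ind : _ => // [|f g bf bg]; first exact: bmeas_cst.
exact: bmeasD.
Qed.

Lemma bmeas_integrable a b g : 0 <= a -> b <= 1 -> bmeas g ->
  (@lebesgue_measure R).-integrable `[a, b] (EFin \o g).
Proof.
move=> a0 b1 [mg [M gM]]; apply: measurable_bounded_integrable => //.
- by rewrite /= lebesgue_measure_itv/=; case: ifPn => // _; rewrite -EFinB ltry.
- exact: measurable_funTS.
- exists M; split; first exact: num_real.
  move=> N MN x /=; rewrite in_itv/= => /andP[ax xb].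
  by rewrite (le_trans _ (ltW MN))// gM// (le_trans a0)//= (le_trans xb).
Qed.

Lemma integD a b f g : 0 <= a -> b <= 1 -> bmeas f -> bmeas g ->
  integ a b (fun x => f x + g x) = integ a b f + integ a b g.
Proof. by move=> *; rewrite /integ RintegralD//; exact: bmeas_integrable. Qed.

Lemma integB a b f g : 0 <= a -> b <= 1 -> bmeas f -> bmeas g ->
  integ a b (fun x => f x - g x) = integ a b f - integ a b g.
Proof. by move=> *; rewrite /integ RintegralB//; exact: bmeas_integrable. Qed.

Lemma integZ a b r g : 0 <= a -> b <= 1 -> bmeas g ->
  integ a b (fun x => r * g x) = r * integ a b g.
Proof. by move=> *; rewrite /integ RintegralZl//; exact: bmeas_integrable. Qed.

Lemma integ_sum a b (I : finType) (F : I -> R -> R) : 0 <= a -> b <= 1 ->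
  (forall i, bmeas (F i)) ->
  integ a b (fun x => \sum_i F i x) = \sum_i integ a b (F i).
Proof.
move=> a0 b1 bF.
have key (s : seq I) : bmeas (fun x => \sum_(i <- s) F i x) /\
    integ a b (fun x => \sum_(i <- s) F i x) = \sum_(i <- s) integ a b (F i).
  elim: s => [|i s [bs IH]].
    split; first by under eq_fun do rewrite big_nil; exact: bmeas_cst.
    rewrite big_nil; under eq_fun do rewrite big_nil.
    by rewrite /integ Rintegral_cst// mul0r.
  split.
    by under eq_fun do rewrite big_cons; exact: bmeasD.
  by rewrite big_cons; under eq_fun do rewrite big_cons; rewrite integD// IH.
exact: (key _).2.
Qed.

Lemma eq_integ a b f g : (forall x, a <= x <= b -> f x = g x) ->
  integ a b f = integ a b g.
Proof.
move=> fg; apply: eq_Rintegral => x; rewrite inE/= in_itv/=; exact: fg.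
Qed.

Lemma le_integ a b f g : 0 <= a -> b <= 1 -> bmeas f -> bmeas g ->
  (forall x, a <= x <= b -> f x <= g x) -> integ a b f <= integ a b g.
Proof.
move=> a0 b1 bf bg fg; apply: le_Rintegral => //; try exact: bmeas_integrable.
Qed.

Lemma integ_split c a b g : 0 <= a -> b <= 1 -> a <= c -> c <= b -> bmeas g ->
  integ a b g = integ a c g + integ c b g.
Proof.
move=> a0 b1 ac cb bg; apply/eqP; rewrite addrC -subr_eq; apply/eqP.
have ig := bmeas_integrable a0 b1 bg.
rewrite /integ Rintegral_itvB//; rewrite ?bnd_simp//.
rewrite Rintegral_itv_obnd_cbnd//; apply: integrableS ig => //.
by move=> x /=; rewrite !in_itv/= => /andP[cx ->]; rewrite (le_trans ac)// ltW.
Qed.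

(** All explicit integrals below are of functions that are polynomials of
    degree at most three on each of two or three intervals. *)
Lemma integ_cubic a b (c0 c1 c2 c3 : R) g : a <= b ->
  (forall x, a <= x <= b -> g x = c0 + c1 * x + c2 * x ^+ 2 + c3 * x ^+ 3) ->
  integ a b g = c0 * (b - a) + c1 * (b ^+ 2 - a ^+ 2) / 2 +
    c2 * (b ^+ 3 - a ^+ 3) / 3 + c3 * (b ^+ 4 - a ^+ 4) / 4.
Proof.
move=> ab /eq_integ ->.
move: ab; rewrite le_eqVlt => /predU1P[->|ab].
  by rewrite /integ set_itv1 Rintegral_set1 !subrr !mulr0 !mul0r !addr0.
pose P : {poly R} := c0 *: 'X + (c1 / 2) *: 'X^2 + (c2 / 3) *: 'X^3 +
   (c3 / 4) *: 'X^4.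
pose p : {poly R} := c0%:P + c1 *: 'X + c2 *: 'X^2 + c3 *: 'X^3.
have dP x : (P^`()).[x] = p.[x].
  rewrite /P !derivD !derivZ !derivXn derivX /p /=.
  rewrite !(hornerD, hornerZ, hornerMn, hornerXn, hornerX, hornerC).
  by clear; field.
rewrite /integ /Rintegral (@continuous_FTC2 _ _ (horner P))//.
- by rewrite /= /P !(hornerD, hornerZ, hornerXn, hornerX); clear; field.
- apply: continuous_subspaceT => x.
  rewrite (_ : (fun x => _) = horner p); first exact: continuous_horner.
  by apply/funext => y; rewrite /p !(hornerD, hornerZ, hornerXn, hornerX, hornerC).
- split=> [x _||].
  + exact: derivable_horner.
  + by apply: cvg_at_right_filter; exact: continuous_horner.
  + by apply: cvg_at_left_filter; exact: continuous_horner.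
- by move=> x _; rewrite -derivE dP /p !(hornerD, hornerZ, hornerXn, hornerX, hornerC).
Qed.

End unit_integral.

(** * Tent functions and their integrals *)

Section tents.
Context {R : realType}.
Implicit Types (r s t : R).
Local Notation int01 := (integ (0 : R) 1).

(** [t + ltent r t] is the minimum of [t / r] and 1 on [0, 1]: up to the addition
    of the identity these are the extreme nondecreasing concave functions with
    value 1 at 1. The value at [r = 0] is the limit [1 - t]. *)
Definition ltent r t : R := if t < r then t * (1 - r) / r else 1 - t.
(** The mirror image of [ltent]: [1 - t + rtent s t] is the minimum of 1 and
    [(1 - t) / (1 - s)] on [0, 1]. *)
Definition rtent s t : R := if t <= s then t else (1 - t) * s / (1 - s).

Lemma ltent_bound r t : 0 <= r <= 1 -> 0 <= t <= 1 -> 0 <= ltent r t <= 1.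
Proof.
move=> /andP[r0 r1] /andP[t0 t1]; rewrite /ltent; case: (ltP t r) => [tr|rt].
  have r_gt0 : 0 < r by exact: le_lt_trans tr.
  rewrite divr_ge0// ?mulr_ge0// ?subr_ge0//= ler_pdivrMr// mul1r; nra.
lra.
Qed.

Lemma rtent_bound s t : 0 <= s <= 1 -> 0 <= t <= 1 -> 0 <= rtent s t <= 1.
Proof.
move=> /andP[s0 s1] /andP[t0 t1]; rewrite /rtent; case: (leP t s) => [_|st]; first by rewrite t0.
have s_lt1 : 0 < 1 - s by rewrite subr_gt0 (lt_le_trans st).
rewrite divr_ge0// ?mulr_ge0// ?subr_ge0//= ler_pdivrMr// mul1r; nra.
Qed.

Lemma bmeas_ltent r : 0 <= r <= 1 -> bmeas (ltent r).
Proof.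
move=> r01; split.
  apply: measurable_fun_ifT => /=.
  - by apply: measurable_fun_ltr => //; exact: measurable_cst.
  - by apply: measurable_funM => //; apply: measurable_funM.
  - exact: measurable_funB.
by exists 1 => t t01; have /andP[? ?] := ltent_bound r01 t01; rewrite ger0_norm.
Qed.

Lemma bmeas_rtent s : 0 <= s <= 1 -> bmeas (rtent s).
Proof.
move=> s01; split.
  apply: measurable_fun_ifT => /=.
  - by apply: measurable_fun_ler => //; exact: measurable_cst.
  - exact: measurable_id.
  - by apply: measurable_funM => //; apply: measurable_funM => //; exact: measurable_funB.
by exists 1 => t t01; have /andP[? ?] := rtent_bound s01 t01; rewrite ger0_norm.
Qed.

Lemma integ_ltentM r (k0 k1 k2 : R) : 0 <= r <= 1 ->
  int01 (fun t => (k0 + k1 * t + k2 * t ^+ 2) * ltent r t) =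
  (1 - r) * (k0 / 2 + k1 * (1 + r) / 6 + k2 * (1 + r + r ^+ 2) / 12).
Proof.
move=> r01; have /andP[r0 r1] := r01.
have bm : bmeas (fun t => (k0 + k1 * t + k2 * t ^+ 2) * ltent r t).
  apply: bmeasM (bmeas_ltent r01); apply: bmeasD.
    by apply: bmeasD; [exact: bmeas_cst|apply: bmeasM; [exact: bmeas_cst|exact: bmeas_id]].
  by apply: bmeasM; [exact: bmeas_cst|exact/bmeasX/bmeas_id].
have [r_eq0|r_neq0] := eqVneq r 0.
  rewrite (@integ_cubic _ _ _ k0 (k1 - k0) (k2 - k1) (- k2)) ?ler01//.
    by rewrite r_eq0; field.
  by move=> x /andP[x0 _]; rewrite /ltent r_eq0 ltNge x0 /=; ring.
rewrite (integ_split _ _ r0)//.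
rewrite (@integ_cubic _ _ _ 0 (k0 * ((1 - r) / r)) (k1 * ((1 - r) / r)) (k2 * ((1 - r) / r)))//; last first.
  move=> x /andP[x0 xr]; rewrite /ltent; case: (ltP x r) => [_|rx]; first by ring.
  have -> : x = r by lra. by field.
rewrite (@integ_cubic _ _ _ k0 (k1 - k0) (k2 - k1) (- k2))//.
  by field.
by move=> x /andP[rx x1]; rewrite /ltent ltNge rx /=; ring.
Qed.

Lemma integ_rtentM s (k0 k1 k2 : R) : 0 <= s <= 1 ->
  int01 (fun t => (k0 + k1 * t + k2 * t ^+ 2) * rtent s t) =
  s * (k0 / 2 + k1 * (1 + s) / 6 + k2 * (1 + s + s ^+ 2) / 12).
Proof.
move=> s01; have /andP[s0 s1] := s01.
have bm : bmeas (fun t => (k0 + k1 * t + k2 * t ^+ 2) * rtent s t).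
  apply: bmeasM (bmeas_rtent s01); apply: bmeasD.
    by apply: bmeasD; [exact: bmeas_cst|apply: bmeasM; [exact: bmeas_cst|exact: bmeas_id]].
  by apply: bmeasM; [exact: bmeas_cst|exact/bmeasX/bmeas_id].
have [s_eq1|s_neq1] := eqVneq s 1.
  rewrite (@integ_cubic _ _ _ 0 k0 k1 k2) ?ler01//.
    by rewrite s_eq1; field.
  by move=> x /andP[_ x1]; rewrite /rtent s_eq1 x1 /=; ring.
have d0 : 1 - s != 0 by rewrite subr_eq0 eq_sym.
rewrite (integ_split _ _ s0)//.
rewrite (@integ_cubic _ _ _ 0 k0 k1 k2)//; last first.
  by move=> x /andP[x0 xs]; rewrite /rtent xs; ring.
rewrite (@integ_cubic _ _ _ (k0 * (s / (1 - s))) ((k1 - k0) * (s / (1 - s)))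
  ((k2 - k1) * (s / (1 - s))) (- k2 * (s / (1 - s))))//.
  by field.
move=> x /andP[sx x1]; rewrite /rtent; case: (leP x s) => [xs|_]; last by ring.
have -> : x = s by lra. by field.
Qed.

Lemma integ_ltent_sqr r : 0 <= r <= 1 ->
  int01 (fun t => ltent r t ^+ 2) = (1 - r) ^+ 2 / 3.
Proof.
move=> r01; have /andP[r0 r1] := r01.
have bm := bmeasX 2 (bmeas_ltent r01).
have [r_eq0|r_neq0] := eqVneq r 0.
  rewrite (@integ_cubic _ _ _ 1 (- 2) 1 0) ?ler01//; first by rewrite r_eq0; field.
  by move=> x /andP[x0 _]; rewrite /ltent r_eq0 ltNge x0 /=; ring.
rewrite (integ_split _ _ r0)//.
rewrite (@integ_cubic _ _ _ 0 0 (((1 - r) / r) ^+ 2) 0)//; last first.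
  move=> x /andP[x0 xr]; rewrite /ltent; case: (ltP x r) => [_|rx]; first by ring.
  have -> : x = r by lra. by field.
rewrite (@integ_cubic _ _ _ 1 (- 2) 1 0)//.
  by field.
by move=> x /andP[rx x1]; rewrite /ltent ltNge rx /=; ring.
Qed.

Lemma integ_rtent_sqr s : 0 <= s <= 1 ->
  int01 (fun t => rtent s t ^+ 2) = s ^+ 2 / 3.
Proof.
move=> s01; have /andP[s0 s1] := s01.
have bm := bmeasX 2 (bmeas_rtent s01).
have [s_eq1|s_neq1] := eqVneq s 1.
  rewrite (@integ_cubic _ _ _ 0 0 1 0) ?ler01//; first by rewrite s_eq1; field.
  by move=> x /andP[_ x1]; rewrite /rtent s_eq1 x1 /=; ring.
have d0 : 1 - s != 0 by rewrite subr_eq0 eq_sym.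
rewrite (integ_split _ _ s0)//.
rewrite (@integ_cubic _ _ _ 0 0 1 0)//; last first.
  by move=> x /andP[x0 xs]; rewrite /rtent xs; ring.
rewrite (@integ_cubic _ _ _ ((s / (1 - s)) ^+ 2) (- 2 * (s / (1 - s)) ^+ 2)
  ((s / (1 - s)) ^+ 2) 0)//.
  by field.
move=> x /andP[sx x1]; rewrite /rtent; case: (leP x s) => [xs|_]; last by ring.
have -> : x = s by lra. by field.
Qed.

(** Cauchy-Schwarz, from [2 k l f g <= k^2 f^2 + l^2 g^2] with [k = q], [l = p];
    when [p] or [q] vanishes the other coefficient is sent to infinity. *)
Lemma integM_le_sqr (f g : R -> R) (p q : R) : 0 <= p -> 0 <= q ->
  bmeas f -> bmeas g ->
  int01 (fun t => f t ^+ 2) = p ^+ 2 / 3 -> int01 (fun t => g t ^+ 2) = q ^+ 2 / 3 ->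
  int01 (fun t => f t * g t) <= p * q / 3.
Proof.
move=> p0 q0 bf bg If Ig.
have key (k l : R) : k * l * int01 (fun t => f t * g t) *+ 2 <=
    k ^+ 2 * (p ^+ 2 / 3) + l ^+ 2 * (q ^+ 2 / 3).
  rewrite -If -Ig -!integZ// -?integD//; last first.
    all: try by [exact: bmeasX|exact: bmeasM|
      apply: bmeasM; [exact: bmeas_cst|exact: bmeasX]].
  rewrite -mulr_natr mulrC -integZ//; last first.
    by apply: bmeasM; [exact: bmeas_cst|exact: bmeasM].
  apply: le_integ => //.
  - by apply: bmeasM; [exact: bmeas_cst|apply: bmeasM; [exact: bmeas_cst|exact: bmeasM]].
  - by apply: bmeasD; apply: bmeasM; [exact: bmeas_cst|exact: bmeasX|exact: bmeas_cst|exact: bmeasX].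
  - move=> t _; have := sqr_ge0 (k * f t - l * g t); nra.
set J := int01 _ in key *.
have [p_eq0|p_neq0] := eqVneq p 0.
  have [q_eq0|q_neq0] := eqVneq q 0.
    by have := key 1 1; rewrite p_eq0 q_eq0; lra.
  rewrite leNgt; apply/negP => J0.
  have := key (q ^+ 2 / J) 1; rewrite p_eq0.
  have J_gt0 : 0 < J by move: J0; rewrite p_eq0 mul0r mul0r.
  rewrite mulr1 -mulrA mulVf ?gt_eqF//.
  have : 0 < q ^+ 2 by rewrite exprn_even_gt0.
  lra.
have [q_eq0|q_neq0] := eqVneq q 0.
  rewrite leNgt; apply/negP => J0.
  have := key 1 (p ^+ 2 / J); rewrite q_eq0.
  have J_gt0 : 0 < J by move: J0; rewrite q_eq0 mulr0 mul0r.
  rewrite mul1r -mulrA mulVf ?gt_eqF//.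
  have : 0 < p ^+ 2 by rewrite exprn_even_gt0.
  lra.
have pq : 0 < p * q by rewrite mulr_gt0// lt0r ?p_neq0 ?q_neq0.
rewrite -(ler_pM2l pq).
have := key q p; lra.
Qed.

(** The product integral has two different expressions, according to which of
    the kinks [r] and [s] comes first. The bound is attained by the pair
    [1 - t], [t] obtained for [r = 0], [s = 1]. *)
Lemma integ_ltent_rtent r s : 0 <= r <= 1 -> 0 <= s <= 1 ->
  (1 - r) * s / 6 <= int01 (fun t => ltent r t * rtent s t).
Proof.
move=> r01 s01; have /andP[r0 r1] := r01; have /andP[s0 s1] := s01.
have bm := bmeasM (bmeas_ltent r01) (bmeas_rtent s01).
have [r_eq0|r_neq0] := eqVneq r 0.
  rewrite (@eq_integ _ _ _ _ (fun t => (1 + (-1) * t + 0 * t ^+ 2) * rtent s t)).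
    by rewrite integ_rtentM//; nra.
  by move=> x /andP[x0 _]; rewrite /ltent r_eq0 ltNge x0 /=; ring.
have [s_eq1|s_neq1] := eqVneq s 1.
  rewrite (@eq_integ _ _ _ _ (fun t => (0 + 1 * t + 0 * t ^+ 2) * ltent r t)).
    by rewrite integ_ltentM//; nra.
  by move=> x /andP[_ x1]; rewrite /rtent s_eq1 x1 /=; ring.
have d0 : 1 - s != 0 by rewrite subr_eq0 eq_sym.
have r_gt0 : 0 < r by rewrite lt0r r_neq0.
have d_gt0 : 0 < 1 - s by rewrite lt0r d0 subr_ge0.
have [rs|sr] := leP r s.
  rewrite (integ_split _ _ r0)// (integ_split _ _ rs)//.
  rewrite (@integ_cubic _ _ _ 0 0 ((1 - r) / r) 0)//; last first.
    move=> x /andP[x0 xr]; rewrite /rtent (le_trans xr)//.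
    rewrite /ltent; case: (ltP x r) => [_|rx]; first by ring.
    have -> : x = r by lra. by field.
  rewrite (@integ_cubic _ _ _ 0 1 (-1) 0)//; last first.
    by move=> x /andP[rx xs]; rewrite /rtent /ltent xs ltNge rx /=; ring.
  rewrite (@integ_cubic _ _ _ (s / (1 - s)) (- 2 * s / (1 - s)) (s / (1 - s)) 0)//; last first.
    move=> x /andP[sx x1]; rewrite /ltent /rtent ltNge (le_trans rs sx)/=.
    case: (leP x s) => [xs|_]; last by ring.
    have -> : x = s by lra. by field.
  rewrite [leRHS](_ : _ = (2 * s - r ^+ 2 - s ^+ 2) / 6); last first.
    by field; rewrite r_neq0 d0.
  by nra.
have sr' := ltW sr.
rewrite (integ_split _ _ s0)// (integ_split _ _ sr')//.
rewrite (@integ_cubic _ _ _ 0 0 ((1 - r) / r) 0)//; last first.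
  move=> x /andP[x0 xs]; rewrite /rtent xs /ltent (le_lt_trans xs)//; ring.
rewrite (@integ_cubic _ _ _ 0 ((1 - r) / r * (s / (1 - s))) (- ((1 - r) / r * (s / (1 - s)))) 0)//; last first.
  move=> x /andP[sx xr]; rewrite /rtent /ltent.
  case: (leP x s) => [xs|sx'].
    have -> : x = s by lra.
    by rewrite sr; field; rewrite r_neq0 d0.
  case: (ltP x r) => [xr'|rx]; first by ring.
  have -> : x = r by lra.
  by field; rewrite r_neq0 d0.
rewrite (@integ_cubic _ _ _ (s / (1 - s)) (- 2 * s / (1 - s)) (s / (1 - s)) 0)//; last first.
  move=> x /andP[rx x1]; rewrite /ltent /rtent ltNge rx /= leNgt (lt_le_trans sr rx)/=; ring.
rewrite [leRHS](_ : _ = (1 - r) * s * (2 * r - r ^+ 2 - s ^+ 2) / (6 * r * (1 - s))); last first.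
  by field; rewrite r_neq0 d0.
rewrite ler_pdivlMr ?mulr_gt0//.
have : 0 <= (1 - r) * s by rewrite mulr_ge0// subr_ge0.
have : 0 <= (2 * r - r ^+ 2 - s ^+ 2) - r * (1 - s).
  have : 0 <= r * (1 - r) by rewrite mulr_ge0// subr_ge0.
  have : 0 <= s * (r - s) by rewrite mulr_ge0// subr_ge0 ltW.
  lra.
move=> h1 h2; have := mulr_ge0 h2 h1; lra.
Qed.

End tents.

(** * An inequality between moments *)

Section mixtures.
Context {R : realType}.
Local Notation int01 := (integ (0 : R) 1).

(** For a probability [w] on points [z i] of [0, 1] with moments [M], [m2], [m3],
    the number [k] is the mean of [z] under the weights [w i * (1 - z i)]; it
    turns the Cauchy-Schwarz bound into one without a quotient, including the
    degenerate case [M = 1], where all the [z i] are 1. *)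
Lemma moment_quotient (M m2 m3 : R) : M <= 1 -> m3 <= m2 ->
  M ^+ 2 <= m2 -> (M - m2) ^+ 2 <= (m2 - m3) * (1 - M) ->
  exists k : R, [/\ M - m2 = (1 - M) * k, (1 - M) * k ^+ 2 <= m2 - m3 & k <= M].
Proof.
move=> M1 m32 Mm2 cs; have [M_eq1|M_neq1] := eqVneq M 1.
  have e : M - m2 = 0.
    by apply/eqP; rewrite -sqrf_eq0 eq_le sqr_ge0 andbT (le_trans cs)// M_eq1 subrr mulr0.
  exists 0; rewrite e mulr0 expr0n /= mulr0 subr_ge0 m32; split => //.
  by rewrite M_eq1 ler01.
have d0 : 0 < 1 - M by rewrite subr_gt0 lt_neqAle M_neq1.
exists ((M - m2) / (1 - M)); split.
- by rewrite mulrC divfK// gt_eqF.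
- rewrite [leLHS](_ : _ = (M - m2) ^+ 2 / (1 - M)); last by field; rewrite gt_eqF.
  by rewrite ler_pdivrMr.
- by rewrite ler_pdivrMr//; lra.
Qed.

(** Once [M - m2] and [N - n2] are expressed through the biased means [k] and [l],
    the difference of the two sides is a sum of terms that are visibly
    nonnegative when [N <= M]. *)
Lemma moment_inequality_wlog (M N m2 m3 n2 n3 X : R) : N <= M ->
  0 <= N -> M <= 1 -> m3 <= m2 -> n3 <= n2 ->
  M ^+ 2 <= m2 -> N ^+ 2 <= n2 ->
  (M - m2) ^+ 2 <= (m2 - m3) * (1 - M) ->
  (N - n2) ^+ 2 <= (n2 - n3) * (1 - N) ->
  X <= M ^+ 2 + N ^+ 2 - M * N + (M - 2 * m2) + (N - 2 * n2) ->
  (M + N) / 2 * X <= (m2 - m3) + (n2 - n3).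
Proof.
move=> NM N0 M1 m32 n32 Mm Nn csM csN XB.
have [k [dk Sk kM]] := moment_quotient M1 m32 Mm csM.
have [l [el Sl lN]] := moment_quotient (le_trans NM M1) n32 Nn csN.
have Q0 : 0 <= (M + N) / 2 by rewrite divr_ge0// addr_ge0// (le_trans N0).
apply: le_trans (ler_wpM2l Q0 XB) _.
set Q := (M + N) / 2 in Q0 *.
apply: (@le_trans _ _ ((1 - M) * k ^+ 2 + (1 - N) * l ^+ 2)); last by lra.
have -> : M ^+ 2 + N ^+ 2 - M * N + (M - 2 * m2) + (N - 2 * n2) =
  2 * ((1 - M) * k) - M * (1 - M) + (2 * ((1 - N) * l) - N * (1 - N)) - M * N.
  rewrite -dk -el; ring.
(* [Q] is the average of [M] and [N], and [l <= N <= M] controls the second term *)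
rewrite -subr_ge0.
have -> : (1 - M) * k ^+ 2 + (1 - N) * l ^+ 2 - Q * (2 * ((1 - M) * k) -
    M * (1 - M) + (2 * ((1 - N) * l) - N * (1 - N)) - M * N) =
  (1 - M) * (k - Q) ^+ 2 + (1 - N) * ((N - l) * (2 * Q - N - l)) +
  ((M - N) * ((1 - M) * (M - N) / 2 + N ^+ 2) + 2 * M * N ^+ 2) / 2.
  by rewrite /Q; field.
have D0 : 0 <= 1 - M by rewrite subr_ge0.
have E0 : 0 <= 1 - N by rewrite subr_ge0 (le_trans NM).
have MN0 : 0 <= M - N by rewrite subr_ge0.
have M0 : 0 <= M by exact: le_trans NM.
apply: addr_ge0; first apply: addr_ge0.
- by rewrite mulr_ge0// sqr_ge0.
- rewrite mulr_ge0// mulr_ge0 ?subr_ge0// /Q; lra.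
- rewrite divr_ge0// addr_ge0 ?mulr_ge0 ?sqr_ge0// addr_ge0 ?sqr_ge0//.
  by rewrite divr_ge0// mulr_ge0.
Qed.

(** Here [M], [m2], [m3] and [N], [n2], [n3] stand for the first three moments of
    two probabilities on [0, 1]; the hypotheses relating them are
    Cauchy-Schwarz bounds. *)
Lemma moment_inequality (M N m2 m3 n2 n3 X : R) :
  0 <= M <= 1 -> 0 <= N <= 1 -> m3 <= m2 -> n3 <= n2 ->
  M ^+ 2 <= m2 -> N ^+ 2 <= n2 ->
  (M - m2) ^+ 2 <= (m2 - m3) * (1 - M) ->
  (N - n2) ^+ 2 <= (n2 - n3) * (1 - N) ->
  X <= M ^+ 2 + N ^+ 2 - M * N + (M - 2 * m2) + (N - 2 * n2) ->
  (M + N) / 2 * X <= (m2 - m3) + (n2 - n3).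
Proof.
move=> /andP[M0 M1] /andP[N0 N1] m32 n32 Mm Nn csM csN XB.
have [NM|MN] := leP N M; first exact: moment_inequality_wlog.
rewrite [leRHS]addrC [M + N]addrC.
by apply: moment_inequality_wlog => //; [exact: ltW|lra].
Qed.

Lemma weighted_cauchy_schwarz (I : finType) (w p q : I -> R) :
  (forall i, 0 <= w i) ->
  (\sum_i w i * (p i * q i)) ^+ 2 <=
  (\sum_i w i * p i ^+ 2) * (\sum_i w i * q i ^+ 2).
Proof.
move=> w0; set B := \sum_i _ * (_ * _); set A := \sum_i w i * p i ^+ 2.
set C := \sum_i _.
have key (x y : R) : 0 <= x ^+ 2 * A - 2 * x * y * B + y ^+ 2 * C.
  rewrite /A /B /C !mulr_sumr -sumrB -big_split/=; apply: sumr_ge0 => i _.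
  rewrite [X in _ <= X](_ : _ = w i * (x * p i - y * q i) ^+ 2); last by ring.
  by rewrite mulr_ge0// sqr_ge0.
have A0 : 0 <= A by apply: sumr_ge0 => i _; rewrite mulr_ge0// sqr_ge0.
have C0 : 0 <= C by apply: sumr_ge0 => i _; rewrite mulr_ge0// sqr_ge0.
move: A B C key A0 C0 => A B C key A0 C0 {p q w w0}.
have [A_eq0|A_neq0] := eqVneq A 0.
  have := key (C + 1) B; rewrite A_eq0 mul0r mulr0 add0r => h.
  have h1 : 0 <= B ^+ 2 * C by rewrite mulr_ge0// sqr_ge0.
  have h2 : 0 <= - (B ^+ 2 * C) - 2 * B ^+ 2 by lra.
  have h3 : B ^+ 2 <= 0 by lra.
  by [].
have A_gt0 : 0 < A by rewrite lt0r A_neq0.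
rewrite -(ler_pM2l A_gt0) -subr_ge0.
by rewrite [X in _ <= X](_ : _ = B ^+ 2 * A - 2 * B * A * B + A ^+ 2 * C)//; ring.
Qed.

End mixtures.

(** * The inequality for mixtures of tents *)

Section mixture_integrals.
Context {R : realType}.
Local Notation int01 := (integ (0 : R) 1).

Lemma bmeas_mix (I : finType) (w : I -> R) (F : I -> R -> R) :
  (forall i, bmeas (F i)) -> bmeas (fun t => \sum_i w i * F i t).
Proof.
by move=> bF; apply: bmeas_sum => i; apply: bmeasM => //; exact: bmeas_cst.
Qed.

Lemma integ_mixM (I : finType) (w : I -> R) (F : I -> R -> R) (p : R -> R) :
  (forall i, bmeas (F i)) -> bmeas p ->
  int01 (fun t => p t * (\sum_i w i * F i t)) =
  \sum_i w i * int01 (fun t => p t * F i t).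
Proof.
move=> bF bp; rewrite -(eq_bigr _ (fun i _ => integZ _ _ _ (bmeasM bp (bF i))))//.
rewrite -integ_sum//; last first.
  by move=> i; apply: bmeasM; [exact: bmeas_cst|exact: bmeasM].
by apply: eq_integ => t _; rewrite mulr_sumr; apply: eq_bigr => i _; rewrite mulrCA.
Qed.

Lemma integ_mix_mix (I J : finType) (w : I -> R) (v : J -> R)
    (F : I -> R -> R) (G : J -> R -> R) :
  (forall i, bmeas (F i)) -> (forall j, bmeas (G j)) ->
  int01 (fun t => (\sum_i w i * F i t) * (\sum_j v j * G j t)) =
  \sum_i \sum_j w i * v j * int01 (fun t => F i t * G j t).
Proof.
move=> bF bG; rewrite (@eq_integ _ _ _ _
   (fun t => (\sum_j v j * G j t) * (\sum_i w i * F i t))); last first.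
  by move=> t _; rewrite mulrC.
rewrite integ_mixM//; last exact: bmeas_mix.
apply: eq_bigr => i _; rewrite (@eq_integ _ _ _ _
   (fun t => F i t * (\sum_j v j * G j t))); last by move=> t _; rewrite mulrC.
by rewrite integ_mixM// mulr_sumr; apply: eq_bigr => j _; rewrite mulrA.
Qed.

(** Every term is a polynomial in the first three moments of the weights, taken
    at the points [1 - r i] and [s j], apart from the three integrals of products
    of tents. Those enter through two upper bounds (a square of a mixture) and
    one lower bound (the product of the two mixtures), and
    [moment_inequality] absorbs the loss. *)
Lemma tent_mixture_inequality (I J : finType) (w r : I -> R) (v s : J -> R)
    (a := fun t => \sum_i w i * ltent (r i) t)
    (b := fun t => \sum_j v j * rtent (s j) t) :
  (forall i, 0 <= w i) -> \sum_i w i = 1 -> (forall i, 0 <= r i <= 1) ->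
  (forall j, 0 <= v j) -> \sum_j v j = 1 -> (forall j, 0 <= s j <= 1) ->
  (int01 a + int01 b) * (int01 (fun t => (a t - b t) ^+ 2) -
     2 * int01 (fun t => (1 - 2 * t) * (a t - b t))) <=
  4 * int01 (fun t => (t * (1 - t) - 6^-1) * (a t + b t)).
Proof.
move=> w0 w1 r01 v0 v1 s01.
have bl i : bmeas (ltent (r i)) by exact: bmeas_ltent.
have br j : bmeas (rtent (s j)) by exact: bmeas_rtent.
have ba : bmeas a by exact: bmeas_mix.
have bb : bmeas b by exact: bmeas_mix.
have bquad (k0 k1 k2 : R) : bmeas (fun t => k0 + k1 * t + k2 * t ^+ 2).
  apply: bmeasD; last by apply: bmeasM; [exact: bmeas_cst|exact/bmeasX/bmeas_id].
  by apply: bmeasD; [exact: bmeas_cst|apply: bmeasM; [exact: bmeas_cst|exact: bmeas_id]].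
pose z i := 1 - r i.
have z0 i : 0 <= z i by rewrite subr_ge0; case/andP: (r01 i).
have z1 i : z i <= 1 by rewrite gerBl; case/andP: (r01 i).
have s0 j : 0 <= s j by case/andP: (s01 j).
have s1 j : s j <= 1 by case/andP: (s01 j).
pose M := \sum_i w i * z i; pose m2 := \sum_i w i * z i ^+ 2.
pose m3 := \sum_i w i * z i ^+ 3.
pose N := \sum_j v j * s j; pose n2 := \sum_j v j * s j ^+ 2.
pose n3 := \sum_j v j * s j ^+ 3.
have aq (k0 k1 k2 : R) : int01 (fun t => (k0 + k1 * t + k2 * t ^+ 2) * a t) =
    (k0 / 2 + k1 / 3 + k2 / 4) * M - (k1 / 6 + k2 / 4) * m2 + k2 / 12 * m3.
  rewrite /a integ_mixM//; under eq_bigr do rewrite integ_ltentM//.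
  rewrite /M /m2 /m3 !mulr_sumr -sumrB -big_split/=; apply: eq_bigr => i _.
  by rewrite /z; field.
have bq (k0 k1 k2 : R) : int01 (fun t => (k0 + k1 * t + k2 * t ^+ 2) * b t) =
    (k0 / 2 + k1 / 6 + k2 / 12) * N + (k1 / 6 + k2 / 12) * n2 + k2 / 12 * n3.
  rewrite /b integ_mixM//; under eq_bigr do rewrite integ_rtentM//.
  rewrite /N /n2 /n3 !mulr_sumr -!big_split/=; apply: eq_bigr => i _.
  by field.
have Ia : int01 a = M / 2.
  rewrite (@eq_integ _ _ _ _ (fun t => (1 + 0 * t + 0 * t ^+ 2) * a t)).
    by rewrite aq; field.
  by move=> t _; ring.
have Ib : int01 b = N / 2.
  rewrite (@eq_integ _ _ _ _ (fun t => (1 + 0 * t + 0 * t ^+ 2) * b t)).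
    by rewrite bq; field.
  by move=> t _; ring.
have S_eq : 4 * int01 (fun t => (t * (1 - t) - 6^-1) * (a t + b t)) =
    ((m2 - m3) + (n2 - n3)) / 3.
  rewrite (@eq_integ _ _ _ _ (fun t => (- 6^-1 + 1 * t + (-1) * t ^+ 2) * a t +
      (- 6^-1 + 1 * t + (-1) * t ^+ 2) * b t)); last by move=> t _; ring.
  by rewrite integD//; [rewrite aq bq; field|exact: bmeasM..].
have L_eq : int01 (fun t => (1 - 2 * t) * (a t - b t)) =
    (2 * m2 - M) / 6 - (N - 2 * n2) / 6.
  rewrite (@eq_integ _ _ _ _ (fun t => (1 + (-2) * t + 0 * t ^+ 2) * a t -
      (1 + (-2) * t + 0 * t ^+ 2) * b t)); last by move=> t _; ring.
  by rewrite integB//; [rewrite aq bq; field|exact: bmeasM..].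
have aa : int01 (fun t => a t * a t) <= M ^+ 2 / 3.
  rewrite /a integ_mix_mix// expr2 /M mulr_suml mulr_suml; apply: ler_sum => i _.
  rewrite mulr_sumr mulr_suml; apply: ler_sum => j _.
  apply: (@le_trans _ _ (w i * w j * (z i * z j / 3))); last by rewrite le_eqVlt; apply/orP; left; apply/eqP; ring.
  rewrite ler_wpM2l ?mulr_ge0//; apply: integM_le_sqr => //.
  - exact: integ_ltent_sqr.
  - exact: integ_ltent_sqr.
have bb2 : int01 (fun t => b t * b t) <= N ^+ 2 / 3.
  rewrite /b integ_mix_mix// expr2 /N mulr_suml mulr_suml; apply: ler_sum => i _.
  rewrite mulr_sumr mulr_suml; apply: ler_sum => j _.
  apply: (@le_trans _ _ (v i * v j * (s i * s j / 3))); last by rewrite le_eqVlt; apply/orP; left; apply/eqP; ring.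
  rewrite ler_wpM2l ?mulr_ge0//; apply: integM_le_sqr => //.
  - exact: integ_rtent_sqr.
  - exact: integ_rtent_sqr.
have ab : M * N / 6 <= int01 (fun t => a t * b t).
  rewrite /a /b integ_mix_mix// /M /N !mulr_suml; apply: ler_sum => i _.
  rewrite mulr_sumr mulr_suml; apply: ler_sum => j _.
  apply: (@le_trans _ _ (w i * v j * (z i * s j / 6))); first by rewrite le_eqVlt; apply/orP; left; apply/eqP; ring.
  by rewrite ler_wpM2l ?mulr_ge0//; exact: integ_ltent_rtent.
have sq_eq : int01 (fun t => (a t - b t) ^+ 2) = int01 (fun t => a t * a t) +
    int01 (fun t => b t * b t) - 2 * int01 (fun t => a t * b t).
  rewrite -integZ//; last exact: bmeasM.
  rewrite -integD//; try exact: bmeasM.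
  rewrite -integB//; [|by apply: bmeasD; exact: bmeasM|
    by apply: bmeasM; [exact: bmeas_cst|exact: bmeasM]].
  by apply: eq_integ => t _; ring.
rewrite S_eq Ia Ib L_eq sq_eq.
set Iaa := int01 _ in aa *; set Ibb := int01 _ in bb2 *.
set Iab := int01 _ in ab *.
have M01 : 0 <= M <= 1.
  rewrite sumr_ge0/=; last by move=> i _; rewrite mulr_ge0.
  by rewrite -w1 ler_sum// => i _; rewrite ler_piMr.
have N01 : 0 <= N <= 1.
  rewrite sumr_ge0/=; last by move=> i _; rewrite mulr_ge0.
  by rewrite -v1 ler_sum// => i _; rewrite ler_piMr.
have m32 : m3 <= m2.
  by apply: ler_sum => i _; rewrite ler_wpM2l// exprS ler_piMl// sqr_ge0.
have n32 : n3 <= n2.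
  by apply: ler_sum => i _; rewrite ler_wpM2l// exprS ler_piMl// sqr_ge0.
have Mm : M ^+ 2 <= m2.
  have := weighted_cauchy_schwarz (fun=> 1) z w0.
  under eq_bigr do rewrite mul1r; under [X in X * _]eq_bigr do rewrite expr1n mulr1.
  by rewrite w1 mul1r.
have Nn : N ^+ 2 <= n2.
  have := weighted_cauchy_schwarz (fun=> 1) s v0.
  under eq_bigr do rewrite mul1r; under [X in X * _]eq_bigr do rewrite expr1n mulr1.
  by rewrite v1 mul1r.
(* Cauchy-Schwarz with the weights u k * (1 - y k), whose total is 1 - M *)
have cs (K : finType) (u y : K -> R) : (forall k, 0 <= u k) -> (forall k, y k <= 1) ->
    \sum_k u k = 1 ->
    (\sum_k u k * y k - \sum_k u k * y k ^+ 2) ^+ 2 <=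
    (\sum_k u k * y k ^+ 2 - \sum_k u k * y k ^+ 3) * (1 - \sum_k u k * y k).
  move=> u0 y1 u1.
  have uy0 k : 0 <= u k * (1 - y k) by rewrite mulr_ge0// subr_ge0.
  have := weighted_cauchy_schwarz y (fun=> 1) uy0.
  have -> : 1 - \sum_k u k * y k = \sum_k (u k - u k * y k) by rewrite sumrB u1.
  rewrite -!sumrB.
  have -> : \sum_k u k * (1 - y k) * (y k * 1) = \sum_k (u k * y k - u k * y k ^+ 2).
    by apply: eq_bigr => k _; ring.
  have -> : \sum_k u k * (1 - y k) * y k ^+ 2 = \sum_k (u k * y k ^+ 2 - u k * y k ^+ 3).
    by apply: eq_bigr => k _; ring.
  have -> // : \sum_k u k * (1 - y k) * 1 ^+ 2 = \sum_k (u k - u k * y k).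
  by apply: eq_bigr => k _; ring.
have csM := cs _ w z w0 z1 w1.
have csN := cs _ v s v0 s1 v1.
pose X := 3 * (Iaa + Ibb - 2 * Iab - 2 * ((2 * m2 - M) / 6 - (N - 2 * n2) / 6)).
have XB : X <= M ^+ 2 + N ^+ 2 - M * N + (M - 2 * m2) + (N - 2 * n2).
  by rewrite /X; lra.
have := moment_inequality M01 N01 m32 n32 Mm Nn csM csN XB.
rewrite [X in _ -> X <= _](_ : _ = (M + N) / 2 * X / 3); first by rewrite ler_pM2r.
by rewrite /X; field.
Qed.

End mixture_integrals.

(** * Concave functions as mixtures of tents *)

Section tent_approximation.
Context {R : realType}.
Local Notation int01 := (integ (0 : R) 1).
Implicit Types (f g a c : R -> R).

(** Stated on [0, 1] only: the functions of interest are arbitrary outside. *)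
Definition concave01 f := forall x y l, 0 <= x <= 1 -> 0 <= y <= 1 ->
  0 <= l <= 1 -> l * f x + (1 - l) * f y <= f (l * x + (1 - l) * y).

Definition nondecr01 f := forall x y, 0 <= x -> x <= y -> y <= 1 -> f x <= f y.

Definition grid (n k : nat) : R := k%:R / n.+1%:R.

Lemma grid0 n : grid n 0 = 0. Proof. by rewrite /grid mul0r. Qed.

Lemma grid1 n : grid n n.+1 = 1. Proof. by rewrite /grid divff// pnatr_eq0. Qed.

Lemma le_grid n k l : (k <= l)%N -> grid n k <= grid n l.
Proof. by move=> kl; rewrite /grid ler_wpM2r ?invr_ge0// ler_nat. Qed.

Lemma lt_grid n k l : (k < l)%N -> grid n k < grid n l.
Proof. by move=> kl; rewrite /grid ltr_pM2r ?invr_gt0// ltr_nat. Qed.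

Lemma gridS n k : grid n k.+1 = grid n k + n.+1%:R^-1.
Proof. by rewrite /grid -natr1 mulrDl mul1r. Qed.

Lemma grid_ge0 n k : 0 <= grid n k. Proof. by rewrite divr_ge0. Qed.

Lemma grid_le1 n k : (k <= n.+1)%N -> grid n k <= 1.
Proof. by move=> kn; rewrite -(grid1 n) le_grid. Qed.

(** On each cell of the grid both functions stay between the same two values, so
    the error is at most the increment of [f] there; the increments telescope. *)
Lemma nondecr_eq_grid_L1 n f g : bmeas f -> bmeas g -> nondecr01 f -> nondecr01 g ->
  (forall k, (k <= n.+1)%N -> f (grid n k) = g (grid n k)) ->
  int01 (fun t => `|f t - g t|) <= (f 1 - f 0) / n.+1%:R.
Proof.
move=> bf bg ndf ndg fg.
have bh : bmeas (fun t => `|f t - g t|) by exact/bmeas_norm/bmeasB.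
suff H k : (k <= n.+1)%N -> integ 0 (grid n k) (fun t => `|f t - g t|) <=
    (f (grid n k) - f 0) / n.+1%:R.
  by have := H n.+1 (leqnn _); rewrite grid1.
elim: k => [_|k IH kn].
  by rewrite grid0 subrr mul0r /integ set_itv1 Rintegral_set1.
have gk1 : grid n k.+1 <= 1 by exact: grid_le1.
have gkS := le_grid n (leqnSn k).
rewrite (@integ_split _ (grid n k))// ?grid_ge0//.
apply: (@le_trans _ _ ((f (grid n k) - f 0) / n.+1%:R +
   (f (grid n k.+1) - f (grid n k)) / n.+1%:R)).
  apply: lerD; first exact/IH/ltnW.
  have -> : (f (grid n k.+1) - f (grid n k)) / n.+1%:R =
      integ (grid n k) (grid n k.+1) (fun=> f (grid n k.+1) - f (grid n k)).
    rewrite (@integ_cubic _ _ _ (f (grid n k.+1) - f (grid n k)) 0 0 0)//.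
      by rewrite gridS; ring.
    by move=> x _; ring.
  apply: le_integ => //; [exact: grid_ge0|exact: bmeas_cst|].
  move=> x /andP[kx xk].
  have x0 : 0 <= x := le_trans (grid_ge0 n k) kx.
  have x1 : x <= 1 := le_trans xk gk1.
  have h1 := ndf _ _ (grid_ge0 n k) kx x1.
  have h2 := ndf _ _ x0 xk gk1.
  have h3 := ndg _ _ (grid_ge0 n k) kx x1.
  have h4 := ndg _ _ x0 xk gk1.
  rewrite -!fg// in h3 h4; last exact: ltnW.
  by rewrite ler_norml; lra.
by rewrite -mulrDl addrC subrKA.
Qed.

Lemma second_difference_sum (d g : nat -> R) (k n : nat) :
  (forall i, d i = g i - g i.+1) ->
  \sum_(k <= i < k + n) (i.+1 - k)%:R * (d i - d i.+1) =
  g k - g (k + n)%N - n%:R * d (k + n)%N.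
Proof.
move=> dE; elim: n => [|n IH]; first by rewrite addn0 big_geq// subrr mul0r subrr.
rewrite addnS big_nat_recr/=; last by rewrite leq_addr.
rewrite IH subSn ?leq_addr// addKn (dE (k + n)%N) -natr1; ring.
Qed.

(** The mixture is the piecewise linear interpolation of [f] on the grid: the
    weight of the tent with kink at the i-th grid point is [i] times the opposite
    of the second difference of [f] there, nonnegative by concavity. *)
Lemma tent_approx f n : concave01 f -> nondecr01 f -> f 1 = 1 -> 0 <= f 0 ->
  exists (w r : 'I_n.+2 -> R),
  [/\ forall i, 0 <= w i, \sum_i w i = 1, forall i, 0 <= r i <= 1,
      nondecr01 (fun t => t + \sum_i w i * ltent (r i) t) &
      forall k, (k <= n.+1)%N ->
        f (grid n k) = grid n k + \sum_i w i * ltent (r i) (grid n k)].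
Proof.
move=> cf ndf f1 f0.
pose g k := if (k <= n.+1)%N then 1 - f (grid n k) else 0.
pose d k := g k - g k.+1.
have gn : g n.+1 = 0 by rewrite /g leqnn grid1 f1 subrr.
have gnS : g n.+2 = 0 by rewrite /g ltnn.
have g_ge0 k : 0 <= g k.
  by rewrite /g; case: ifP => // kn; rewrite subr_ge0 -f1 ndf ?grid_ge0 ?grid_le1.
have dd k : (k <= n)%N -> 0 <= d k - d k.+1.
  rewrite leq_eqVlt => /predU1P[->|kn].
    by rewrite /d gn gnS subr0 subrr subr0.
  have k3 : (k.+2 <= n.+1)%N by [].
  have k2 := ltnW k3; have k1 := ltnW k2.
  rewrite /d /g k1 k2 k3.
  have h01 : 0 <= (2^-1 : R) <= 1 by rewrite invr_ge0 ler0n invf_le1 ?ltr0n// ler1n.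
  have := cf (grid n k) (grid n k.+2) 2^-1; rewrite !grid_ge0 !grid_le1//= => /(_ isT isT h01).
  have -> : 2^-1 * grid n k + (1 - 2^-1) * grid n k.+2 = grid n k.+1.
    by rewrite !gridS; field.
  lra.
(* the tent with kink at 0 adds up with [t] to the constant 1; its weight is [f 0] *)
pose w (i : 'I_n.+2) := if i == ord0 then 1 - g 0%N else
  (i%:R : R) * (d i.-1 - d i).
pose r (i : 'I_n.+2) := grid n i.
have w_ge0 i : 0 <= w i.
  rewrite /w; case: eqP => [_|/eqP i0].
    by rewrite /g/= grid0 subKr.
  have ip : (0 < i)%N by rewrite lt0n.
  rewrite mulr_ge0//; have := dd i.-1; rewrite prednK//; apply.
  by rewrite -ltnS (prednK ip) -ltnS ltn_ord.
have r01 i : 0 <= r i <= 1 by rewrite /r grid_ge0 grid_le1// -ltnS.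
have sumE (h : nat -> R) : \sum_(i < n.+2) w i * h i =
   (1 - g 0%N) * h 0%N + \sum_(0 <= i < n.+1) i.+1%:R * (d i - d i.+1) * h i.+1.
  rewrite big_ord_recl /w eqxx; congr (_ + _).
  by rewrite big_mkord; apply: eq_bigr => i _.
have S0 : \sum_(0 <= i < n.+1) i.+1%:R * (d i - d i.+1) = g 0%N.
  have := @second_difference_sum d g 0 n.+1 (fun=> erefl).
  rewrite add0n gn (_ : d n.+1 = 0) ?mulr0 ?subr0; last by rewrite /d gn gnS subr0.
  by move=> <-; apply: eq_bigr => i _; rewrite subn0.
have w1 : \sum_i w i = 1.
  under eq_bigr do rewrite -[w _]mulr1; rewrite (sumE (fun=> 1)).
  under eq_bigr do rewrite mulr1.
  by rewrite S0; ring.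
exists w, r; split => //.
- move=> x y x0 xy y1.
  have ltent_slope (q : R) : 0 <= q <= 1 -> x + ltent q x <= y + ltent q y.
    move=> /andP[q0 q1]; rewrite /ltent.
    case: (ltP y q) => [yq|qy].
      rewrite (le_lt_trans xy yq) lerD// -!mulrA ler_wpM2r// divr_ge0//; lra.
    case: (ltP x q) => [xq|qx]; last lra.
    have q_gt0 : 0 < q by exact: le_lt_trans xq.
    have : x * (1 - q) / q <= 1 - x; last lra.
    rewrite ler_pdivrMr//; nra.
  have E u : u + \sum_i w i * ltent (r i) u = \sum_i w i * (u + ltent (r i) u).
    under [RHS]eq_bigr do rewrite mulrDr.
    by rewrite big_split/= -mulr_suml w1 mul1r.
  by rewrite !E ler_sum// => i _; rewrite ler_wpM2l// ltent_slope.
- move=> k kn.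
  rewrite (sumE (fun i => ltent (grid n i) (grid n k))) grid0.
  have -> : ltent 0 (grid n k) = 1 - grid n k by rewrite /ltent ltNge grid_ge0.
  (* each tent lies below the line 1 - t, by (1 - t/r)^+ *)
  have tE i : i.+1%:R * (d i - d i.+1) * ltent (grid n i.+1) (grid n k) =
     i.+1%:R * (d i - d i.+1) * (1 - grid n k) - (i.+1 - k)%:R * (d i - d i.+1).
    rewrite /ltent; case: ltP => [ki|ik].
      have ki' : (k < i.+1)%N.
        by rewrite ltnNge; apply/negP => /(le_grid n); rewrite leNgt ki.
      rewrite natrB; last exact: ltnW.
      by rewrite /grid; field; rewrite !nat1r !pnatr_eq0.
    have ik' : (i.+1 <= k)%N.
      by rewrite leqNgt; apply/negP => /(lt_grid n); rewrite ltNge ik.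
    by rewrite (eqP ik') mul0r subr0.
  under eq_bigr do rewrite tE.
  rewrite sumrB -mulr_suml.
  have Sk : \sum_(0 <= i < n.+1) (i.+1 - k)%:R * (d i - d i.+1) = g k.
    rewrite (@big_cat_nat _ _ _ k)//= big1_seq ?add0r; last first.
      by move=> i; rewrite mem_index_iota/= => ik; rewrite (eqP ik) mul0r.
    have := @second_difference_sum d g k (n.+1 - k) (fun=> erefl).
    rewrite subnKC// => ->.
    by rewrite gn (_ : d n.+1 = 0) ?mulr0 ?subr0// /d gn gnS subr0.
  rewrite S0 Sk /g kn; ring.
Qed.

End tent_approximation.

(** * The inequality for a pair of concave functions *)

Section concave_pair.
Context {R : realType}.
Local Notation int01 := (integ (0 : R) 1).
Implicit Types (f g h a c : R -> R).

Lemma dist_integ f g h : bmeas f -> bmeas g -> bmeas h ->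
  (forall t, 0 <= t <= 1 -> `|f t - g t| <= h t) ->
  `|int01 f - int01 g| <= int01 h.
Proof.
move=> bf bg bh fgh; rewrite -integB// ler_norml; apply/andP; split.
  rewrite lerNl -mulN1r -integZ//; last exact: bmeasB.
  apply: le_integ => //; first by apply: bmeasM; [exact: bmeas_cst|exact: bmeasB].
  by move=> t /fgh; rewrite ler_norml => /andP[? ?]; rewrite mulN1r; lra.
apply: le_integ => //; first exact: bmeasB.
by move=> t /fgh; rewrite ler_norml => /andP[].
Qed.

Lemma integ_cst01 (k : R) : int01 (fun=> k) = k.
Proof.
rewrite (@integ_cubic _ _ _ k 0 0 0) ?ler01//; first by ring.
by move=> t _; ring.
Qed.

Lemma rtentE (q t : R) : rtent (1 - q) t = ltent q (1 - t).
Proof.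
rewrite /rtent /ltent; case: (leP t (1 - q)) => h; case: (ltP (1 - t) q) => h'; try lra.
by rewrite subKr.
Qed.

Lemma grid_rev n k : (k <= n.+1)%N -> grid n (n.+1 - k) = 1 - grid n k :> R.
Proof. by move=> kn; rewrite /grid natrB// mulrBl divff// pnatr_eq0. Qed.

(** [tent_mixture_inequality] in terms of [a] and [c] themselves. Adding back the
    linear parts changes the integral of the squared difference by exactly the
    linear term there, plus the constant [3^-1], the integral of
    [(1 - 2 * t) ^+ 2]. *)
Lemma tent_mixture_inequality_ac (I J : finType) (w r : I -> R) (v q : J -> R)
    (a := fun t => t + \sum_i w i * ltent (r i) t)
    (c := fun t => 1 - t + \sum_j v j * ltent (q j) (1 - t)) :
  (forall i, 0 <= w i) -> \sum_i w i = 1 -> (forall i, 0 <= r i <= 1) ->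
  (forall j, 0 <= v j) -> \sum_j v j = 1 -> (forall j, 0 <= q j <= 1) ->
  [/\ bmeas a, bmeas c &
  int01 (fun t => a t + c t - 1) *
    (int01 (fun t => (a t - c t) ^+ 2) - 3^-1) <=
  4 * int01 (fun t => (t * (1 - t) - 6^-1) * (a t + c t - 1))].
Proof.
move=> w0 w1 r01 v0 v1 q01.
have s01 j : 0 <= 1 - q j <= 1 by have := q01 j; lra.
have := tent_mixture_inequality w0 w1 r01 v0 v1 s01.
set al := fun t => \sum_i _; set be := fun t => \sum_j _.
have bal : bmeas al by apply: bmeas_mix => i; exact: bmeas_ltent.
have bbe : bmeas be by apply: bmeas_mix => j; exact: bmeas_rtent.
have aE t : a t = t + al t by [].
have cE t : c t = 1 - t + be t.
  by rewrite /c /be; congr (_ + _); apply: eq_bigr => j _; rewrite rtentE.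
have b1t : bmeas (fun t : R => 1 - t) by apply: bmeasB; [exact: bmeas_cst|exact: bmeas_id].
have ba : bmeas a by apply: bmeasD => //; exact: bmeas_id.
have bc : bmeas c by rewrite (funext cE); apply: bmeasD.
move=> H; split => //.
have -> : int01 (fun t => a t + c t - 1) = int01 al + int01 be.
  by rewrite -integD//; apply: eq_integ => t _; rewrite aE cE; ring.
have -> : int01 (fun t => (t * (1 - t) - 6^-1) * (a t + c t - 1)) =
   int01 (fun t => (t * (1 - t) - 6^-1) * (al t + be t)).
  by apply: eq_integ => t _; rewrite aE cE; ring.
suff -> : int01 (fun t => (a t - c t) ^+ 2) - 3^-1 =
   int01 (fun t => (al t - be t) ^+ 2) -
   2 * int01 (fun t => (1 - 2 * t) * (al t - be t)) by exact: H.
have bd : bmeas (fun t => al t - be t) by exact: bmeasB.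
have b2t : bmeas (fun t : R => 1 - 2 * t).
  by apply: bmeasB; [exact: bmeas_cst|apply: bmeasM; [exact: bmeas_cst|exact: bmeas_id]].
have -> : 3^-1 = int01 (fun t => (1 - 2 * t) ^+ 2).
  rewrite (@integ_cubic _ _ _ 1 (-4) 4 0) ?ler01//; first by field.
  by move=> t _; ring.
have bX1 : bmeas (fun t => (a t - c t) ^+ 2) by apply: bmeasX; exact: bmeasB.
have bX2 := bmeasX 2 b2t; have bX3 := bmeasX 2 bd.
have bX4 : bmeas (fun t => 2 * ((1 - 2 * t) * (al t - be t))).
  by apply: bmeasM; [exact: bmeas_cst|exact: bmeasM].
rewrite -integZ//; last exact: bmeasM.
rewrite -!integB//.
by apply: eq_integ => t _; rewrite aE cE; ring.
Qed.

(** Replacing [a] and [c] by tent mixtures costs an error of L1 norm at most [2 / n.+1].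
    The left side changes by at most three times this error and the right side
    by at most four times, whence the constant [14]. *)
Lemma concave_pair_approx a c (n : nat) : bmeas a -> bmeas c ->
  concave01 a -> nondecr01 a -> a 1 = 1 -> 0 <= a 0 ->
  concave01 (fun t => c (1 - t)) -> nondecr01 (fun t => c (1 - t)) -> c 0 = 1 -> 0 <= c 1 ->
  int01 (fun t => a t + c t - 1) *
    (int01 (fun t => (a t - c t) ^+ 2) - 3^-1) <=
  4 * int01 (fun t => (t * (1 - t) - 6^-1) * (a t + c t - 1)) + 14 / n.+1%:R.
Proof.
move=> ba bc ca na a1 a0 cc nc c0 c1.
have [w [r [w0 w1 r01 nan aan]]] := tent_approx n ca na a1 a0.
have [||v [q [v0 v1 q01 ncn ccn]]] := tent_approx n cc nc.
- by rewrite subrr.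
- by rewrite subr0.
have := tent_mixture_inequality_ac w0 w1 r01 v0 v1 q01.
set an := fun t => t + _; set cn := fun t => 1 - t + _.
move=> [ban bcn H].
have g01 : grid n 0 = 0 :> R := grid0 n.
have g11 : grid n n.+1 = 1 :> R := grid1 n.
have cn_grid k : (k <= n.+1)%N -> c (grid n k) = cn (grid n k).
  move=> kn; have := ccn (n.+1 - k)%N; rewrite leq_subr => /(_ isT).
  by rewrite grid_rev// subKr.
have ncN : nondecr01 (fun t => - c t).
  move=> x y x0 xy y1; rewrite lerN2.
  by have := nc (1 - y) (1 - x); rewrite !subKr; apply; lra.
have ncnN : nondecr01 (fun t => - cn t).
  move=> x y x0 xy y1; rewrite lerN2.
  by have := ncn (1 - y) (1 - x); rewrite /cn; apply; lra.
have La : int01 (fun t => `|a t - an t|) <= n.+1%:R^-1.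
  have := nondecr_eq_grid_L1 ba ban na nan aan => /le_trans; apply.
  by rewrite ler_piMl ?invr_ge0//; lra.
have Lc : int01 (fun t => `|c t - cn t|) <= n.+1%:R^-1.
  have := @nondecr_eq_grid_L1 _ n (fun t => - c t) (fun t => - cn t).
  rewrite (_ : int01 (fun t => `|- c t - - cn t|) = int01 (fun t => `|c t - cn t|)); last first.
    by apply: eq_integ => t _; rewrite -opprD normrN.
  have cnN k : (k <= n.+1)%N -> - c (grid n k) = - cn (grid n k).
    by move=> kn; rewrite cn_grid.
  move=> /(_ (bmeasN bc) (bmeasN bcn) ncN ncnN cnN) /le_trans; apply.
  by rewrite ler_piMl ?invr_ge0//; lra.
have bnda t : 0 <= t <= 1 -> 0 <= a t <= 1.
  move=> /andP[t0 t1]; rewrite (le_trans a0) ?na//=.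
  by rewrite -a1 na.
have bndan t : 0 <= t <= 1 -> 0 <= an t <= 1.
  move=> /andP[t0 t1].
  have e0 := aan 0%N isT; have e1 := aan n.+1 (leqnn _); rewrite g01 in e0; rewrite g11 in e1.
  rewrite (le_trans a0)/=; last by rewrite e0; exact: nan.
  by rewrite -a1 e1; exact: nan.
have bndc t : 0 <= t <= 1 -> 0 <= c t <= 1.
  move=> /andP[t0 t1]; have := ncN 0 t; have := ncN t 1.
  rewrite c0 !lerN2 !lexx t0 t1 => /(_ isT isT isT) h1 /(_ isT isT isT) h2.
  by rewrite h2 (le_trans c1).
have bndcn t : 0 <= t <= 1 -> 0 <= cn t <= 1.
  move=> /andP[t0 t1]; have := ncnN 0 t; have := ncnN t 1.
  have e0 := cn_grid 0%N isT; have e1 := cn_grid n.+1 (leqnn _); rewrite g01 in e0; rewrite g11 in e1.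
  rewrite -e0 -e1 c0 !lerN2 !lexx t0 t1 => /(_ isT isT isT) h1 /(_ isT isT isT) h2.
  by rewrite h2 (le_trans c1).
pose E t := `|a t - an t| + `|c t - cn t|.
have bE : bmeas E by apply: bmeasD; exact/bmeas_norm/bmeasB.
have EN : int01 E <= 2 / n.+1%:R.
  by rewrite /E integD//; [rewrite mulrC mulr_natr mulr2n lerD|exact/bmeas_norm/bmeasB..].
have bq : bmeas (fun t : R => t * (1 - t) - 6^-1).
  apply: bmeasB; last exact: bmeas_cst.
  apply: bmeasM; first exact: bmeas_id.
  by apply: bmeasB; [exact: bmeas_cst|exact: bmeas_id].
have bf : bmeas (fun t => a t + c t - 1).
  by apply: bmeasB; [exact: bmeasD|exact: bmeas_cst].
have bfn : bmeas (fun t => an t + cn t - 1).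
  by apply: bmeasB; [exact: bmeasD|exact: bmeas_cst].
have bp : bmeas (fun t => (a t - c t) ^+ 2) by apply: bmeasX; exact: bmeasB.
have bpn : bmeas (fun t => (an t - cn t) ^+ 2) by apply: bmeasX; exact: bmeasB.
have dA : `|int01 (fun t => a t + c t - 1) - int01 (fun t => an t + cn t - 1)| <= int01 E.
  apply: dist_integ => // t _.
  by rewrite (_ : _ - _ = (a t - an t) + (c t - cn t)); [exact: ler_normD|ring].
have dS : `|int01 (fun t => (t * (1 - t) - 6^-1) * (a t + c t - 1)) -
    int01 (fun t => (t * (1 - t) - 6^-1) * (an t + cn t - 1))| <= int01 E.
  apply: dist_integ => //; [exact: bmeasM..|] => t t01.
  rewrite -mulrBr normrM; apply: (@le_trans _ _ (1 * `|(a t - an t) + (c t - cn t)|)).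
    rewrite (_ : a t + c t - 1 - _ = (a t - an t) + (c t - cn t)); last by ring.
    rewrite ler_wpM2r// ler_norml; apply/andP; split; nra.
  by rewrite mul1r ler_normD.
have dP : `|int01 (fun t => (a t - c t) ^+ 2) - int01 (fun t => (an t - cn t) ^+ 2)|
    <= 2 * int01 E.
  rewrite -integZ//; apply: dist_integ => //.
    by apply: bmeasM => //; exact: bmeas_cst.
  move=> t t01; have A1 := bnda _ t01; have A2 := bndan _ t01.
  have C1 := bndc _ t01; have C2 := bndcn _ t01.
  rewrite subr_sqr mulrC normrM; apply: ler_pM => //.
    by rewrite ler_norml; lra.
  by rewrite (_ : _ - _ = (a t - an t) - (c t - cn t)); [exact: ler_normB|ring].
have A_le : `|int01 (fun t => a t + c t - 1)| <= 1.
  rewrite -[X in `|X|]subr0 -[in X in `|_ - X|](integ_cst01 0) -[leRHS]integ_cst01.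
  apply: dist_integ => //; [exact: bmeas_cst..|] => t t01.
  by rewrite subr0 ler_norml; have := bnda _ t01; have := bndc _ t01; lra.
have P_le : `|int01 (fun t => (an t - cn t) ^+ 2) - 3^-1| <= 1.
  rewrite -[in X in `|_ - X|](integ_cst01 3^-1) -[leRHS]integ_cst01.
  apply: dist_integ => //; [exact: bmeas_cst..|] => t t01.
  have A2 := bndan _ t01; have C2 := bndcn _ t01.
  have h : 0 <= (1 - (an t - cn t)) * (1 + (an t - cn t)).
    by rewrite mulr_ge0//; lra.
  have := sqr_ge0 (an t - cn t); rewrite ler_norml => h1.
  by apply/andP; split; lra.
move: H dA dS dP A_le P_le EN.
set An := int01 (fun t => an t + cn t - 1); set A := int01 (fun t => a t + c t - 1).
set Sn := int01 (fun t => _ * (an t + cn t - 1)); set S := int01 (fun t => _ * (a t + c t - 1)).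
set Pn := int01 (fun t => (an t - cn t) ^+ 2); set P := int01 (fun t => (a t - c t) ^+ 2).
move: (int01 E) An A Sn S Pn P; clear => e An A Sn S Pn P H dA dS dP A1 P1 eN.
have -> : A * (P - 3^-1) = An * (Pn - 3^-1) + (A - An) * (Pn - 3^-1) + A * (P - Pn) by ring.
have h1 : (A - An) * (Pn - 3^-1) <= e.
  by rewrite (le_trans (ler_norm _))// normrM -[leRHS]mulr1 ler_pM.
have h2 : A * (P - Pn) <= 2 * e.
  by rewrite (le_trans (ler_norm _))// normrM -[leRHS]mul1r ler_pM.
have h3 : - e <= S - Sn by move: dS; rewrite ler_norml => /andP[].
have h4 : 14 / n.+1%:R = 7 * (2 / n.+1%:R) :> R by field; rewrite nat1r pnatr_eq0.
rewrite h4; move: (2 / _) eN => N eN; lra.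
Qed.

(** The inequality on which the comparison of the two projections rests. For a
    convex region between two graphs and one direction, [a] and [c] encode how
    much of the boundary lies to the left and to the right, and [a + c - 1] is
    proportional to the length of the vertical sections.
    The kernel on the left is [3^-1 - t * (1 - t)], so this is the limit of
    [concave_pair_approx]. *)
Lemma concave_pair_inequality a c : bmeas a -> bmeas c ->
  concave01 a -> nondecr01 a -> a 1 = 1 -> 0 <= a 0 ->
  concave01 (fun t => c (1 - t)) -> nondecr01 (fun t => c (1 - t)) -> c 0 = 1 -> 0 <= c 1 ->
  int01 (fun t => (a t + c t - 1) * (((1 - t) ^+ 3 + t ^+ 3) / 3)) <=
  int01 (fun t => a t + c t - 1) * int01 (fun t => (1 - (a t - c t) ^+ 2) / 4).
Proof.
move=> ba bc ca na a1 a0 cc nc c0 c1.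
have bq : bmeas (fun t : R => t * (1 - t) - 6^-1).
  apply: bmeasB; last exact: bmeas_cst.
  apply: bmeasM; first exact: bmeas_id.
  by apply: bmeasB; [exact: bmeas_cst|exact: bmeas_id].
have bf : bmeas (fun t => a t + c t - 1).
  by apply: bmeasB; [exact: bmeasD|exact: bmeas_cst].
have bp : bmeas (fun t => (a t - c t) ^+ 2) by apply: bmeasX; exact: bmeasB.
have := fun n => concave_pair_approx n ba bc ca na a1 a0 cc nc c0 c1.
have -> : int01 (fun t => (a t + c t - 1) * (((1 - t) ^+ 3 + t ^+ 3) / 3)) =
  int01 (fun t => a t + c t - 1) / 6 -
  int01 (fun t => (t * (1 - t) - 6^-1) * (a t + c t - 1)).
  rewrite [X in X - _]mulrC -integZ// -integB//; last 2 first.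
  - by apply: bmeasM; first exact: bmeas_cst.
  - exact: bmeasM.
  by apply: eq_integ => t _; field.
have -> : int01 (fun t => (1 - (a t - c t) ^+ 2) / 4) =
   (1 - int01 (fun t => (a t - c t) ^+ 2)) / 4.
  rewrite -[X in _ = (X - _) / _]integ_cst01 -integB//; last exact: bmeas_cst.
  rewrite [RHS]mulrC -integZ//; last by apply: bmeasB; [exact: bmeas_cst|].
  by apply: eq_integ => t _; rewrite mulrC.
set A := int01 (fun t => a t + c t - 1).
set S := int01 (fun t => _ * (a t + c t - 1)).
set P := int01 (fun t => (a t - c t) ^+ 2).
move: A S P; clear => A S P H.
suff : A * (P - 3^-1) <= 4 * S by lra.
apply/ler_addgt0Pr => e e0.
have : 14 / e < (Num.bound (14 / e))%:R by rewrite archi_boundP// divr_ge0// ltW.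
move: (Num.bound _) => n; rewrite ltr_pdivrMr// => nP.
apply: (le_trans (H n)); rewrite lerD2l ler_pdivrMr ?ltr0n//.
by rewrite -natr1; lra.
Qed.

End concave_pair.

(** * Bounds for one-dimensional Hausdorff measure *)

Section hausdorff_bounds.
Context {R : realType}.
Implicit Types (S : set (R * R)) (p q V : R).

(** [S] is the image of a part of [p, p + V] under a 1-Lipschitz map; cutting
    [p, p + V] into equal pieces gives covers of total diameter at most [V]. *)
Lemma hausdorff1_le_param S (v : R * R -> R) p V : 0 <= V ->
  (forall x y, S x -> S y -> eucl_dist x y <= `|v x - v y|) ->
  (forall x, S x -> p <= v x <= p + V) ->
  (hausdorff1 S <= V%:E)%E.
Proof.
move=> V0 Sv Sp; apply: ge_ereal_sup => _ [delta d0 <-].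
have : V / delta < (Num.bound (V / delta))%:R.
  by rewrite archi_boundP// divr_ge0// ltW.
set N := Num.bound _; rewrite ltr_pdivrMr// => VN.
have N0 : (0 < N)%N.
  by rewrite lt0n; apply/eqP => N0; move: VN; rewrite N0 mul0r ltNge V0.
have Nr0 : 0 < N%:R :> R by rewrite ltr0n.
pose tau := V / N%:R.
have tau0 : 0 <= tau by rewrite divr_ge0// ltW.
have taud : tau <= delta by rewrite ler_pdivrMr// mulrC ltW.
pose F k := if (k < N)%N then
  S `&` [set x | p + k%:R * tau <= v x <= p + k.+1%:R * tau] else set0.
have dF k : (diam (F k) <= (if (k < N)%N then tau else 0)%:E)%E.
  rewrite /F; case: ifPn => kN; last by rewrite diam0.
  apply: ge_ereal_sup => _ [->|[[x y] [[Sx /= xk] [Sy /= yk]] <-]]; first by rewrite lee_fin.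
  rewrite lee_fin (le_trans (Sv _ _ Sx Sy))// ler_norml.
  by move: xk yk; rewrite -!natr1 !mulrDl !mul1r => /andP[? ?] /andP[? ?]; lra.
apply: (@le_trans _ _ (\sum_(k <oo) diam (F k))%E).
  apply: ereal_inf_lbound; exists F => //; split.
    move=> x Sx; have /andP[px xp] := Sp _ Sx.
    have ex : exists k, v x <= p + k.+1%:R * tau.
      by exists N.-1; rewrite prednK// mulrC divfK// gt_eqF.
    case: (ex_minnP ex) => k xk kmin.
    have kN : (k < N)%N.
      rewrite -(prednK N0) ltnS kmin// prednK// mulrC divfK// gt_eqF//.
    exists k => //; rewrite /F kN; split => //=; rewrite xk andbT.
    case: k xk kmin kN => [|k] _ kmin _; first by rewrite mul0r addr0.
    rewrite leNgt; apply/negP => /ltW /kmin; by rewrite ltnn.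
  move=> k; apply: (le_trans (dF k)); rewrite lee_fin; case: ifP => // _.
  exact: ltW.
apply: lime_le; first by apply: is_cvg_nneseries => *; exact: diam_ge0.
apply: nearW => n.
apply: (@le_trans _ _ ((minn n N)%:R * tau)%:E); last first.
  rewrite lee_fin -[leRHS](@divfK _ N%:R) ?gt_eqF// mulrC ler_wpM2l//.
  by rewrite ler_nat geq_minr.
elim: n => [|n IH]; first by rewrite big_geq// min0n mul0r.
rewrite big_nat_recr//=; apply: (le_trans (leeD IH (dF n))).
rewrite -EFinD lee_fin; case: ifPn => nN.
  by rewrite (minn_idPl (ltnW nN)) (minn_idPl nN) -natr1 mulrDl mul1r.
rewrite -leqNgt in nN.
by rewrite (minn_idPr nN) (minn_idPr (leqW nN)) addr0.
Qed.

(** Each set of a cover of [S] has its image under [f] in an interval as long as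
    its diameter, and these intervals cover the open interval, so that countable
    subadditivity of Lebesgue measure applies. *)
Lemma hausdorff1_ge_image S (f : R * R -> R) p q :
  (forall x y, `|f x - f y| <= eucl_dist x y) ->
  `]p, q[%classic `<=` f @` S -> ((q - p)%:E <= hausdorff1 S)%E.
Proof.
move=> fl pqS; apply: le_trans (hausdorff1_pre_ub S (ltr01 : 0 < (1 : R))).
apply: le_ereal_inf_tmp => _ [F [SF dF] <-].
have [qp|pq] := leP q p.
  apply: (@le_trans _ _ 0%E); first by rewrite lee_fin subr_le0.
  by apply: nneseries_ge0 => *; exact: diam_ge0.
pose dk k := fine (diam (F k)).
have dkE k : diam (F k) = (dk k)%:E.
  rewrite /dk fineK// ge0_fin_numE ?diam_ge0//.
  by rewrite (le_lt_trans (dF k))// ltry.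
(* the infimum makes sense only for nonempty sets of the cover *)
pose I k : set R := if `[< F k !=set0 >] then
  `[inf (f @` F k), inf (f @` F k) + dk k]%classic else set0.
have FI k x : F k x -> I k (f x).
  move=> Fx; rewrite /I; case: asboolP => [_|]; last by case; exists x.
  have Fl y z : F k y -> F k z -> f y <= f z + dk k.
    move=> Fy Fz; have : eucl_dist y z <= dk k.
      by rewrite -lee_fin -dkE eucl_dist_le_diam.
    by move/(le_trans (fl y z)); rewrite ler_norml; lra.
  have lb y : F k y -> lbound (f @` F k) (f y - dk k).
    by move=> Fy _ [z Fz <-]; rewrite lerBlDr Fl.
  rewrite /= in_itv/=; apply/andP; split.
    by apply: ge_inf; [exists (f x - dk k); exact: lb|exists x].
  rewrite -lerBlDr; apply: lb_le_inf; first by exists (f x), x.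
  exact: lb.
have mI k : measurable (I k).
  by rewrite /I; case: ifP => _ //; exact: measurable_itv.
have pqI : `]p, q[%classic `<=` \bigcup_k I k.
  by move=> y /pqS[x /SF[k _ Fx] <-]; exists k => //; exact: FI.
have := measure_sigma_subadditive (@lebesgue_measure R) mI (measurable_itv `]p, q[) pqI.
rewrite /= lebesgue_measure_itv/= lte_fin pq -EFinB => /le_trans; apply.
apply: lee_nneseries => [k _ _|k _]; first exact: measure_ge0.
rewrite /I; case: ifP => _; last by rewrite measure0 diam_ge0.
rewrite /= lebesgue_measure_itv/= dkE lte_fin; case: ifP => [_|_].
  by rewrite -EFinB addrC addKr.
by rewrite -dkE diam_ge0.
Qed.

End hausdorff_bounds.

(** * Euclidean length as a finite sum of linear functionals *)

Section finite_crofton.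
Context {R : realType}.

Lemma sum_cos_telescope (a h : R) (p q : nat) : (p <= q)%N ->
  2 * sin h * (\sum_(p <= j < q) cos (a - 2 * j%:R * h)) =
  sin (a - 2 * p%:R * h + h) - sin (a - 2 * q%:R * h + h).
Proof.
move=> pq; pose f j := - sin (a - 2 * j%:R * h + h).
rewrite -[RHS](_ : f q - f p = _); last by rewrite /f; ring.
rewrite -telescope_sumr// mulr_sumr; apply: eq_bigr => j _.
rewrite /f -[j.+1%:R]natr1.
have -> : a - 2 * (j%:R + 1) * h + h = (a - 2 * j%:R * h) - h by ring.
by rewrite sinB (sinD (a - 2 * j%:R * h) h); move: (a - _) => X; ring.
Qed.

(** The cosines change sign at most once, at an index [m]; on either side of it the sum
    telescopes, and what remains is a single sine at an angle within [h] of a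
    right angle. *)
Lemma sum_abs_cos (n : nat) (a h : R) : (0 < n)%N -> h = pi / (2 * n%:R) ->
  - (pi / 2) <= a <= pi / 2 ->
  exists2 b, `|b| <= h & sin h * (\sum_(j < n) `|cos (a - 2 * j%:R * h)|) = cos b.
Proof.
move=> n0 hE /andP[a1 a2].
have nr0 : 0 < n%:R :> R by rewrite ltr0n.
have h0 : 0 < h by rewrite hE divr_gt0 ?pi_gt0// mulr_gt0.
have hn : 2 * n%:R * h = pi by rewrite hE; field; rewrite gt_eqF.
have ex : exists m, a - 2 * m%:R * h <= - (pi / 2).
  by exists n; rewrite hn; lra.
case: (ex_minnP ex) => m mP mmin.
have mn : (m <= n)%N by apply: mmin; rewrite hn; lra.
have below j : (j < m)%N -> - (pi / 2) < a - 2 * j%:R * h.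
  by move=> jm; rewrite ltNge; apply/negP => /mmin; rewrite leqNgt jm.
have nonneg j : (j < m)%N -> `|cos (a - 2 * j%:R * h)| = cos (a - 2 * j%:R * h).
  move=> jm; rewrite ger0_norm// cos_ge0_pihalf// ltW ?below//=.
  have : 0 <= 2 * j%:R * h by rewrite mulr_ge0// ltW.
  lra.
have nonpos j : (m <= j)%N -> (j < n)%N ->
    `|cos (a - 2 * j%:R * h)| = - cos (a - 2 * j%:R * h).
  move=> mj jn; rewrite -normrN ger0_norm// -cosDpi cos_ge0_pihalf//.
  have : 2 * m%:R * h <= 2 * j%:R * h by rewrite ler_pM2r// ler_pM2l// ler_nat.
  have : 2 * j%:R * h <= 2 * n%:R * h by rewrite ler_pM2r// ler_pM2l// ler_nat ltnW.
  by rewrite hn => ? ?; apply/andP; split; lra.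
exists (a - 2 * m%:R * h + h + pi / 2).
  rewrite ler_norml; apply/andP; split; last lra.
  case: m mP mmin mn below {nonneg nonpos} => [|m] mP mmin mn below.
    by rewrite mulr0 mul0r; lra.
  have := below m (ltnSn m); rewrite -[m.+1%:R]natr1 mulrDr mulr1 mulrDl; lra.
have S1 := @sum_cos_telescope a h 0 m (leq0n m).
have S2 := sum_cos_telescope a h mn.
rewrite cosDpihalf -(big_mkord xpredT (fun j => `|cos (a - 2 * j%:R * h)|)).
rewrite (big_cat_nat (leq0n m) mn)/=.
under eq_big_nat => j /andP[_ jm] do rewrite nonneg//.
under [X in _ * (_ + X)]eq_big_nat => j /andP[mj jn] do rewrite nonpos//.
rewrite sumrN.
have hn' : sin (a - 2 * n%:R * h + h) = - sin (a + h).
  rewrite hn (_ : a - pi + h = a + h - pi); last by ring.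
  by rewrite -[in RHS](subrK pi (a + h)) sinDpi opprK.
move: S1 S2; rewrite hn' mulr0 mul0r subr0.
set A := \sum_(0 <= _ < _) _; set B := \sum_(_ <= _ < n) _ => S1 S2.
have : 2 * (sin h * (A - B)) = 2 * - sin (a - 2 * m%:R * h + h); lra.
Qed.

(** A half-turn of angles suffices because only absolute values of linear
    functionals are taken. *)
Lemma polar_upto_sign (x y : R) : exists r w : R,
  [/\ r = Num.sqrt (x ^+ 2 + y ^+ 2), 0 <= w <= pi &
      (x = r * cos w /\ y = r * sin w) \/ (x = - (r * cos w) /\ y = - (r * sin w))].
Proof.
pose r := Num.sqrt (x ^+ 2 + y ^+ 2).
have r0 : 0 <= r by exact: sqrtr_ge0.
have rE : r ^+ 2 = x ^+ 2 + y ^+ 2 by rewrite sqr_sqrtr// addr_ge0 ?sqr_ge0.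
have [r_eq0|r_neq0] := eqVneq r 0.
  exists r, 0; rewrite r_eq0 !mul0r lexx pi_ge0; split => //; left.
  move: rE; rewrite r_eq0 expr0n/= => /esym/eqP.
  by rewrite paddr_eq0 ?sqr_ge0// !sqrf_eq0 => /andP[/eqP -> /eqP ->].
have r_gt0 : 0 < r by rewrite lt0r r_neq0.
(* the sign is chosen so that the second coordinate becomes nonnegative *)
have upper (u v : R) : 0 <= v -> r ^+ 2 = u ^+ 2 + v ^+ 2 ->
    exists w, [/\ 0 <= w <= pi, u = r * cos w & v = r * sin w].
  move=> v0 uv; have ur : -1 <= u / r <= 1.
    rewrite ler_pdivlMr// ler_pdivrMr// mulN1r mul1r -ler_norml.
    by rewrite -(ler_pXn2r (_ : 0 < 2)%N) ?nnegrE// real_normK ?num_real// uv lerDl sqr_ge0.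
  exists (acos (u / r)); rewrite acos_ge0// acos_lepi//; split => //.
    by rewrite acosK ?in_itv//= mulrC divfK.
  rewrite sin_acos// -[X in X * _](ger0_norm r0) -sqrtr_sqr -sqrtrM ?sqr_ge0//.
  rewrite mulrBr mulr1 expr_div_n mulrCA divff ?mulr1 ?expf_neq0//.
  by rewrite uv addrC addKr sqrtr_sqr ger0_norm.
have [y0|y0] := leP 0 y.
  have [w [w01 xE yE]] := upper x y y0 rE.
  by exists r, w; split => //; left.
have [||w [w01 xE yE]] := upper (- x) (- y).
- by rewrite oppr_ge0 ltW.
- by rewrite !sqrrN.
by exists r, w; split => //; right; rewrite -xE -yE !opprK.
Qed.

(** The directions are the odd multiples of [h], which avoids the horizontal
    direction and makes every [beta j] positive. *)
Lemma finite_crofton_step (n : nat) (h := pi / (2 * n%:R) : R)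
    (alpha := fun j : 'I_n => sin h * cos ((2 * j%:R + 1) * h))
    (beta := fun j : 'I_n => sin h * sin ((2 * j%:R + 1) * h)) : (0 < n)%N ->
  (forall j, 0 < beta j) /\
  forall x y, cos h * Num.sqrt (x ^+ 2 + y ^+ 2) <=
      \sum_j `|alpha j * x + beta j * y| <= Num.sqrt (x ^+ 2 + y ^+ 2).
Proof.
move=> n0; have nr0 : 0 < n%:R :> R by rewrite ltr0n.
have h0 : 0 < h by rewrite /h divr_gt0 ?pi_gt0// mulr_gt0.
have hn : 2 * n%:R * h = pi by rewrite /h; field; rewrite gt_eqF.
have h_le : h <= pi / 2.
  rewrite -hn; have : 1 <= n%:R :> R by rewrite ler1n.
  by move=> n1; have := ler_wpM2r (ltW h0) n1; lra.
have pi0 : 0 < pi :> R by exact: pi_gt0.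
have sinh : 0 < sin h by rewrite sin_gt0_pi//; lra.
split.
  move=> j; rewrite mulr_gt0// sin_gt0_pi//; apply/andP; split.
    by rewrite mulr_gt0// ltr_wpDl// mulr_ge0.
  rewrite -hn ltr_pM2r//.
  have : (j%:R : R) + 1 <= n%:R by rewrite natr1 ler_nat.
  lra.
move=> x y; have [r [w [rE w01 xy]]] := polar_upto_sign x y; rewrite -rE.
have r0 : 0 <= r by rewrite rE sqrtr_ge0.
have -> : \sum_j `|alpha j * x + beta j * y| =
    r * (sin h * \sum_(j < n) `|cos (w - h - 2 * j%:R * h)|).
  rewrite !mulr_sumr; apply: eq_bigr => j _.
  rewrite (_ : w - h - 2 * j%:R * h = w - (2 * j%:R + 1) * h); last by ring.
  rewrite cosB /alpha /beta.
  set c := cos ((2 * j%:R + 1) * h); set s := sin ((2 * j%:R + 1) * h).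
  rewrite -[X in X * (_ * `|_|)](ger0_norm r0) -[X in _ * (X * `|_|)](ger0_norm (ltW sinh)).
  rewrite -!normrM; case: xy => -[-> ->]; last rewrite -normrN; by congr `|_|; ring.
suff [b bh ->] : exists2 b, `|b| <= h &
    sin h * (\sum_(j < n) `|cos (w - h - 2 * j%:R * h)|) = cos b.
  rewrite mulrC ler_wpM2l//=; last first.
    rewrite -(cos_norm b); move: bh; rewrite le_eqVlt => /predU1P[->//|bh].
    by apply: ltW; rewrite ltr_cos// in_itv/=; have := normr_ge0 b; lra.
  by rewrite ler_piMr// cos_le1.
have [w1|w1] := leP (w - h) (pi / 2); first by apply: sum_abs_cos => //; lra.
have [|b bh bE] := @sum_abs_cos n (w - h - pi) h n0 erefl; first lra.
exists b => //; rewrite -bE; congr (_ * _); apply: eq_bigr => j _.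
rewrite (_ : w - h - 2 * j%:R * h = (w - h - pi - 2 * j%:R * h) + pi); last by ring.
by rewrite cosDpi normrN.
Qed.

(** A discrete Crofton formula: summing one-dimensional variations over
    finitely many directions recovers Euclidean length up to a factor close to 1. *)
Lemma finite_crofton (e : R) : 0 < e ->
  exists n (alpha beta : 'I_n -> R), (forall j, 0 < beta j) /\
  forall x y, (1 - e) * Num.sqrt (x ^+ 2 + y ^+ 2) <=
      \sum_j `|alpha j * x + beta j * y| <= Num.sqrt (x ^+ 2 + y ^+ 2).
Proof.
move=> e0.
have : \forall x \near (0 : R), `|cos 0 - cos x| < e.
  by have /cvgrPdist_lt := @continuous_cos R 0; apply.
move=> /nbhs_ballP[d /= d0 dP].
have : pi / d < (Num.bound (pi / d : R))%:R.
  by rewrite archi_boundP// divr_ge0 ?pi_ge0// ltW.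
set n := Num.bound _ => nP.
have n0 : (0 < n)%N.
  by rewrite -(ltr0n R) (le_lt_trans _ nP)// divr_ge0 ?pi_ge0// ltW.
have nr0 : 0 < n%:R :> R by rewrite ltr0n.
have [b0 H] := finite_crofton_step n0.
eexists n, _, _; split; first exact: b0.
move=> x y; have /andP[H1 H2] := H x y; apply/andP; split; last exact: H2.
apply: le_trans H1.
rewrite ler_wpM2r ?sqrtr_ge0//.
have : `|cos 0 - cos (pi / (2 * n%:R))| < e.
  apply: dP; rewrite /ball/= sub0r normrN ger0_norm; last first.
    by rewrite divr_ge0 ?pi_ge0// mulr_ge0.
  rewrite ltr_pdivrMr ?mulr_gt0//; move: nP; rewrite ltr_pdivrMr// => nP.
  have := mulr_gt0 nr0 d0; lra.
by rewrite cos0 => /(le_lt_trans (ler_norm _)); lra.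
Qed.

End finite_crofton.

(** * The Gini mean difference through the distribution function *)

Section gini_formula.
Context {R : realType}.
Local Open Scope ereal_scope.

Lemma integral_if_cst d (T : measurableType d) (mu : {measure set T -> \bar R})
    (b : T -> bool) (L : R) : (0 <= L)%R -> measurable [set x | b x] ->
  \int[mu]_x (if b x then L else 0%R)%:E = L%:E * mu [set x | b x].
Proof.
move=> L0 mb; rewrite -integral_cst// [in RHS]integral_mkcond.
apply: eq_integral => x _; rewrite patchE.
case: ifPn => bx; first by rewrite ifT// inE.
by rewrite ifF//; apply/negP; rewrite inE; exact/negP.
Qed.

Lemma measurable_bool_set d (T : measurableType d) (b : T -> bool) :
  measurable_fun [set: T] b -> measurable [set x | b x].
Proof.
move=> mb; have := mb measurableT [set true] I; rewrite setTI.
by congr measurable; apply/seteqP; split => x /=.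
Qed.

Lemma measurable_fun_bool_set d (T : measurableType d) (b : T -> bool) :
  measurable [set x | b x] -> measurable_fun [set: T] b.
Proof. by move=> mb; apply: (measurable_fun_bool true); rewrite setTI. Qed.

(** [|x - y|] is the length of the set of thresholds separating [x] from [y];
    Tonelli moves the threshold outside. The affine parameter [s] makes the
    projection of the body correspond to [0, 1]. *)
Lemma gini_cdf (rho : probability R R) (x0 L : R) : (0 < L)%R ->
  gini_mean_difference rho =
  \int[lebesgue_measure]_s ((2 * L)%:E *
    (rho `]-oo, (x0 + L * s)%R]%classic * rho `](x0 + L * s)%R, +oo[%classic)).
Proof.
move=> L0; rewrite /gini_mean_difference.
have L_ge0 := ltW L0.
pose t (s : R) := (x0 + L * s)%R.
pose g (w : (R * R) * R) : R := ((if (w.1.1 <= t w.2) && (t w.2 < w.1.2) then L else 0) +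
   (if (w.1.2 <= t w.2) && (t w.2 < w.1.1) then L else 0))%R.
have mt : measurable_fun [set: (measurableTypeR R * measurableTypeR R) * measurableTypeR R]
    (fun w => t w.2).
  by apply: measurable_funD => //; apply: measurable_funM => //; exact: measurable_snd.
have m1 : measurable_fun [set: (measurableTypeR R * measurableTypeR R) * measurableTypeR R]
    (fun w => w.1.1 : R).
  by apply: measurableT_comp; [exact: measurable_fst|exact: measurable_fst].
have m2 : measurable_fun [set: (measurableTypeR R * measurableTypeR R) * measurableTypeR R]
    (fun w => w.1.2 : R).
  by apply: measurableT_comp; [exact: measurable_snd|exact: measurable_fst].
have mg : measurable_fun [set: (measurableTypeR R * measurableTypeR R) * measurableTypeR R] g.
  apply: measurable_funD; apply: measurable_fun_ifT => //; apply: measurable_and.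
  - exact: measurable_fun_ler.
  - exact: measurable_fun_ltr.
  - exact: measurable_fun_ler.
  - exact: measurable_fun_ltr.
have g0 w : 0 <= (g w)%:E.
  by rewrite lee_fin addr_ge0//; case: ifP.
have mitv (x y : R) : measurable [set s : R | (x <= t s)%R && (t s < y)%R].
  apply: (@measurable_bool_set _ (measurableTypeR R)); apply: measurable_and.
  - apply: measurable_fun_ler; first exact: measurable_cst.
    by apply: measurable_funD => //; exact: measurable_funM.
  - apply: measurable_fun_ltr; last exact: measurable_cst.
    by apply: measurable_funD => //; exact: measurable_funM.
have len (x y : R) : \int[lebesgue_measure]_s
    (if (x <= t s) && (t s < y) then L else 0)%R%:E = (Num.max 0 (y - x))%:E.
  rewrite integral_if_cst//; last exact: mitv.
  rewrite (_ : [set _ | _] = `[((x - x0) / L)%R, ((y - x0) / L)%R[%classic); last first.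
    apply/seteqP; split => s /=; rewrite in_itv/= ler_pdivrMr// ltr_pdivlMr// /t;
    by rewrite lerBlDl ltrBrDl mulrC.
  rewrite /= lebesgue_measure_itv/= lte_fin ltr_pM2r ?invr_gt0// ltrD2r.
  case: ltP => xy; last by rewrite mule0 (max_idPl _)// subr_le0.
  rewrite (max_idPr _); last by rewrite subr_ge0 ltW.
  by rewrite -EFinB -EFinM; congr EFin; field; rewrite gt_eqF.
transitivity (\int[rho \x rho]_z \int[lebesgue_measure]_s (g (z, s))%:E).
  apply: eq_integral => -[x y] _ /=.
  rewrite /g/=; under eq_integral do rewrite EFinD.
  have mif (u v : R) : measurable_fun [set: measurableTypeR R]
      (fun s : R => (if (u <= t s) && (t s < v) then L else 0)%R%:E).
    apply/measurable_EFinP; apply: measurable_fun_ifT => //.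
    exact: measurable_fun_bool_set (mitv u v).
  rewrite ge0_integralD//; try by move=> s _; rewrite lee_fin; case: ifP.
  apply/esym/(etrans (congr2 adde (len x y) (len y x))); congr EFin.
  have [xy|yx] := leP x y.
    rewrite ler0_norm ?subr_le0// (max_idPr _) ?subr_ge0//.
    by rewrite (max_idPl _) ?subr_le0// addr0 opprB.
  by rewrite gtr0_norm ?subr_gt0// (max_idPl _) ?subr_le0 ?(max_idPr _) ?subr_ge0 ?ltW// add0r.
have mge : measurable_fun [set: plane R * measurableTypeR R] (fun w => (g w)%:E).
  exact/measurable_EFinP.
have FT := @fubini_tonelli _ _ _ _ _ [the probability _ _ of rho \x rho]
  (@lebesgue_measure R) _ mge g0.
apply: (etrans FT) => {FT}.
apply: eq_integral => s _; rewrite /g/=; under eq_integral do rewrite EFinD.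
have rect1 : [set z : R * R | (z.1 <= t s)%R && (t s < z.2)%R] =
    `]-oo, t s]%classic `*` `]t s, +oo[%classic.
  by apply/seteqP; split => -[x y] /=; rewrite !in_itv/= andbT => /andP.
have rect2 : [set z : R * R | (z.2 <= t s)%R && (t s < z.1)%R] =
    `]t s, +oo[%classic `*` `]-oo, t s]%classic.
  apply/seteqP; split => -[x y] /=; rewrite !in_itv/= andbT; first by move=> /andP[].
  by move=> [-> ->].
have mr1 : measurable ([set z : R * R | (z.1 <= t s)%R && (t s < z.2)%R] : set (plane R)).
  by rewrite rect1; exact: measurableX.
have mr2 : measurable ([set z : R * R | (z.2 <= t s)%R && (t s < z.1)%R] : set (plane R)).
  by rewrite rect2; exact: measurableX.
have mif (b : R * R -> bool) : measurable ([set z | b z] : set (plane R)) ->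
    measurable_fun [set: plane R] (fun z => (if b z then L else 0)%R%:E).
  move=> mb; apply/measurable_EFinP; apply: measurable_fun_ifT => //.
  exact: measurable_fun_bool_set.
rewrite ge0_integralD//; try (by move=> z _; rewrite lee_fin; case: ifP);
  try exact: mif.
rewrite !integral_if_cst// rect1 rect2.
have PE (A B : set R) : measurable A -> measurable B ->
    [the probability _ _ of rho \x rho] (A `*` B) = rho A * rho B.
  by move=> mA mB; exact: product_measure1E.
apply: (etrans (congr2 adde (congr1 (mule L%:E) (PE _ _ _ _))
                            (congr1 (mule L%:E) (PE _ _ _ _)))) => //.
rewrite -[LHS]/(L%:E * (rho `]-oo, t s]%classic * rho `]t s, +oo[%classic) +
                L%:E * (rho `]t s, +oo[%classic * rho `]-oo, t s]%classic)).
rewrite [X in _ + _ * X]muleC -ge0_muleDl ?lee_fin// -EFinD.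
by congr (_%:E * _); ring.
Qed.

End gini_formula.

(** * Planar convex sets between two graphs *)

Section convex_region.
Context {R : realType}.
Implicit Types (Q : set (R * R)) (T B : R -> R).

Definition convex_plane Q := forall s y s' y' l, Q (s, y) -> Q (s', y') ->
  0 <= l <= 1 -> Q (l * s + (1 - l) * s', l * y + (1 - l) * y').

(** Functions on [0, 1] are extended by their boundary values in order to speak of
    continuity on the whole line. *)
Definition clamp01 (s : R) := Num.max 0 (Num.min s 1).

Lemma clamp01_bound s : 0 <= clamp01 s <= 1.
Proof.
rewrite /clamp01 /Num.max /Num.min; case: (ltP s 1) => h; case: ltP => h'; lra.
Qed.

Lemma clamp01_id s : 0 <= s <= 1 -> clamp01 s = s.
Proof.
rewrite /clamp01 /Num.max /Num.min; case: (ltP s 1) => h; case: ltP => h'; lra.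
Qed.

Lemma dist_clamp01 s s' : `|clamp01 s - clamp01 s'| <= `|s - s'|.
Proof.
rewrite ler_norml; have := ler_norm (s - s'); have := ler_norm (s' - s).
rewrite distrC => h1 h2; have h0 := normr_ge0 (s - s').
rewrite /clamp01 /Num.max /Num.min.
case: (ltP s 1) => ?; case: (ltP s' 1) => ?; do 2 (case: ltP => ?); lra.
Qed.

Lemma continuous_pair (U : topologicalType) (f g : U -> R) : continuous f -> continuous g ->
  continuous (fun z => (f z, g z)).
Proof. by move=> cf cg z; exact: cvg_pair (cf z) (cg z). Qed.

(** Half of the continuity of a concave function, valid also at the endpoints;
    the other half fails there and comes from compactness in [top_function]. *)
Lemma concave01_lower_lip (t : R -> R) s0 : concave01 t -> 0 <= s0 <= 1 ->
  exists2 C, 0 <= C & forall s, 0 <= s <= 1 -> t s0 - C * `|s - s0| <= t s.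
Proof.
move=> ct s01; pose C1 := `|t 1 - t s0| / (1 - s0); pose C0 := `|t 0 - t s0| / s0.
have C10 : 0 <= C1 by rewrite divr_ge0//; lra.
have C00 : 0 <= C0 by rewrite divr_ge0//; lra.
have step e m s : 0 <= e <= 1 -> 0 < m -> `|s - s0| <= m ->
    s = `|s - s0| / m * e + (1 - `|s - s0| / m) * s0 ->
    t s0 - `|t e - t s0| / m * `|s - s0| <= t s.
  move=> e01 m0 lm sE; set l := `|s - s0| / m in sE.
  have l01 : 0 <= l <= 1 by rewrite divr_ge0 ?(ltW m0)//= ler_pdivrMr// mul1r.
  have -> : `|t e - t s0| / m * `|s - s0| = l * `|t e - t s0| by rewrite /l; ring.
  rewrite sE; apply: le_trans (ct e s0 l e01 s01 l01).
  have -> : l * t e + (1 - l) * t s0 = t s0 - l * (- (t e - t s0)) by ring.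
  rewrite lerD2l lerN2 ler_wpM2l//; first by case/andP: l01.
  by rewrite -normrN ler_norm.
exists (C1 + C0) => [|s ss]; first by rewrite addr_ge0.
have [lt|gt|->] := ltgtP s s0; last by rewrite subrr normr0 mulr0 subr0.
- have s0_gt0 : 0 < s0 by lra.
  have sE : `|s - s0| = s0 - s by rewrite ler0_norm ?opprB//; lra.
  apply: le_trans (step 0 s0 s _ s0_gt0 _ _).
  + by rewrite lerD2l lerN2 ler_wpM2r// lerDr.
  + by rewrite lexx ler01.
  + rewrite sE; lra.
  + by rewrite sE; field; rewrite gt_eqF.
- have s1_gt0 : 0 < 1 - s0 by lra.
  have sE : `|s - s0| = s - s0 by rewrite ger0_norm//; lra.
  apply: le_trans (step 1 (1 - s0) s _ s1_gt0 _ _).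
  + by rewrite lerD2l lerN2 ler_wpM2r// lerDl.
  + by rewrite lexx ler01.
  + rewrite sE; lra.
  + by rewrite sE; field; rewrite gt_eqF.
Qed.

(** A jump upwards is excluded because the part of [Q] above a given height is
    compact, hence has a closed projection; a jump downwards is excluded by
    concavity. *)
Lemma top_function Q : compact Q -> convex_plane Q ->
  (forall z, Q z -> 0 <= z.1 <= 1) ->
  (exists y, Q (0, y)) -> (exists y, Q (1, y)) ->
  exists t, [/\ continuous t, concave01 t, forall s, 0 <= s <= 1 -> Q (s, t s) &
    forall s y, Q (s, y) -> y <= t s].
Proof.
move=> cQ vQ Q01 [y0 Q0] [y1 Q1].
have cfst : continuous (@fst R R) by move=> z; exact: cvg_fst.
have csnd : continuous (@snd R R) by move=> z; exact: cvg_snd.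
have slice s : 0 <= s <= 1 -> exists y, Q (s, y).
  move=> s01; exists (s * y1 + (1 - s) * y0).
  by have := vQ _ _ _ _ s Q1 Q0 s01; rewrite mulr1 mulr0 addr0.
have top s : {y : R | 0 <= s <= 1 -> Q (s, y) /\ forall y', Q (s, y') -> y' <= y}.
  apply/cid; have [s01|ns] := pselect (0 <= s <= 1); last by exists 0 => /ns.
  have [y Qy] := slice s s01.
  have cS : compact (Q `&` (@fst R R) @^-1` [set s]).
    apply: compact_closedI => //; exact: preimage_closed.
  have S0 : Q `&` (@fst R R) @^-1` [set s] !=set0 by exists (s, y).
  have [[s' m]] := compact_EVT_max S0 cS (continuous_subspaceT csnd).
  rewrite inE => -[Qm /= s'E] mP; rewrite s'E in Qm mP; exists m => _; split => // y' Qy'.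
  by apply: (mP (s, y')); rewrite inE.
pose t0 s := sval (top s).
have t0Q s : 0 <= s <= 1 -> Q (s, t0 s) by move=> s01; exact: (svalP (top s) s01).1.
have t0max s y : Q (s, y) -> y <= t0 s.
  by move=> Qy; exact: (svalP (top s) (Q01 _ Qy)).2.
have ct0 : concave01 t0.
  move=> x y l x01 y01 l01; apply: t0max; exact: vQ (t0Q _ x01) (t0Q _ y01) l01.
have cont0 s0 e : 0 <= s0 <= 1 -> 0 < e -> exists2 d, 0 < d &
    forall s, 0 <= s <= 1 -> `|s0 - s| < d -> `|t0 s0 - t0 s| < e.
  move=> s01 e0; have [C C0 lip] := concave01_lower_lip ct0 s01.
  have cF : compact (Q `&` (@snd R R) @^-1` [set y | t0 s0 + e <= y]).
    apply: compact_closedI => //; apply: preimage_closed; last exact: closed_ge.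
    by move=> z _; exact: csnd.
  have clF : closed ((@fst R R) @` (Q `&` (@snd R R) @^-1` [set y | t0 s0 + e <= y])).
    apply: compact_closed; first exact: Rhausdorff.
    by apply: continuous_compact => //; exact: continuous_subspaceT.
  have /open_nbhs_nbhs /nbhs_ballP : open_nbhs s0
      (~` ((@fst R R) @` (Q `&` (@snd R R) @^-1` [set y | t0 s0 + e <= y]))).
    split; first exact: closed_openC.
    move=> [[s y] [Qs /= ye] /= ss0]; move: ye; rewrite leNgt => /negP; apply.
    by rewrite -ss0 (le_lt_trans (t0max _ _ Qs))// ltrDl.
  move=> [d1 /= d10 d1P].
  exists (Num.min d1 (e / (C + 1))).
    by rewrite lt_min d10 divr_gt0//; lra.
  move=> s ss; rewrite lt_min => /andP[sd1 sd2].
  have up : t0 s < t0 s0 + e.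
    rewrite ltNge; apply/negP => h; apply: (d1P s sd1).
    by exists (s, t0 s) => //; split => //; exact: t0Q.
  have lo : t0 s0 - e < t0 s.
    apply: lt_le_trans (lip s ss); rewrite ltrD2l ltrN2 distrC.
    move: sd2; rewrite ltr_pdivlMr; last lra.
    by have := normr_ge0 (s0 - s) => h1 h2; apply: le_lt_trans h2; rewrite mulrC ler_wpM2l//; lra.
  by rewrite ltr_norml; apply/andP; split; lra.
exists (t0 \o clamp01); split.
- move=> s0; apply/cvgrPdist_lt => e e0 /=.
  have [d d0 dP] := cont0 _ _ (clamp01_bound s0) e0.
  apply/nbhs_ballP; exists d => //= s; rewrite /ball/= => sd.
  by apply: dP; [exact: clamp01_bound|exact: le_lt_trans (dist_clamp01 _ _) sd].
- move=> x y l x01 y01 l01 /=; rewrite !clamp01_id//; first exact: ct0.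
  nra.
- by move=> s s01 /=; rewrite clamp01_id//; exact: t0Q.
- by move=> s y Qs /=; rewrite clamp01_id; [exact: t0max|exact: (Q01 _ Qs)].
Qed.

(** The bottom function is the opposite of the top function of the mirror image
    of [Q]. One vertical segment inside [Q] forces all interior sections to be
    nondegenerate, by concavity of their length. *)
Lemma convex_region Q s0 y1 y2 : compact Q -> convex_plane Q ->
  (forall z, Q z -> 0 <= z.1 <= 1) ->
  (exists y, Q (0, y)) -> (exists y, Q (1, y)) ->
  0 < s0 < 1 -> y1 < y2 -> Q (s0, y1) -> Q (s0, y2) ->
  exists T B, [/\ continuous T, continuous B, concave01 T, concave01 (fun s => - B s) &
    (forall s y, Q (s, y) <-> 0 <= s <= 1 /\ B s <= y <= T s) /\
    (forall s, 0 < s < 1 -> B s < T s)].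
Proof.
move=> cQ vQ Q01 Q0 Q1 s01 y12 Qy1 Qy2.
have [T [cT vT QT maxT]] := top_function cQ vQ Q01 Q0 Q1.
pose flip (z : R * R) := (z.1, - z.2).
have cflip : continuous flip.
  apply: continuous_pair => z; first exact: cvg_fst.
  by apply: cvgN; exact: cvg_snd.
have [|||||B [cB vB QB maxB]] := @top_function (flip @` Q).
- by apply: continuous_compact => //; exact: continuous_subspaceT.
- move=> s y s' y' l [[a b] Qab [<- <-]] [[a' b'] Qab' [<- <-]] l01.
  exists (l * a + (1 - l) * a', l * b + (1 - l) * b'); first exact: vQ.
  by rewrite /flip/=; congr pair; ring.
- by move=> _ [z Qz <-]; exact: Q01 Qz.
- by have [y Qy] := Q0; exists (- y), (0, y).
- by have [y Qy] := Q1; exists (- y), (1, y).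
have {}QB s : 0 <= s <= 1 -> Q (s, - B s).
  by move=> /QB[[a b] Qab [<- <-]]; rewrite opprK.
have {}maxB s y : Q (s, y) -> - B s <= y.
  by move=> Qs; rewrite lerNl; apply: maxB; exists (s, y).
have QE s y : Q (s, y) <-> 0 <= s <= 1 /\ - B s <= y <= T s.
  split=> [Qs|[ss /andP[By yT]]].
    by split; [exact: (Q01 _ Qs)|rewrite maxB// maxT].
  have [BT|BT] := ltP (- B s) (T s); last first.
    have -> : y = T s by lra.
    exact: QT.
  pose l := (y + B s) / (T s + B s).
  have d0 : 0 < T s + B s by lra.
  have l01 : 0 <= l <= 1 by rewrite /l divr_ge0 ?ler_pdivrMr//; lra.
  have := vQ _ _ _ _ l (QT _ ss) (QB _ ss) l01.
  congr (Q (_, _)); first by ring.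
  by rewrite /l; field; rewrite gt_eqF.
exists T, (fun s => - B s); split => //.
- by move=> s; apply: cvgN; exact: cB.
- by under eq_fun do rewrite opprK.
split => // s ss.
have f0 : 0 < T s0 + B s0 by have := maxT _ _ Qy2; have := maxB _ _ Qy1; lra.
have fpos x : 0 <= x <= 1 -> 0 <= T x + B x.
  by move=> x01; have := maxT _ _ (QB _ x01); lra.
have s0c : 0 <= s0 <= 1 by lra.
have z01 : 0 <= (0 : R) <= 1 by rewrite lexx ler01.
have o01 : 0 <= (1 : R) <= 1 by rewrite lexx ler01.
have fconc e l : 0 <= e <= 1 -> 0 <= l < 1 -> s = l * e + (1 - l) * s0 -> - B s < T s.
  move=> e01 /andP[l0 l1] sE; have l01 : 0 <= l <= 1 by rewrite l0 ltW.
  have h1 := vT _ _ _ e01 s0c l01; have h2 := vB _ _ _ e01 s0c l01.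
  rewrite -sE in h1 h2; have h3 := fpos _ e01.
  have h4 : 0 <= l * (T e + B e) by rewrite mulr_ge0.
  have h5 : 0 < (1 - l) * (T s0 + B s0) by rewrite mulr_gt0// subr_gt0.
  lra.
have [ss0|ss0] := leP s s0.
  apply: (fconc 0 (1 - s / s0)) => //; last by field; rewrite gt_eqF//; case/andP: s01.
  have s0p : 0 < s0 by lra.
  rewrite subr_ge0 ler_pdivrMr// mul1r ss0 ltrBlDr ltrDl divr_gt0//; lra.
have s1p : 0 < 1 - s0 by lra.
apply: (fconc 1 ((s - s0) / (1 - s0))) => //; last by field; rewrite gt_eqF.
rewrite divr_ge0 ?ltr_pdivrMr//; lra.
Qed.

End convex_region.

(** * Coordinates adapted to the direction u *)

Section chart.
Context {R : realType}.
Implicit Types (K : set (R * R)) (u z : R * R) (L s x y : R).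

(** The rotation taking the first axis to [u], scaled by [L] and translated so that
    the first coordinate of a point [z] is [(dotp u z - x0) / L]. *)
Definition chart u x0 L z : R * R :=
  ((x0 + L * z.1) * u.1 - L * z.2 * u.2, (x0 + L * z.1) * u.2 + L * z.2 * u.1).

Definition unchart u x0 L z : R * R :=
  ((dotp u z - x0) / L, (z.2 * u.1 - z.1 * u.2) / L).

Lemma eucl_norm1 u : eucl_norm u = 1 -> u.1 ^+ 2 + u.2 ^+ 2 = 1.
Proof.
rewrite /eucl_norm /dotp -!expr2 => u1.
by rewrite -[LHS]sqr_sqrtr ?u1 ?expr1n// addr_ge0 ?sqr_ge0.
Qed.

Lemma chartK u x0 L : 0 < L -> u.1 ^+ 2 + u.2 ^+ 2 = 1 ->
  cancel (chart u x0 L) (unchart u x0 L).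
Proof.
move=> L0 u1 [s y]; rewrite /unchart /chart /dotp/=; congr pair.
  apply: (mulIf (lt0r_neq0 L0)); rewrite divfK ?lt0r_neq0//.
  transitivity ((x0 + L * s) * (u.1 ^+ 2 + u.2 ^+ 2) - x0); first by ring.
  by rewrite u1; ring.
apply: (mulIf (lt0r_neq0 L0)); rewrite divfK ?lt0r_neq0//.
transitivity (L * y * (u.1 ^+ 2 + u.2 ^+ 2)); first by ring.
by rewrite u1; ring.
Qed.

Lemma unchartK u x0 L : 0 < L -> u.1 ^+ 2 + u.2 ^+ 2 = 1 ->
  cancel (unchart u x0 L) (chart u x0 L).
Proof.
move=> L0 u1 [s y]; rewrite /unchart /chart /dotp/=.
have Lc (a : R) : L * (a / L) = a by rewrite mulrC divfK ?lt0r_neq0.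
rewrite !Lc; congr pair.
  transitivity (s * (u.1 ^+ 2 + u.2 ^+ 2)); first by ring.
  by rewrite u1 mulr1.
transitivity (y * (u.1 ^+ 2 + u.2 ^+ 2)); first by ring.
by rewrite u1 mulr1.
Qed.

Lemma dotp_chart u x0 L z : u.1 ^+ 2 + u.2 ^+ 2 = 1 ->
  dotp u (chart u x0 L z) = x0 + L * z.1.
Proof.
move=> u1; rewrite /dotp /chart/=.
transitivity ((x0 + L * z.1) * (u.1 ^+ 2 + u.2 ^+ 2)); first by ring.
by rewrite u1 mulr1.
Qed.

Lemma eucl_dist_chart u x0 L z w : 0 < L -> u.1 ^+ 2 + u.2 ^+ 2 = 1 ->
  eucl_dist (chart u x0 L z) (chart u x0 L w) =
  L * Num.sqrt ((z.1 - w.1) ^+ 2 + (z.2 - w.2) ^+ 2).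
Proof.
move=> L0 u1; rewrite /eucl_dist /eucl_norm /dotp /chart/=.
have -> (D : R) : L * Num.sqrt D = Num.sqrt (L ^+ 2 * D).
  by rewrite sqrtrM ?sqr_ge0// sqrtr_sqr gtr0_norm.
congr Num.sqrt.
transitivity (L ^+ 2 * ((z.1 - w.1) ^+ 2 + (z.2 - w.2) ^+ 2) * (u.1 ^+ 2 + u.2 ^+ 2)).
  by ring.
by rewrite u1 mulr1.
Qed.

Lemma continuous_affine_pair (a b c : R) :
  continuous (fun z : R * R => a * z.1 + b * z.2 + c).
Proof.
move=> z; apply: cvgD; last exact: cvg_cst.
by apply: cvgD; apply: cvgM; [exact: cvg_cst|exact: cvg_fst|exact: cvg_cst|exact: cvg_snd].
Qed.

Lemma continuous_unchart u x0 L : continuous (unchart u x0 L).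
Proof.
apply: continuous_pair.
  rewrite (_ : (fun z => _) = fun z => u.1 / L * z.1 + u.2 / L * z.2 + - (x0 / L)).
    exact: continuous_affine_pair.
  by apply/funext => z; rewrite /dotp; ring.
rewrite (_ : (fun z => _) = fun z => - (u.2 / L) * z.1 + u.1 / L * z.2 + 0).
  exact: continuous_affine_pair.
by apply/funext => z; ring.
Qed.

Lemma continuous_chart u x0 L : continuous (chart u x0 L).
Proof.
apply: continuous_pair.
  rewrite (_ : (fun z => _) = fun z => L * u.1 * z.1 + - (L * u.2) * z.2 + x0 * u.1).
    exact: continuous_affine_pair.
  by apply/funext => z; ring.
rewrite (_ : (fun z => _) = fun z => L * u.2 * z.1 + L * u.1 * z.2 + x0 * u.2).
  exact: continuous_affine_pair.
by apply/funext => z; ring.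
Qed.

Lemma convex_body_convex K z w l : convex_body K -> K z -> K w -> 0 <= l <= 1 ->
  K (l * z.1 + (1 - l) * w.1, l * z.2 + (1 - l) * w.2).
Proof.
move=> [_ cK _] Kz Kw /andP[l0 l1].
have := cK z w (Itv01 l0 l1); rewrite !inE => /(_ Kz Kw).
by congr K.
Qed.

(** [x0] and [x0 + L] are the extreme values of [dotp u] on [K]. A disc inside
    [K] shows that they differ, and contains a segment orthogonal to [u]. *)
Lemma convex_body_chart K u : convex_body K -> u.1 ^+ 2 + u.2 ^+ 2 = 1 ->
  exists x0 L T B, [/\ 0 < L,
   continuous T /\ continuous B, concave01 T /\ concave01 (fun s => - B s),
   forall s y, K (chart u x0 L (s, y)) <-> 0 <= s <= 1 /\ B s <= y <= T s &
   forall s, 0 < s < 1 -> B s < T s].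
Proof.
move=> hK u1; have [cK _ [z0 z0K]] := hK.
have cdot : continuous (dotp u).
  rewrite (_ : dotp u = fun z => u.1 * z.1 + u.2 * z.2 + 0).
    exact: continuous_affine_pair.
  by apply/funext => z; rewrite /dotp; ring.
have K0 : K !=set0 by exists z0; exact: interior_subset.
have [zmin] := compact_EVT_min K0 cK (continuous_subspaceT cdot).
rewrite inE => Kzmin minP.
have [zmax] := compact_EVT_max K0 cK (continuous_subspaceT cdot).
rewrite inE => Kzmax maxP.
move: z0K => /nbhs_ballP[e /= e0 eK].
have normu (i : R) : i ^+ 2 <= 1 -> `|e / 2 * i| < e.
  move=> i1; have h : `|i| <= 1.
    by rewrite -(ler_pXn2r (_ : 0 < 2)%N) ?nnegrE// real_normK ?num_real// expr1n.
  rewrite normrM (gtr0_norm (divr_gt0 e0 _))//.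
  have := ler_wpM2l (ltW (divr_gt0 e0 (ltr0n R 2))) h; lra.
have u1le : u.1 ^+ 2 <= 1 by rewrite -u1 lerDl sqr_ge0.
have u2le : u.2 ^+ 2 <= 1 by rewrite -u1 lerDr sqr_ge0.
have Kball (a b : R) : a ^+ 2 <= 1 -> b ^+ 2 <= 1 ->
    K (z0.1 + e / 2 * a, z0.2 + e / 2 * b).
  move=> a1 b1; apply: eK; split; rewrite /ball/= opprD addrA subrr add0r normrN;
  exact: normu.
have N1 (i : R) : i ^+ 2 <= 1 -> (- i) ^+ 2 <= 1 by rewrite sqrrN.
pose x0 := dotp u zmin; pose L := dotp u zmax - x0.
have {}minP z : K z -> x0 <= dotp u z by move=> Kz; apply: minP; rewrite inE.
have {}maxP z : K z -> dotp u z <= x0 + L.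
  by move=> Kz; rewrite /L addrC subrK; apply: maxP; rewrite inE.
have lo : x0 <= dotp u z0 - e / 2.
  have := minP _ (Kball _ _ (N1 _ u1le) (N1 _ u2le)); rewrite /dotp/=.
  rewrite (_ : _ + _ = z0.1 * u.1 + z0.2 * u.2 - e / 2 * (u.1 ^+ 2 + u.2 ^+ 2)); last by ring.
  by rewrite u1 mulr1.
have hi : dotp u z0 + e / 2 <= x0 + L.
  have := maxP _ (Kball _ _ u1le u2le); rewrite /dotp/=.
  rewrite (_ : _ + _ = z0.1 * u.1 + z0.2 * u.2 + e / 2 * (u.1 ^+ 2 + u.2 ^+ 2)); last by ring.
  by rewrite u1 mulr1.
have L0 : 0 < L by lra.
pose Q := unchart u x0 L @` K.
have QE z : Q z <-> K (chart u x0 L z).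
  split=> [[w Kw <-]|Kz]; first by rewrite unchartK.
  by exists (chart u x0 L z) => //; rewrite chartK.
have Qun z : K z -> Q (unchart u x0 L z) by move=> Kz; exists z.
pose s0 := (dotp u z0 - x0) / L.
pose yc := (z0.2 * u.1 - z0.1 * u.2) / L.
pose d := e / 2 / L.
have d0 : 0 < d by rewrite !divr_gt0.
have Qy (c : R) : c = 1 \/ c = -1 -> Q (s0, yc + c * d).
  move=> c1; have c2 : c ^+ 2 = 1 by case: c1 => ->; rewrite ?sqrrN expr1n.
  have := Qun _ (Kball (- (c * u.2)) (c * u.1) _ _).
  rewrite !sqrrN !exprMn c2 !mul1r => /(_ u2le u1le); congr (Q _).
  rewrite /unchart /dotp/=; congr pair; rewrite /s0 /yc /d /dotp.
    by congr (_ / _); congr (_ - _); ring.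
  transitivity ((z0.2 * u.1 - z0.1 * u.2) / L + c * (e / 2 / L) * (u.1 ^+ 2 + u.2 ^+ 2)).
    by field; rewrite gt_eqF.
  by rewrite u1 mulr1.
have [|||||||||T [B [cT cB vT vB [TB TBlt]]]] := @convex_region _ Q s0 (yc + -1 * d) (yc + 1 * d).
- by apply: continuous_compact => //; apply: continuous_subspaceT; exact: continuous_unchart.
- move=> s y s' y' l /QE Ks /QE Ks' l01; apply/QE.
  have := convex_body_convex hK Ks Ks' l01; congr (K _).
  by rewrite /chart/=; congr pair; ring.
- move=> _ [z Kz <-]; rewrite /unchart/=.
  apply/andP; split; last by rewrite ler_pdivrMr// mul1r lerBlDl maxP.
  by apply: divr_ge0; [rewrite subr_ge0 minP|exact: ltW].
- exists (unchart u x0 L zmin).2.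
  have := Qun _ Kzmin; congr (Q _); rewrite /unchart/=; congr pair.
  by rewrite subrr mul0r.
- exists (unchart u x0 L zmax).2.
  have := Qun _ Kzmax; congr (Q _); rewrite /unchart/=; congr pair.
  by rewrite divff// gt_eqF.
- rewrite divr_gt0 ?ltr_pdivrMr//; lra.
- lra.
- by apply: Qy; right.
- by apply: Qy; left.
exists x0, L, T, B; split => // s y.
by split=> [/QE/TB|/TB/QE].
Qed.

End chart.

(** * Primitives and affine substitutions *)

Section integral_tools.
Context {R : realType}.
Local Notation int01 := (integ (0 : R) 1).
Local Notation mu := (@lebesgue_measure R).

Lemma continuous_bmeas (f : R -> R) : continuous f -> bmeas f.
Proof.
move=> cf; split; first exact: continuous_measurable_fun.
have [|c _ cP] := @EVT_max R (fun x => `|f x|) 0 1 ler01.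
  by apply: continuous_subspaceT => x; apply: cvg_norm; exact: cf.
by exists `|f c| => x x01; apply: cP; rewrite in_itv.
Qed.

Lemma integ_primitive (f : R -> R) : continuous f -> exists P : R -> R,
  (forall x : R, 0 <= x <= 1 -> is_derive x (1 : R) P (f x)) /\
  forall a b, 0 <= a -> a <= b -> b <= 1 -> integ a b f = P b - P a.
Proof.
move=> cf; pose P x := (\int[mu]_(t in `[(-1)%R, x]) f t)%R.
have intf a b : mu.-integrable `[a, b] (EFin \o f).
  apply: continuous_compact_integrable; first exact: segment_compact.
  exact: continuous_subspaceT.
exists P; split.
  move=> x x01; have x2 : x < 2 by lra.
  have x1 : -1 < x by lra.
  have [dP P'] := continuous_FTC1_closed x2 (intf _ _) x1 (cf x).
  rewrite derive1E in P'; exact: DeriveDef dP P'.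
move=> a b a0 ab b1; rewrite /integ /P.
rewrite Rintegral_itvB//; try (by rewrite bnd_simp; lra).
by rewrite Rintegral_itv_obnd_cbnd//; apply: integrableS (intf a b) => // x /=;
  rewrite !in_itv/= => /andP[ax ->]; rewrite (ltW ax).
Qed.

(** Integration by parts: with [P] a primitive of [f], the left integrand minus
    the right one is the derivative of
    [- (1 - s) ^+ 3 / 3 * (P s - P 0) + s ^+ 3 / 3 * (P 1 - P s)], which vanishes at
    both ends. *)
Lemma integ_cdf_parts (f : R -> R) : continuous f ->
  int01 (fun s => (1 - s) ^+ 2 * integ 0 s f + s ^+ 2 * integ s 1 f) =
  int01 (fun t => f t * (((1 - t) ^+ 3 + t ^+ 3) / 3)).
Proof.
move=> cf; have [P [dP intP]] := integ_primitive cf.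
pose q (s : R) := ((1 - s) ^+ 3 + s ^+ 3) / 3.
pose qp : {poly R} := 3^-1 *: ((1 - 'X) ^+ 3 + 'X ^+ 3).
have qE s : q s = qp.[s].
  rewrite /q /qp !(hornerZ, hornerD, hornerN, hornerX, horner_exp, hornerC).
  by rewrite mulrC.
have cr : continuous (fun t => f t * q t).
  move=> t; apply: cvgM; first exact: cf.
  by rewrite (funext qE); exact: continuous_horner.
have [Q [dQ intQ]] := integ_primitive cr.
rewrite [RHS]intQ// ?lexx ?ler01//.
pose p1 : {poly R} := (- 3^-1)%:P + 'X - 'X^2 + 3^-1 *: 'X^3.
pose p2 : {poly R} := 3^-1 *: 'X^3.
have p1E (x : R) : p1.[x] = - ((1 - x) ^+ 3) / 3.
  by rewrite /p1 !(hornerD, hornerN, hornerZ, hornerXn, hornerX, hornerC); clear; field.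
have p2E (x : R) : p2.[x] = x ^+ 3 / 3.
  by rewrite /p2 hornerZ hornerXn; clear; field.
have d1 (x : R) : is_derive x (1 : R) (horner p1) ((1 - x) ^+ 2).
  apply: DeriveDef; first exact: derivable_horner.
  rewrite -derive1E -derivE /p1 !derivD !derivN !derivZ !derivXn derivX derivC /=.
  rewrite !(hornerD, hornerN, hornerZ, hornerMn, hornerXn, hornerX, hornerC).
  by clear; field.
have d2 (x : R) : is_derive x (1 : R) (horner p2) (x ^+ 2).
  apply: DeriveDef; first exact: derivable_horner.
  rewrite -derive1E -derivE /p2 derivZ derivXn /= hornerZ hornerMn hornerXn.
  by clear; field.
pose H : R -> R := horner p1 * (P - cst (P 0)) + horner p2 * (cst (P 1) - P) + Q.
have dH (x : R) : 0 <= x <= 1 -> is_derive x (1 : R) H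
    ((1 - x) ^+ 2 * (P x - P 0) + x ^+ 2 * (P 1 - P x)).
  move=> x01; have dPx := dP x x01; have dQx := dQ x x01.
  have := is_deriveD (is_deriveD (is_deriveM (d1 x) (is_deriveB dPx (is_derive_cst (P 0) x 1)))
    (is_deriveM (d2 x) (is_deriveB (is_derive_cst (P 1) x 1) dPx))) dQx.
  move=> DH; apply: is_derive_eq DH _.
  rewrite /= !fctE /= /GRing.scale /= p1E p2E /q.
  by move: (P x) (P 0) (P 1) (f x) => *; clear; field.
have cP (x : R) : 0 <= x <= 1 -> {for x, continuous P}.
  by move=> x01; have [dPx _] := dP x x01; apply: differentiable_continuous; exact/derivable1_diffP.
have cH (x : R) : 0 <= x <= 1 -> {for x, continuous H}.
  by move=> x01; have [dHx _] := dH x x01; apply: differentiable_continuous; exact/derivable1_diffP.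
have i0 : 0 <= (0 : R) <= 1 by rewrite lexx ler01.
have i1 : 0 <= (1 : R) <= 1 by rewrite lexx ler01.
transitivity (int01 (fun x => (1 - x) ^+ 2 * (P x - P 0) + x ^+ 2 * (P 1 - P x))).
  by apply: eq_integ => x /andP[x0 x1]; rewrite !intP ?lexx.
rewrite /integ /Rintegral (@continuous_FTC2 _ _ H)//.
- rewrite /= /H !fctE /= !p1E !p2E.
  by move: (P 0) (P 1) (Q 0) (Q 1) => *; clear; field.
- apply: continuous_in_subspaceT => x; rewrite inE/= in_itv/= => x01.
  have cPx := cP x x01.
  have c1 : {for x, continuous (fun s : R => 1 - s)} by apply: cvgB; [exact: cvg_cst|exact: cvg_id].
  apply: cvgD; apply: cvgM.
  + by apply: cvgM; exact: c1.
  + by apply: cvgB; [exact: cPx|exact: cvg_cst].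
  + by apply: cvgM; exact: cvg_id.
  + by apply: cvgB; [exact: cvg_cst|exact: cPx].
- split.
  + by move=> x; rewrite in_itv/= => /andP[x0 x1]; have [] := dH x; rewrite ?ltW.
  + by apply: cvg_at_right_filter; exact: cH.
  + by apply: cvg_at_left_filter; exact: cH.
- move=> x; rewrite in_itv/= => /andP[x0 x1].
  by rewrite derive1E; have [] := dH x; rewrite ?ltW.
Qed.

Section affine_substitution.
Context (k m : R) (k0 : k != 0).

Let F (s : measurableTypeR R) : measurableTypeR R := k * s + m.

Let mF : measurable_fun [set: measurableTypeR R] F.
Proof. by apply: measurable_funD => //; exact: measurable_funM. Qed.

Let knng : {nonneg R} := NngNum (normr_ge0 k).

Let nu : {measure set (measurableTypeR R) -> \bar R} :=
  mscale knng (measure_function_pushforward__canonical__measure_function_Measure mu mF).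

Let muE (A : set (measurableTypeR R)) : measurable A -> mu A = nu A.
Proof.
move=> mA; apply: lebesgue_measure_unique => //= _ [[a b] _ <-].
rewrite -[nu _]/(`|k|%:E * mu (F @^-1` `]a, b]%classic))%E.
have [kn|kp|/eqP] := ltgtP k 0; last by rewrite (negbTE k0).
  rewrite (_ : F @^-1` _ = `[((b - m) / k)%R, ((a - m) / k)%R[%classic); last first.
    apply/seteqP; split => s /=; rewrite !in_itv/= /F ler_ndivrMr// ltr_ndivlMr//;
    by rewrite lerBrDr ltrBlDr mulrC andbC.
  rewrite !lebesgue_measure_itv/= !lte_fin ltr_nM2r ?invr_lt0// ltrD2r.
  case: ifP => ab; last by rewrite mule0.
  by rewrite ltr0_norm// -!EFinB -EFinM; congr EFin; field.
rewrite (_ : F @^-1` _ = `]((a - m) / k)%R, ((b - m) / k)%R]%classic); last first.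
  apply/seteqP; split => s /=; rewrite !in_itv/= /F ltr_pdivrMr// ler_pdivlMr//;
  by rewrite lerBrDr ltrBlDr mulrC.
rewrite !lebesgue_measure_itv/= !lte_fin ltr_pM2r ?invr_gt0// ltrD2r.
case: ifP => ab; last by rewrite mule0.
by rewrite gtr0_norm// -!EFinB -EFinM; congr EFin; field.
Qed.

Lemma affine_integral (g : measurableTypeR R -> \bar R) :
  measurable_fun setT g -> (forall x, 0 <= g x)%E ->
  (\int[mu]_x g x = `|k|%:E * \int[mu]_s g (k * s + m)%R)%E.
Proof.
move=> mg g0; rewrite (@eq_measure_integral _ _ _ _ nu)//; last first.
  by move=> A mA _; exact: muE.
rewrite ge0_integral_mscale//; congr (_ * _)%E.
by rewrite ge0_integral_pushforward.
Qed.

End affine_substitution.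

End integral_tools.

(** * Area in adapted coordinates *)

Section area_in_chart.
Context {R : realType}.
Local Notation mu := (@lebesgue_measure R).
Local Open Scope ereal_scope.

Lemma measurable_affine_map (a b c a' b' c' : R) :
  measurable_fun [set: plane R]
    (fun w : plane R => (a * w.1 + b * w.2 + c, a' * w.1 + b' * w.2 + c')%R : plane R).
Proof.
have m1 : measurable_fun [set: plane R] (fun w : plane R => w.1 : measurableTypeR R).
  exact: measurable_fst.
have m2 : measurable_fun [set: plane R] (fun w : plane R => w.2 : measurableTypeR R).
  exact: measurable_snd.
by apply: measurable_fun_pair; apply: measurable_funD => //;
  apply: measurable_funD; apply: measurable_funM.
Qed.

(** The chart is factored into one affine substitution in each variable, between
    which Tonelli exchanges the order of integration; when [u] lies on the first
    axis the two variables are already separated. The constant cancels on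
    normalization, hence the existential form. *)
Lemma area_chart (u : R * R) (x0 L : R) : (0 < L)%R -> (u.1 ^+ 2 + u.2 ^+ 2 = 1)%R ->
  exists2 c : R, (0 < c)%R & forall W : set (plane R), measurable W ->
    area W = c%:E * \int[mu]_s mu [set y | W (chart u x0 L (s, y))].
Proof.
move=> L0 u1.
pose i (W : set (plane R)) (z : plane R) : \bar R := (\1_W z : R)%:E.
have mi (W : set (plane R)) : measurable W -> measurable_fun [set: plane R] (i W).
  by move=> mW; exact/measurable_EFinP/measurable_indic.
have i0 (W : set (plane R)) z : 0 <= i W z by rewrite lee_fin indicE.
have indic_int (W : set (plane R)) : measurable W ->
    area W = \int[mu]_x \int[mu]_y i W (x, y).
  move=> mW; rewrite -[in LHS](setIT W) -[LHS]integral_indic//.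
  exact: (fubini_tonelli1 (m1 := mu) (m2 := mu) _ (mi W mW) (i0 W)).
have mpair1 (x : R) : measurable_fun [set: measurableTypeR R]
    (fun y : measurableTypeR R => (x, y) : plane R) by exact: pair1_measurable.
have mpair2 (y : R) : measurable_fun [set: measurableTypeR R]
    (fun x : measurableTypeR R => (x, y) : plane R) by exact: pair2_measurable.
have mchart : measurable_fun [set: plane R] (chart u x0 L : plane R -> plane R).
  rewrite (_ : chart u x0 L = fun w => ((L * u.1) * w.1 + - (L * u.2) * w.2 + x0 * u.1,
    (L * u.2) * w.1 + (L * u.1) * w.2 + x0 * u.2)%R); first exact: measurable_affine_map.
  by apply/funext => w; rewrite /chart; congr pair; ring.
have slice (W : set (plane R)) s : measurable W ->
    \int[mu]_y i W (chart u x0 L (s, y)) = mu [set y | W (chart u x0 L (s, y))].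
  move=> mW; rewrite -[in RHS](setIT [set y | _]) -[RHS]integral_indic//.
  have : measurable_fun [set: measurableTypeR R]
      (fun y : measurableTypeR R => chart u x0 L (s, y) : plane R).
    exact: measurableT_comp mchart (mpair1 s).
  by move=> /(_ measurableT _ mW); rewrite setTI.
have mslice (W : set (plane R)) : measurable W ->
    measurable_fun [set: measurableTypeR R] (fun s : measurableTypeR R => mu [set y | W (chart u x0 L (s, y))]).
  move=> mW; rewrite (_ : (fun s => mu _) =
      (fun s => \int[mu]_y i W (chart u x0 L (s, y)))); last first.
    by apply/funext => s; rewrite slice.
  exact: (measurable_fun_fubini_tonelli_F (m2 := mu) _
    (measurableT_comp (mi W mW) mchart) (fun w => i0 W (chart u x0 L w))).
have [u2_eq0|u2_neq0] := eqVneq u.2 0%R.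
  have u1_neq0 : u.1 != 0%R.
    by apply/eqP => u1_eq0; move: u1; rewrite u2_eq0 u1_eq0 expr0n addr0 => /esym/eqP; rewrite oner_eq0.
  have k0 : (L * u.1)%R != 0%R by rewrite mulf_neq0// gt_eqF.
  exists (`|L * u.1| * `|L * u.1|)%R; first by rewrite mulr_gt0// normr_gt0.
  move=> W mW; rewrite indic_int//.
  have mG := measurable_fun_fubini_tonelli_F (m2 := mu) _ (mi W mW) (i0 W).
  rewrite (affine_integral (x0 * u.1) k0 mG); last first.
    by move=> x; apply: integral_ge0 => y _; exact: i0.
  rewrite EFinM -muleA; congr (_ * _).
  rewrite -ge0_integralZl//; last first.
    exact: mslice.
  apply: eq_integral => s _; rewrite -slice//.
  apply: (etrans (affine_integral 0 k0 (measurableT_comp (mi W mW) (mpair1 _))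
    (fun y => i0 W (_, y)))).
  congr (_ * _); apply: eq_integral => y _; congr (i W _).
  by rewrite /chart u2_eq0/=; congr pair; ring.
pose k := (L / u.2)%R; pose k' := (- (L * u.2))%R.
have k0 : k != 0%R by rewrite mulf_neq0 ?invr_neq0// gt_eqF.
have k0' : k' != 0%R by rewrite oppr_eq0 mulf_neq0// gt_eqF.
exists (`|k| * `|k'|)%R; first by rewrite mulr_gt0// normr_gt0.
move=> W mW; rewrite indic_int//.
pose g (w : plane R) : plane R := (w.1, k * w.2 + (x0 - u.1 * w.1) / u.2)%R.
have mg : measurable_fun [set: plane R] (fun w => i W (g w)).
  apply: measurableT_comp (mi W mW) _.
  rewrite (_ : g = fun w => (1 * w.1 + 0 * w.2 + 0, - (u.1 / u.2) * w.1 + k * w.2 + x0 / u.2)%R).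
    exact: measurable_affine_map.
  by apply/funext => w; rewrite /g; congr pair; ring.
transitivity (`|k|%:E * \int[mu]_x \int[mu]_s i W (g (x, s))).
  rewrite -ge0_integralZl//; last 2 first.
  - exact: (measurable_fun_fubini_tonelli_F (m2 := mu) _ mg (fun w => i0 W (g w))).
  - by move=> x _; apply: integral_ge0 => y _; exact: i0.
  apply: eq_integral => x _.
  exact: (affine_integral ((x0 - u.1 * x) / u.2) k0
    (measurableT_comp (mi W mW) (mpair1 x)) (fun y => i0 W (x, y))).
rewrite EFinM -muleA; congr (_ * _).
rewrite (fubini_tonelli _ mg (fun w => i0 W (g w))) -ge0_integralZl//; last first.
  exact: mslice.
apply: eq_integral => s _; rewrite -slice//.
apply: (etrans (affine_integral ((x0 + L * s) * u.1) k0'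
  (measurableT_comp mg (mpair2 s)) (fun y => i0 W (g (y, s))))).
congr (_ * _); apply: eq_integral => y _; congr (i W _).
rewrite /chart /g/=; congr pair; first by rewrite /k'; ring.
have e : (u.1 ^+ 2 = 1 - u.2 ^+ 2)%R by rewrite -u1 addrK.
transitivity ((x0 + L * s) * (1 - u.1 ^+ 2) / u.2 + L * y * u.1)%R.
  by rewrite /k /k'; field.
by rewrite e; field.
Qed.

End area_in_chart.

(** * Distribution functions of projections *)

Section gini_bounds.
Context {R : realType}.
Local Notation mu := (@lebesgue_measure R).
Local Notation int01 := (integ (0 : R) 1).
Context (rho : probability R R) (x0 L : R) (F : R -> R).
Context (L0 : 0 < L)
  (rhoF : forall s, rho `]-oo, (x0 + L * s)%R]%classic = (F s)%:E).

Lemma cdf_bounds s : 0 <= F s <= 1.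
Proof. by rewrite -!lee_fin -rhoF measure_ge0 probability_le1. Qed.

Lemma cdf_nondecr s t : s <= t -> F s <= F t.
Proof.
move=> st; rewrite -lee_fin -!rhoF le_measure ?inE//.
by apply: subset_itvl; rewrite bnd_simp lerD2l ler_pM2l.
Qed.

Lemma measurable_cdf : measurable_fun [set: R] F.
Proof. by apply: nondecreasing_measurable => // x y /cdf_nondecr. Qed.

Lemma gini_cdfE : gini_mean_difference rho =
  (\int[mu]_s (2 * L * (F s * (1 - F s)))%:E)%E.
Proof.
rewrite (gini_cdf rho x0 L0); apply: eq_integral => s _.
rewrite rhoF (_ : rho `](x0 + L * s)%R, +oo[%classic = (1 - F s)%:E) -?EFinM//.
by rewrite -setCitvl probability_setC// rhoF.
Qed.

Let measurable_F (c : R) (D : set R) :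
  measurable_fun D (fun s => (c * (F s * (1 - F s)))%:E).
Proof.
apply: measurable_funTS; apply/measurable_EFinP; apply: measurable_funM => //.
apply: measurable_funM; first exact: measurable_cdf.
by apply: measurable_funB => //; exact: measurable_cdf.
Qed.

Let F_ge0 s : 0 <= F s * (1 - F s).
Proof. by have /andP[F0 F1] := cdf_bounds s; rewrite mulr_ge0// subr_ge0. Qed.

Let integE (B : R -> R) : bmeas B ->
  ((int01 B)%:E = \int[mu]_(s in `[0%R, 1%R]) (B s)%:E)%E.
Proof.
move=> bB; rewrite /integ /Rintegral fineK//.
exact: integrable_fin_num (bmeas_integrable (lexx 0) (lexx 1) bB).
Qed.

Lemma gini_le (B : R -> R) : bmeas B ->
  (forall s, s < 0 -> F s = 0) -> (forall s, 1 < s -> F s = 1) ->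
  (forall s, 0 <= s <= 1 -> F s * (1 - F s) <= B s) ->
  (gini_mean_difference rho <= (2 * L * int01 B)%:E)%E.
Proof.
move=> bB F0 F1 FB; have bLB : bmeas (fun s => 2 * L * B s).
  by apply: bmeasM => //; exact: bmeas_cst.
rewrite -integZ// integE// gini_cdfE.
rewrite (_ : (\int[mu]_s _ = \int[mu]_(s in `[0%R, 1%R]) (2 * L * (F s * (1 - F s)))%:E)%E).
  apply: ge0_le_integral => //.
  - by move=> s _; rewrite lee_fin; apply: mulr_ge0 => //; rewrite mulr_ge0// ltW.
  - exact: measurable_F.
  - by apply/measurable_EFinP; apply: measurable_funTS; case: bLB.
  - move=> s; rewrite /= in_itv/= => s01; rewrite lee_fin ler_wpM2l ?FB//.
    by rewrite mulr_ge0// ltW.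
rewrite [RHS]integral_mkcond; apply: eq_integral => s _; rewrite patchE.
case: ifPn => //; rewrite notin_setE/= in_itv/= => /negP.
by rewrite negb_and -!ltNge => /orP[/F0|/F1] ->; rewrite ?subrr ?mul0r ?mulr0.
Qed.

Lemma gini_ge (B : R -> R) : bmeas B ->
  (forall s, 0 < s < 1 -> 0 <= B s <= F s * (1 - F s)) ->
  ((2 * L * int01 B)%:E <= gini_mean_difference rho)%E.
Proof.
move=> bB BF; have bLB : bmeas (fun s => 2 * L * B s).
  by apply: bmeasM => //; exact: bmeas_cst.
have mLB D : measurable_fun D (fun s => (2 * L * B s)%:E).
  by apply/measurable_EFinP; apply: measurable_funTS; case: bLB.
have LL : 0 <= 2 * L by rewrite mulr_ge0// ltW.
rewrite -integZ// integE// gini_cdfE integral_itv_bndoo//.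
apply: (@le_trans _ _ (\int[mu]_(s in `]0%R, 1%R[) (2 * L * (F s * (1 - F s)))%:E)%E).
  apply: ge0_le_integral => //.
  - move=> s; rewrite /= in_itv/= => /BF/andP[B0 _].
    by rewrite lee_fin mulr_ge0.
  - exact: mLB.
  - exact: measurable_F.
  - move=> s; rewrite /= in_itv/= => /BF/andP[_ B0].
    by rewrite lee_fin ler_wpM2l.
apply: ge0_subset_integral => //; first exact: measurable_F.
move=> s _.
by rewrite lee_fin; apply: mulr_ge0 => //.
Qed.

End gini_bounds.

Section normalized_projection.
Context {R : realType}.

(** A positive finite mass excludes the default probability of the
    normalization. *)
Lemma projection_normalized (nu : {measure set (plane R) -> \bar R})
    (D : set (plane R)) (mD : measurable D) (u : R * R) (A : set R) (m : R) :
  measurable A -> 0 < m -> nu D = m%:E ->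
  distribution (normalized_on nu mD) (projection u) A =
  (nu (D `&` [set z | A (dotp u z)]) * (m^-1)%:E)%E.
Proof.
move=> mA m0 nuD.
rewrite /distribution /pushforward /normalized_on /=.
rewrite /mnormalize /= /mrestr/= setTI nuD /= eqe gt_eqF//=.
by rewrite setIC.
Qed.

End normalized_projection.

(** * The upper bound for the area projection *)

Section area_projection_bound.
Context {R : realType}.
Local Notation mu := (@lebesgue_measure R).
Local Notation int01 := (integ (0 : R) 1).

Lemma continuous_ge0_on_closure (f : R -> R) : continuous f ->
  (forall s, 0 < s < 1 -> 0 < f s) -> forall s, 0 <= s <= 1 -> 0 <= f s.
Proof.
move=> cf f0 s /andP[]; rewrite le_eqVlt => /predU1P[<- _|s0].
  have cf0 : f x @[x --> 0^'+] --> f 0.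
    by apply: cvg_at_right_filter; exact: cf.
  rewrite -(cvg_lim _ cf0)//; apply: limr_ge; first by apply/cvg_ex; eexists; exact: cf0.
  near=> x; apply/ltW/f0; apply/andP; split; first by near: x; exact: nbhs_right_gt.
  by near: x; apply: nbhs_right_lt; exact: ltr01.
rewrite le_eqVlt => /predU1P[->|s1]; last by rewrite ltW// f0// s0.
have cf1 : f x @[x --> 1^'-] --> f 1.
  by apply: cvg_at_left_filter; exact: cf.
rewrite -(cvg_lim _ cf1)//; apply: limr_ge; first by apply/cvg_ex; eexists; exact: cf1.
near=> x; apply/ltW/f0; apply/andP; split; last by near: x; exact: nbhs_left_lt.
by near: x; apply: nbhs_left_gt; exact: ltr01.
Unshelve. all: by end_near. Qed.

(** Concavity puts [f] above a positive multiple of [s * (1 - s)]. *)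
Lemma int01_concave_gt0 (f : R -> R) : bmeas f -> concave01 f ->
  (forall s, 0 <= s <= 1 -> 0 <= f s) -> 0 < f 2^-1 -> 0 < int01 f.
Proof.
move=> bf cf f0 fh; have h01 : 0 <= (2^-1 : R) <= 1 by lra.
have lower s : 0 <= s <= 1 -> 2 * f 2^-1 * (s * (1 - s)) <= f s.
  move=> s01; have [sh|sh] := leP s 2^-1.
    have l01 : 0 <= 2 * s <= 1 by lra.
    have z01 : 0 <= (0 : R) <= 1 by lra.
    have := cf _ _ _ h01 z01 l01.
    have -> : 2 * s * 2^-1 + (1 - 2 * s) * 0 = s by field.
    have f00 : 0 <= (1 - 2 * s) * f 0 by rewrite mulr_ge0 ?f0//; lra.
    have : 0 <= s * s * f 2^-1 by rewrite !mulr_ge0//; lra.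
    by lra.
  have l01 : 0 <= 2 * (1 - s) <= 1 by lra.
  have z01 : 0 <= (1 : R) <= 1 by lra.
  have := cf _ _ _ h01 z01 l01.
  have -> : 2 * (1 - s) * 2^-1 + (1 - 2 * (1 - s)) * 1 = s by field.
  have f00 : 0 <= (1 - 2 * (1 - s)) * f 1 by rewrite mulr_ge0 ?f0//; lra.
  have : 0 <= (1 - s) * (1 - s) * f 2^-1 by rewrite !mulr_ge0//; lra.
  by lra.
apply: (@lt_le_trans _ _ (int01 (fun s => 2 * f 2^-1 * (s * (1 - s))))).
  rewrite (@integ_cubic _ 0 1 0 (2 * f 2^-1) (- 2 * f 2^-1) 0)//.
    by lra.
  by move=> x _; ring.
apply: le_integ => //; apply: bmeasM; first exact: bmeas_cst.
apply: bmeasM; first exact: bmeas_id.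
by apply: bmeasB; [exact: bmeas_cst|exact: bmeas_id].
Qed.

(** The distribution function [F] of the projection is the normalized primitive of
    the section length [T - B]. The bound comes from
    [F * (1 - F) = (1 - s) ^+ 2 * F + s ^+ 2 * (1 - F) - (F - s) ^+ 2], where the last
    square is dropped so that the integrand becomes linear in [F]. *)
Lemma gini_area_projection_le (K : set (R * R)) (hK : convex_body K)
    (u : R * R) (x0 L : R) (T B : R -> R) :
  u.1 ^+ 2 + u.2 ^+ 2 = 1 -> 0 < L -> continuous T -> continuous B ->
  concave01 T -> concave01 (fun s => - B s) ->
  (forall s y, K (chart u x0 L (s, y)) <-> 0 <= s <= 1 /\ B s <= y <= T s) ->
  (forall s, 0 < s < 1 -> B s < T s) ->
  (gini_mean_difference (area_projection hK u) <=
   (2 * L * (int01 (fun t => (T t - B t) * (((1 - t) ^+ 3 + t ^+ 3) / 3)) /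
             int01 (fun t => T t - B t)%R))%:E)%E.
Proof.
move=> u1 L0 cT cB ccT ccB KE BT.
set f := fun t => T t - B t.
have cf : continuous f by move=> x; apply: cvgB; [exact: cT|exact: cB].
have bf := continuous_bmeas cf.
have f0 : forall s, 0 <= s <= 1 -> 0 <= f s.
  by apply: continuous_ge0_on_closure => // s /BT; rewrite subr_gt0.
have ccf : concave01 f.
  move=> x y l x01 y01 l01; have := ccT x y l x01 y01 l01.
  by have := ccB x y l x01 y01 l01; rewrite /f; lra.
set A := int01 f.
have A0 : 0 < A.
  apply: int01_concave_gt0 => //; rewrite subr_gt0; apply: BT.
  by apply/andP; split; lra.
have [c c0 areaE] := area_chart x0 L0 u1.
have mK := measurable_convex_body hK.
(* for [t < 0] the interval is empty and the integral vanishes *)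
pose Phi t := integ 0 (Order.min t 1) f.
have integ_cut a b : 0 <= a -> b <= 1 ->
    (\int[mu]_(s in `[a, b]) (f s)%:E = (integ a b f)%:E)%E.
  move=> a0 b1; rewrite /integ /Rintegral fineK//.
  exact: integrable_fin_num (bmeas_integrable a0 b1 bf).
have area_cut t : area (K `&` [set z | `]-oo, (x0 + L * t)%R]%classic (dotp u z)]) =
    (c * Phi t)%:E.
  rewrite areaE; last first.
    apply: measurableI => //.
    have := measurable_dotp u measurableT (measurable_itv `]-oo, (x0 + L * t)%R]).
    by rewrite setTI.
  rewrite EFinM -integ_cut ?ge_min ?lexx ?orbT//; congr (_ * _)%E.
  rewrite [RHS]integral_mkcond; apply: eq_integral => s _; rewrite patchE.
  have inW y : (K `&` [set z | `]-oo, (x0 + L * t)%R]%classic (dotp u z)])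
      (chart u x0 L (s, y)) <-> (0 <= s <= 1 /\ B s <= y <= T s) /\ s <= t.
    split.
      move=> [/KE ?]; rewrite /= in_itv/= dotp_chart//= lerD2l ler_pM2l//.
    move=> [/KE ? st]; split => //=.
    by rewrite in_itv/= dotp_chart//= lerD2l ler_pM2l.
  case: ifPn.
    rewrite inE/= in_itv/= le_min => /andP[s0 /andP[st s1]].
    rewrite (_ : [set y | _] = `[B s, T s]%classic); last first.
      apply/seteqP; split => y /=; rewrite in_itv/=; first by move=> /inW[[]].
      by move=> ?; apply/inW; rewrite s0 s1.
    have := f0 s; rewrite s0 s1 => /(_ isT); rewrite subr_ge0 => BTs.
    rewrite /= lebesgue_measure_itv/= lte_fin; case: ltP => // TBs.
    by congr EFin; rewrite /f; lra.
  rewrite notin_setE/= in_itv/= le_min => /negP sN.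
  rewrite (_ : [set y | _] = set0) ?measure0//.
  apply/seteqP; split => y //= /inW[[/andP[s0 s1] _] st].
  by move: sN; rewrite s0 s1 st.
have PhiA t : 1 <= t -> Phi t = A by move=> t1; rewrite /Phi min_r.
have areaK : area K = (c * A)%:E.
  rewrite -(PhiA 1 (lexx 1)) -area_cut; congr (area _).
  apply/seteqP; split => z; last by case.
  move=> Kz; split => //=; rewrite in_itv/=; move: Kz.
  rewrite -(@unchartK _ u x0 L L0 u1 z); move: (unchart _ _ _ z) => -[s y].
  move=> /KE[/andP[s0 s1] _]; rewrite dotp_chart//= lerD2l.
  by rewrite ler_pM2l.
have cA0 : 0 < c * A by rewrite mulr_gt0.
pose F t := Phi t / A.
have pF t : area_projection hK u `]-oo, (x0 + L * t)%R]%classic = (F t)%:E.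
  rewrite [LHS](projection_normalized mK u (measurable_itv _) cA0 areaK) area_cut.
  rewrite -EFinM; congr EFin; rewrite /F; field.
  by rewrite !gt_eqF.
pose Bd s := A^-1 * ((1 - s) ^+ 2 * (A * F s) + s ^+ 2 * (A - A * F s)).
have bF : bmeas F.
  split; first exact: measurable_cdf L0 pF.
  exists 1 => s _; have /andP[F0 F1] := cdf_bounds pF s.
  by rewrite ger0_norm.
have bBd : bmeas Bd.
  have bAF : bmeas (fun s => A * F s) by apply: bmeasM => //; exact: bmeas_cst.
  apply: bmeasM; first exact: bmeas_cst.
  apply: bmeasD; apply: bmeasM => //; try apply: bmeasX.
  - by apply: bmeasB; [exact: bmeas_cst|exact: bmeas_id].
  - exact: bmeas_id.
  - by apply: bmeasB => //; exact: bmeas_cst.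
have AF s : A * F s = Phi s by rewrite /F; field; rewrite gt_eqF.
apply: le_trans (gini_le L0 pF bBd _ _ _) _.
- move=> s s0; rewrite /F /Phi /integ min_l; last by lra.
  by rewrite set_itv_ge ?Rintegral_set0 ?mul0r// bnd_simp -ltNge.
- by move=> s s1; rewrite /F PhiA ?divff ?gt_eqF// ltW.
- move=> s _; rewrite -subr_ge0.
  have -> : Bd s - F s * (1 - F s) = (F s - s) ^+ 2.
    by rewrite /Bd; field; rewrite gt_eqF.
  exact: sqr_ge0.
rewrite lee_fin ler_pM2l ?mulr_gt0// mulrC -integ_cdf_parts//.
have bG : bmeas (fun s => (1 - s) ^+ 2 * Phi s + s ^+ 2 * (A - Phi s)).
  have := bmeasM (bmeas_cst A) bBd; congr bmeas; apply/funext => s.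
  by rewrite /Bd !AF mulrA divff ?gt_eqF// mul1r.
rewrite (_ : int01 (fun s => _ * integ 0 s f + _) =
    int01 (fun s => (1 - s) ^+ 2 * Phi s + s ^+ 2 * (A - Phi s))).
  rewrite -integZ//; apply: le_integ => // [|s _].
    by apply: bmeasM => //; exact: bmeas_cst.
  by rewrite /Bd !AF.
apply: eq_integ => s /andP[s0 s1].
rewrite /Phi (min_idPl s1) /A (@integ_split _ s 0 1)//; ring.
Qed.

End area_projection_bound.

(** * Concave functions and their variation *)

Section monotone_halves.
Context {R : realType}.
Implicit Types (g h f : R -> R) (m t s x y : R).

(** [g] up to the point [m] and constant afterwards; for concave [g] with
    maximum at [m] this is nondecreasing and still concave. *)
Definition rising g m t := g (Order.min t m).

(** The other half of [g], so that [rising + falling] is [g] plus a constant. *)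
Definition falling g m t := g (Order.max t m).

Definition argmax01 g m := 0 <= m <= 1 /\ forall x, 0 <= x <= 1 -> g x <= g m.

Lemma argmax01_exists g : continuous g -> exists m, argmax01 g m.
Proof.
move=> cg; have [|m m01 mP] := @EVT_max R g 0 1 ler01; first exact: continuous_subspaceT.
by exists m; split => [|x x01]; [move: m01; rewrite in_itv|apply: mP; rewrite in_itv].
Qed.

Lemma argmax01_reflect g m : argmax01 g m -> argmax01 (fun t => g (1 - t)) (1 - m).
Proof.
move=> [m01 mP]; split; first by lra.
by move=> x x01; rewrite subKr; apply: mP; lra.
Qed.

Lemma concave01_reflect g : concave01 g -> concave01 (fun t => g (1 - t)).
Proof.
move=> cg x y l x01 y01 l01.
rewrite (_ : 1 - (l * x + (1 - l) * y) = l * (1 - x) + (1 - l) * (1 - y)); last by ring.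
by apply: cg; lra.
Qed.

Lemma fallingE g m t : falling g m (1 - t) = rising (fun t => g (1 - t)) (1 - m) t.
Proof.
rewrite /falling /rising; congr g; case: leP => ?; case: leP => ?; lra.
Qed.

Lemma rising_nondecr g m : concave01 g -> argmax01 g m -> nondecr01 (rising g m).
Proof.
move=> cg [m01 mP] x y x0 xy y1; rewrite /rising.
have [ym|my] := leP y m; last first.
  by apply: mP; case: (leP x m) => ?; lra.
rewrite min_l; last exact: le_trans xy ym.
have [xm|xm] := eqVneq x m; first by have -> : y = x by lra.
have mx : 0 < m - x by rewrite subr_gt0 lt_neqAle xm (le_trans xy).
pose l := (m - y) / (m - x).
have l01 : 0 <= l <= 1.
  rewrite /l divr_ge0 ?ler_pdivrMr ?mul1r//; lra.
have x01 : 0 <= x <= 1 by lra.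
have := cg x m l x01 m01 l01.
have -> : l * x + (1 - l) * m = y by rewrite /l; field; lra.
apply: le_trans; have gxm := mP x x01.
have : 0 <= (1 - l) * (g m - g x) by rewrite mulr_ge0//; lra.
by move: (g x) (g m) l {l01 gxm} => *; lra.
Qed.

(** Truncation at [m] replaces both points by smaller ones, and then monotonicity of
    the truncated function compensates for the order of truncating and averaging. *)
Lemma rising_concave g m : concave01 g -> argmax01 g m -> concave01 (rising g m).
Proof.
move=> cg mm x y l x01 y01 l01; have [m01 mP] := mm.
set x' := Order.min x m; set y' := Order.min y m.
have x'01 : 0 <= x' <= 1 by rewrite /x'; case: (leP x m) => ?; lra.
have y'01 : 0 <= y' <= 1 by rewrite /y'; case: (leP y m) => ?; lra.
apply: le_trans (cg x' y' l x'01 y'01 l01) _.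
have [x'x x'm y'y y'm] : [/\ x' <= x, x' <= m, y' <= y & y' <= m].
  by rewrite !ge_min !lexx !orbT.
have lx : 0 <= l * (x - x') by rewrite mulr_ge0//; lra.
have ly : 0 <= (1 - l) * (y - y') by rewrite mulr_ge0//; lra.
have lmx : 0 <= l * (m - x') by rewrite mulr_ge0//; lra.
have lmy : 0 <= (1 - l) * (m - y') by rewrite mulr_ge0//; lra.
have lx1 : 0 <= l * (1 - x) by rewrite mulr_ge0//; lra.
have ly1 : 0 <= (1 - l) * (1 - y) by rewrite mulr_ge0//; lra.
have lx0 : 0 <= l * x' by rewrite mulr_ge0//; lra.
have ly0 : 0 <= (1 - l) * y' by rewrite mulr_ge0//; lra.
have zm : l * x' + (1 - l) * y' <= m by lra.
have -> : g (l * x' + (1 - l) * y') = rising g m (l * x' + (1 - l) * y').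
  by rewrite /rising min_l.
by apply: rising_nondecr => //; lra.
Qed.

Lemma continuous_rising g m : continuous g -> continuous (rising g m).
Proof.
move=> cg x; apply: (@continuous_comp _ _ _ (fun t : R => Order.min t m)); last exact: cg.
by apply: (@continuous_min _ _ id (cst m)); [exact: cvg_id|exact: cvg_cst].
Qed.

Lemma continuous_falling g m : continuous g -> continuous (falling g m).
Proof.
move=> cg x; apply: (@continuous_comp _ _ _ (fun t : R => Order.max t m)); last exact: cg.
by apply: (@continuous_max _ _ id (cst m)); [exact: cvg_id|exact: cvg_cst].
Qed.

(** Up to a constant, the total variation of [g] between 0 and [t] when [g]
    increases before [m] and decreases after it. *)
Definition signed_variation g m t := rising g m t - falling g m t.

Lemma rising_falling g m t : rising g m t + falling g m t = g t + g m.
Proof. by rewrite /rising /falling; case: leP => _ //; rewrite addrC. Qed.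

Lemma falling_nonincr g m x y : concave01 g -> argmax01 g m ->
  0 <= x -> x <= y -> y <= 1 -> falling g m y <= falling g m x.
Proof.
move=> cg mm x0 xy y1; rewrite -[x](subKr 1) -[y](subKr 1) !fallingE.
by apply: rising_nondecr; [exact: concave01_reflect|exact: argmax01_reflect|lra..].
Qed.

Lemma dist_le_signed_variation g m x y : concave01 g -> argmax01 g m ->
  0 <= x -> x <= y -> y <= 1 -> `|g y - g x| <= signed_variation g m y - signed_variation g m x.
Proof.
move=> cg mm x0 xy y1; have := rising_nondecr cg mm x0 xy y1.
have := falling_nonincr cg mm x0 xy y1.
have := rising_falling g m x; have := rising_falling g m y.
rewrite /signed_variation ler_norml; lra.
Qed.

(** Between its maximum and an endpoint a concave function is monotone, so there
    its variation is the absolute increment. *)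
Lemma signed_variation_chord g m x y : 0 <= x -> x <= y -> y <= 1 ->
  concave01 g -> argmax01 g m -> ~ (x < m < y) ->
  signed_variation g m y - signed_variation g m x = `|g y - g x|.
Proof.
move=> x0 xy y1 cg mm mN.
have up := rising_nondecr cg mm x0 xy y1.
have dn := falling_nonincr cg mm x0 xy y1.
move: up dn; rewrite /signed_variation /rising /falling.
have [ym|my] := leP y m.
  by rewrite (min_l (le_trans xy ym)) (max_r (le_trans xy ym)) => gxy _; rewrite ger0_norm; lra.
have mx : m <= x by rewrite leNgt; apply/negP => xm; apply: mN; rewrite xm.
by rewrite (min_r mx) (max_l mx) => _ gyx; rewrite ler0_norm; lra.
Qed.

End monotone_halves.

Section profile.
Context {R : realType}.
Local Notation int01 := (integ (0 : R) 1).
Context (g k f : R -> R) (m m' b : R).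
Context (cg : continuous g) (ck : continuous k) (ccg : concave01 g)
  (cck : concave01 k) (mg : argmax01 g m) (mk : argmax01 k m').

Definition variation_sum t := signed_variation g m t + signed_variation k m' t.

(** [g] and [- k] are the values of one linear functional along the upper and the
    lower boundary, so that [b * f] is their gap. The sum of the two rising parts and
    the sum of the two falling parts, divided by the width [g m + k m'], are a pair
    as in [concave_pair_inequality]; their difference is the normalized variation. *)
Lemma profile_inequality : bmeas f -> 0 < b -> 0 < g m + k m' ->
  (forall t, 0 <= t <= 1 -> g t + k t = b * f t) ->
  (forall t, 0 <= t <= 1 -> 0 <= f t) ->
  (forall t, 0 <= t <= 1 -> `|variation_sum t| <= g m + k m') /\
  int01 (fun t => f t * (((1 - t) ^+ 3 + t ^+ 3) / 3)) <=
  int01 f * int01 (fun t =>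
    (1 - (variation_sum t / (g m + k m')) ^+ 2) / 4).
Proof.
move=> bf b0 W0 gkf f0; set W := g m + k m'.
have WN0 : W != 0 by rewrite gt_eqF.
have i0 : 0 <= (0 : R) <= 1 by rewrite lexx ler01.
have i1 : 0 <= (1 : R) <= 1 by rewrite lexx ler01.
pose a t := (rising g m t + rising k m' t) / W.
pose c t := (falling g m t + falling k m' t) / W.
have acE t : 0 <= t <= 1 -> a t + c t - 1 = b / W * f t.
  move=> t01; have := gkf t t01.
  have := rising_falling g m t; have := rising_falling k m' t.
  move=> hk hg ht; rewrite mulrAC -ht /a /c.
  have -> : rising g m t = g t + g m - falling g m t by rewrite -hg addrK.
  have -> : rising k m' t = k t + k m' - falling k m' t by rewrite -hk addrK.
  rewrite /W; field.
  by rewrite -/W.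
have DE t : variation_sum t / W = a t - c t.
  by rewrite /variation_sum /signed_variation /a /c; field.
have a_nd : nondecr01 a.
  move=> x y x0 xy y1; rewrite ler_pM2r ?invr_gt0//.
  by rewrite lerD//; apply: rising_nondecr.
have c_ni x y : 0 <= x -> x <= y -> y <= 1 -> c y <= c x.
  move=> x0 xy y1; rewrite ler_pM2r ?invr_gt0//.
  by rewrite lerD//; apply: falling_nonincr.
have scale_concave (p q : R -> R) : concave01 p -> concave01 q ->
    concave01 (fun t => (p t + q t) / W).
  move=> cp cq x y l x01 y01 l01; rewrite !mulrA -mulrDl ler_pM2r ?invr_gt0//.
  have := cp x y l x01 y01 l01; have := cq x y l x01 y01 l01.
  lra.
have a_cc : concave01 a by apply: scale_concave; exact: rising_concave.
have c_cc : concave01 (fun t => c (1 - t)).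
  have := scale_concave (fun t => falling g m (1 - t)) (fun t => falling k m' (1 - t)).
  by apply; under eq_fun do rewrite fallingE; apply: rising_concave;
    [exact: concave01_reflect|exact: argmax01_reflect
    |exact: concave01_reflect|exact: argmax01_reflect].
have c_nd : nondecr01 (fun t => c (1 - t)).
  by move=> x y x0 xy y1; apply: c_ni; lra.
have cgm := mg; have [mg01 _] := cgm; have ckm := mk; have [mk01 _] := ckm.
have a1 : a 1 = 1.
  by rewrite /a /rising !min_r; [rewrite -/W divff| lra..].
have c0 : c 0 = 1.
  by rewrite /c /falling !max_r; [rewrite -/W divff| lra..].
have bW : 0 < b / W by rewrite divr_gt0.
have a0 : 0 <= a 0.
  by have := acE 0 i0; rewrite c0 addrK => ->; rewrite mulr_ge0 ?f0// ltW.
have c1 : 0 <= c 1.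
  have := acE 1 i1; rewrite a1 addrC addKr => ->.
  by rewrite mulr_ge0 ?f0// ltW.
have ba : bmeas a.
  apply: continuous_bmeas => x; apply: cvgM; last exact: cvg_cst.
  by apply: cvgD; apply: continuous_rising.
have bc : bmeas c.
  apply: continuous_bmeas => x; apply: cvgM; last exact: cvg_cst.
  by apply: cvgD; apply: continuous_falling.
split.
  move=> t t01; have t0 : 0 <= t by lra.
  have t1 : t <= 1 by lra.
  have := a_nd t 1 t0 t1 (lexx 1); have := c_ni 0 t (lexx 0) t0 t1.
  rewrite a1 c0 => ct at_.
  have act : 0 <= b / W * f t by rewrite mulr_ge0 ?f0// ltW.
  move: act; rewrite -acE// => act.
  have <- : (a t - c t) * W = variation_sum t by rewrite -DE mulfVK.
  rewrite normrM [`|W|]gtr0_norm// ger_pMl// ler_norml; lra.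
have := concave_pair_inequality ba bc a_cc a_nd a1 a0 c_cc c_nd c0 c1.
rewrite (eq_integ (g := fun t => b / W * (f t * (((1 - t) ^+ 3 + t ^+ 3) / 3)))); last first.
  by move=> t t01; rewrite acE// mulrA.
rewrite (eq_integ (f := fun t => a t + c t - 1) (g := fun t => b / W * f t)); last first.
  by move=> t t01; rewrite acE.
have bq : bmeas (fun t : R => ((1 - t) ^+ 3 + t ^+ 3) / 3).
  apply: bmeasM; last exact: bmeas_cst.
  apply: bmeasD; apply: bmeasX; last exact: bmeas_id.
  by apply: bmeasB; [exact: bmeas_cst|exact: bmeas_id].
rewrite !integZ//; last exact: bmeasM.
rewrite -[X in _ <= X]mulrA ler_pM2l// => /le_trans; apply.
rewrite (eq_integ (f := fun t => (1 - (a t - c t) ^+ 2) / 4) (g := fun t =>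
  (1 - (variation_sum t / W) ^+ 2) / 4))//.
by move=> t _; rewrite DE.
Qed.

End profile.

(** * Lengths of arcs *)

Section arcs.
Context {R : realType} (u : R * R) (x0 L : R).
Context (L0 : 0 < L) (u1 : u.1 ^+ 2 + u.2 ^+ 2 = 1).
Local Notation ch := (chart u x0 L).
Local Notation unch := (unchart u x0 L).

Lemma cauchy_schwarz2 (a b x y : R) : a ^+ 2 + b ^+ 2 <= 1 ->
  `|a * x + b * y| <= Num.sqrt (x ^+ 2 + y ^+ 2).
Proof.
move=> ab; rewrite -sqrtr_sqr ler_wsqrtr//.
have : 0 <= (a * y - b * x) ^+ 2 by exact: sqr_ge0.
have xy0 : 0 <= x ^+ 2 + y ^+ 2 by rewrite addr_ge0 ?sqr_ge0.
have : (a ^+ 2 + b ^+ 2) * (x ^+ 2 + y ^+ 2) <= 1 * (x ^+ 2 + y ^+ 2).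
  by rewrite ler_wpM2r.
lra.
Qed.

Lemma chart_functional_lip (a b : R) (z w : R * R) : a ^+ 2 + b ^+ 2 <= 1 ->
  `|L * (a * (unch z).1 + b * (unch z).2) -
    L * (a * (unch w).1 + b * (unch w).2)| <= eucl_dist z w.
Proof.
move=> ab; have -> : eucl_dist z w = eucl_dist (ch (unch z)) (ch (unch w)) by rewrite !unchartK.
rewrite eucl_dist_chart// -mulrBr normrM gtr0_norm// ler_pM2l//.
apply: le_trans (cauchy_schwarz2 _ _ ab); rewrite le_eqVlt; apply/orP; left.
by apply/eqP; congr `|_|; ring.
Qed.

(** Project on the direction of the chord: by the intermediate value theorem the
    image of the path contains the whole open segment. *)
Lemma hausdorff1_path_ge (P1 P2 : R -> R) (s t : R) :
  continuous P1 -> continuous P2 -> s <= t ->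
  ((L * Num.sqrt ((P1 t - P1 s) ^+ 2 + (P2 t - P2 s) ^+ 2))%:E <=
   hausdorff1 ((fun r => ch (P1 r, P2 r)) @` `]s, t[%classic))%E.
Proof.
move=> c1 c2 st; set D := Num.sqrt _.
have [->|D0] := eqVneq D 0; first by rewrite mulr0 hausdorff1_ge0.
have DD : D ^+ 2 = (P1 t - P1 s) ^+ 2 + (P2 t - P2 s) ^+ 2.
  by rewrite sqr_sqrtr// addr_ge0 ?sqr_ge0.
pose a := (P1 t - P1 s) / D; pose b := (P2 t - P2 s) / D.
have ab : a ^+ 2 + b ^+ 2 <= 1.
  by rewrite /a /b !expr_div_n -mulrDl -DD divff// expf_neq0.
pose phi r := a * P1 r + b * P2 r.
have phiD : phi t - phi s = D.
  have -> : phi t - phi s = ((P1 t - P1 s) ^+ 2 + (P2 t - P2 s) ^+ 2) / D.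
    by rewrite /phi /a /b; ring.
  by rewrite -DD expr2 mulfK.
have cphi : continuous phi.
  by move=> r; apply: cvgD; apply: cvgM; by [exact: cvg_cst|exact: c1|exact: c2].
rewrite -phiD mulrBr; apply: (@hausdorff1_ge_image _ _
  (fun z => L * (a * (unch z).1 + b * (unch z).2))) => [x y|v].
  exact: chart_functional_lip.
rewrite /= in_itv/= => /andP[sv vt].
have [||r] := @IVT R phi s t (v / L) st; first exact: continuous_subspaceT.
  rewrite min_l; last by rewrite -subr_ge0 phiD sqrtr_ge0.
  rewrite max_r; last by rewrite -subr_ge0 phiD sqrtr_ge0.
  by rewrite ler_pdivlMr// ler_pdivrMr// ![_ * L]mulrC !ltW.
rewrite in_itv/= => /andP[sr rt] phir; exists (ch (P1 r, P2 r)).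
  exists r => //; rewrite /= in_itv/= !lt_neqAle sr rt !andbT; apply/andP; split.
    by apply: contraTneq sv => ->; rewrite phir mulrC divfK ?gt_eqF// ltxx.
  by apply: contraTneq vt => <-; rewrite phir mulrC divfK ?gt_eqF// ltxx.
rewrite -[LHS]/(L * (a * (unch (ch (P1 r, P2 r))).1 + b * (unch (ch (P1 r, P2 r))).2)).
by rewrite chartK//= -/(phi r) phir mulrC divfK ?gt_eqF.
Qed.

(** The set [M] cuts the union into [X] and [Y], and [hausdorff1] is additive
    along it. *)
Lemma hausdorff1_separate (M X Y : set (R * R)) :
  hausdorff1.-caratheodory M -> X `<=` M -> Y `<=` ~` M ->
  (hausdorff1 X + hausdorff1 Y <= hausdorff1 (X `|` Y))%E.
Proof.
move=> mM XM YM; rewrite (mM (X `|` Y)); apply: leeD; apply: le_hausdorff1 => z Z.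
  by split; [left|exact: XM].
by split; [right|exact: YM].
Qed.

Definition graph_arc (T : R -> R) s t := (fun r => ch (r, T r)) @` `]s, t[%classic.

Lemma arc_split (T : R -> R) s r t : s < r < t ->
  (hausdorff1 (graph_arc T s r) + hausdorff1 (graph_arc T r t) <= hausdorff1 (graph_arc T s t))%E.
Proof.
move=> /andP[sr rt].
have ab : (1 : R) ^+ 2 + 0 ^+ 2 <= 1 by rewrite expr1n expr0n addr0.
have := caratheodory_half_plane (fun z w => chart_functional_lip z w ab) (L * r).
set M := [set z | _] => mM.
have ME v : M (ch (v, T v)) <-> r < v.
  rewrite -[X in X <-> _]/(is_true (L * r < L * (1 * (unch (ch (v, T v))).1 +
    0 * (unch (ch (v, T v))).2))).
  by rewrite chartK//= mul1r mul0r addr0 ltr_pM2l.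
rewrite addeC; apply: le_trans (hausdorff1_separate mM _ _) _.
- by move=> _ [v /= + <-]; rewrite in_itv/= => /andP[rv _]; exact/ME.
- move=> _ [v /= + <-]; rewrite in_itv/= => /andP[_ vr] /ME.
  by apply/negP; rewrite -leNgt ltW.
apply: le_hausdorff1 => _ [] [v /= + <-]; rewrite in_itv/= => /andP[v1 v2];
  exists v => //; rewrite /= in_itv/=.
  by rewrite v2 (lt_trans sr).
by rewrite v1 (lt_trans v2).
Qed.

(** Cut the arc at the maxima of the functionals. On each piece all the functionals
    are monotone, so the sum of their variations is the sum of the absolute
    values at the chord, which is at most the length of the chord. The induction
    runs on a list containing the cutting points inside the interval. *)
Lemma arc_length_ge (T : R -> R) n (alpha beta m : 'I_n -> R) (s t : R) :
  continuous T ->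
  (forall x y, \sum_j `|alpha j * x + beta j * y| <= Num.sqrt (x ^+ 2 + y ^+ 2)) ->
  (forall j, concave01 (fun r => alpha j * r + beta j * T r)) ->
  (forall j, argmax01 (fun r => alpha j * r + beta j * T r) (m j)) ->
  0 <= s -> s <= t -> t <= 1 ->
  ((L * \sum_j (signed_variation (fun r => alpha j * r + beta j * T r) (m j) t -
                signed_variation (fun r => alpha j * r + beta j * T r) (m j) s))%R%:E <=
   hausdorff1 (graph_arc T s t))%E.
Proof.
move=> cT crofton cg mg s0 st t1.
pose g j r := alpha j * r + beta j * T r.
rewrite -/(g _).
have : forall j, s < m j < t -> m j \in [seq m j | j <- enum 'I_n].
  by move=> j _; apply: map_f; rewrite mem_enum.
move: [seq _ | _ <- _] => l; elim: l s t s0 st t1 => [|x l IHl] s t s0 st t1 ml.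
  apply: le_trans (hausdorff1_path_ge _ cT st); last by move=> r; exact: cvg_id.
  rewrite lee_fin ler_pM2l//; apply: le_trans (crofton (t - s) (T t - T s)).
  apply: ler_sum => j _.
  rewrite signed_variation_chord//; last by move/ml.
  rewrite le_eqVlt; apply/orP; left; apply/eqP; congr `|_|; ring.
have [/andP[sx xt]|xN] := boolP (s < x < t); last first.
  apply: IHl => // j smt; have := ml j smt; rewrite inE => /predU1P[mx|//].
  by move: xN; rewrite -mx smt.
have x_itv : 0 <= x /\ x <= 1 by split; lra.
apply: (le_trans _ (@arc_split T s x t _)); last by rewrite sx xt.
have ml1 j : s < m j < x -> m j \in l.
  move=> /andP[sm mx]; have : m j \in x :: l by apply: ml; rewrite sm (lt_trans mx).
  by rewrite inE (lt_eqF mx).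
have ml2 j : x < m j < t -> m j \in l.
  move=> /andP[xm mt]; have : m j \in x :: l by apply: ml; rewrite mt (lt_trans sx).
  by rewrite inE (gt_eqF xm).
have [x_ge0 x_le1] := x_itv.
have H1 := IHl s x s0 (ltW sx) x_le1 ml1.
have H2 := IHl x t x_ge0 (ltW xt) t1 ml2.
apply: le_trans (leeD H1 H2).
rewrite -EFinD lee_fin -mulrDr -big_split/= ler_pM2l//.
by apply: ler_sum => j _; rewrite addrC addrA subrK.
Qed.

(** The sum of the variations, scaled, is a monotone parameter whose increments
    dominate Euclidean distances along the graph. *)
Lemma graph_length_le (T : R -> R) n (alpha beta m : 'I_n -> R) (k : R) :
  0 < k ->
  (forall x y, k * Num.sqrt (x ^+ 2 + y ^+ 2) <= \sum_j `|alpha j * x + beta j * y|) ->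
  (forall j, concave01 (fun r => alpha j * r + beta j * T r)) ->
  (forall j, argmax01 (fun r => alpha j * r + beta j * T r) (m j)) ->
  (hausdorff1 ((fun r => ch (r, T r)) @` `[0%R, 1%R]%classic) <=
   (L / k * \sum_j (signed_variation (fun r => alpha j * r + beta j * T r) (m j) 1 -
                signed_variation (fun r => alpha j * r + beta j * T r) (m j) 0))%R%:E)%E.
Proof.
move=> k0 crofton cg mg.
pose g j r := alpha j * r + beta j * T r.
pose V r := L / k * \sum_j signed_variation (g j) (m j) r.
have VB x y : L / k * \sum_j (signed_variation (g j) (m j) y -
    signed_variation (g j) (m j) x) = V y - V x.
  by rewrite /V -mulrBr sumrB.
rewrite VB; have Lk : 0 < L / k by rewrite divr_gt0.
have gV x y : 0 <= x -> x <= y -> y <= 1 ->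
    L * Num.sqrt ((y - x) ^+ 2 + (T y - T x) ^+ 2) <= V y - V x.
  move=> x0' xy y1; rewrite -VB.
  have -> : L * Num.sqrt ((y - x) ^+ 2 + (T y - T x) ^+ 2) =
      L / k * (k * Num.sqrt ((y - x) ^+ 2 + (T y - T x) ^+ 2)).
    by rewrite mulrA divfK ?gt_eqF.
  rewrite ler_pM2l//; apply: le_trans (crofton _ _) _.
  apply: ler_sum => j _; apply: le_trans (dist_le_signed_variation (cg j) (mg j) x0' xy y1).
  by rewrite le_eqVlt; apply/orP; left; apply/eqP; congr `|_|; rewrite /g; ring.
have Vmono x y : 0 <= x -> x <= y -> y <= 1 -> V x <= V y.
  move=> x0' xy y1; rewrite -subr_ge0; apply: le_trans (gV x y x0' xy y1).
  by rewrite mulr_ge0 ?sqrtr_ge0 ?ltW.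
apply: (@hausdorff1_le_param _ _ (fun z => V (unch z).1) (V 0)).
- by rewrite subr_ge0 Vmono.
- move=> _ _ [x xI <-] [y yI <-]; rewrite !chartK// eucl_dist_chart//.
  move: xI yI; rewrite /= !in_itv/= => /andP[x0' x1] /andP[y0 y1].
  have [xy|/ltW yx] := leP x y.
    rewrite [X in _ <= X]distrC; apply: le_trans (ler_norm _).
    apply: le_trans (gV x y x0' xy y1); rewrite ler_pM2l// ler_wsqrtr//.
    by rewrite le_eqVlt; apply/orP; left; apply/eqP; ring.
  by apply: le_trans (ler_norm _); exact: gV.
- move=> _ [x xI <-]; rewrite chartK// addrC subrK; move: xI.
  by rewrite /= in_itv/= => /andP[x0' x1]; rewrite !Vmono.
Qed.

Lemma side_length_le (c y0 y1 : R) : y0 <= y1 ->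
  (hausdorff1 ((fun y => ch (c, y)) @` `[y0, y1]%classic) <= (L * (y1 - y0))%:E)%E.
Proof.
move=> y01; apply: (@hausdorff1_le_param _ _ (fun z => L * (unch z).2) (L * y0)).
- by rewrite mulr_ge0 ?subr_ge0// ltW.
- move=> _ _ [x _ <-] [y _ <-].
  rewrite !chartK// eucl_dist_chart//= subrr expr0n add0r sqrtr_sqr.
  by rewrite -mulrBr normrM [`|L|]gtr0_norm.
- move=> _ [x xI <-]; rewrite chartK//; move: xI; rewrite /= in_itv/= => /andP[yx xy].
  by rewrite -mulrDr addrC subrK !ler_pM2l// yx.
Qed.

End arcs.

(** * The boundary of a convex body *)

Section boundary.
Context {R : realType} (K : set (R * R)) (u : R * R) (x0 L : R) (T B : R -> R).
Context (hK : convex_body K) (L0 : 0 < L) (u1 : u.1 ^+ 2 + u.2 ^+ 2 = 1).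
Context (cT : continuous T) (cB : continuous B).
Context (KE : forall s y, K (chart u x0 L (s, y)) <->
  0 <= s <= 1 /\ B s <= y <= T s).
Context (BT : forall s, 0 < s < 1 -> B s < T s).
Local Notation ch := (chart u x0 L).
Local Notation unch := (unchart u x0 L).

Let BT01 s : 0 <= s <= 1 -> B s <= T s.
Proof.
move=> s01; rewrite -subr_ge0; apply: (@continuous_ge0_on_closure _ (fun s => T s - B s)) => //.
  by move=> x; apply: cvgB; [exact: cT|exact: cB].
by move=> x /BT; rewrite subr_gt0.
Qed.

Let frontier_mem (P : R -> R * R) r0 : continuous P -> K (P r0) ->
  (forall d, 0 < d -> exists2 r, `|r0 - r| < d & ~ K (P r)) -> frontier K (P r0).
Proof.
move=> cP KP out; split; first exact: subset_closure.
move=> /(cP r0) /nbhs_ballP[d /= d0 dK].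
have [r rd Kr] := out d d0; apply: Kr; exact: dK rd.
Qed.

Let continuous_vertical s : continuous (fun y : R => ch (s, y)).
Proof.
move=> y; apply: (@continuous_comp _ _ _ (fun y : R => ((fun=> s) y, id y)));
  last exact: continuous_chart.
by apply: (@continuous_pair _ _ (fun=> s) id) => x; [exact: cvg_cst|exact: cvg_id].
Qed.

Let continuous_horizontal y : continuous (fun s : R => ch (s, y)).
Proof.
move=> s; apply: (@continuous_comp _ _ _ (fun s : R => (id s, (fun=> y) s)));
  last exact: continuous_chart.
by apply: (@continuous_pair _ _ id (fun=> y)) => x; [exact: cvg_id|exact: cvg_cst].
Qed.

Let half_lt (d : R) : 0 < d -> 0 < d / 2 < d.
Proof. lra. Qed.

Lemma frontier_top s : 0 <= s <= 1 -> frontier K (ch (s, T s)).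
Proof.
move=> s01; apply: (@frontier_mem (fun y => ch (s, y)) (T s)) => //.
  by apply/KE; split => //; rewrite lexx BT01.
move=> d /half_lt/andP[d0 dd]; exists (T s + d / 2).
  by rewrite opprD addNKr normrN gtr0_norm.
by move=> /KE[_ /andP[_]]; rewrite gerDl leNgt d0.
Qed.

Lemma frontier_bottom s : 0 <= s <= 1 -> frontier K (ch (s, B s)).
Proof.
move=> s01; apply: (@frontier_mem (fun y => ch (s, y)) (B s)) => //.
  by apply/KE; split => //; rewrite lexx BT01.
move=> d /half_lt/andP[d0 dd]; exists (B s - d / 2).
  by rewrite opprB addrC subrK gtr0_norm.
by move=> /KE[_ /andP[+ _]]; rewrite lerDl oppr_ge0 leNgt d0.
Qed.

Lemma frontier_left y : B 0 <= y <= T 0 -> frontier K (ch (0, y)).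
Proof.
move=> yBT; apply: (@frontier_mem (fun s => ch (s, y)) 0) => //.
  by apply/KE; split => //; rewrite lexx ler01.
move=> d /half_lt/andP[d0 dd]; exists (- (d / 2)).
  by rewrite opprK add0r gtr0_norm.
by move=> /KE[/andP[+ _] _]; rewrite oppr_ge0 leNgt d0.
Qed.

Lemma frontier_right y : B 1 <= y <= T 1 -> frontier K (ch (1, y)).
Proof.
move=> yBT; apply: (@frontier_mem (fun s => ch (s, y)) 1) => //.
  by apply/KE; split => //; rewrite lexx ler01.
move=> d /half_lt/andP[d0 dd]; exists (1 + d / 2).
  by rewrite opprD addNKr normrN gtr0_norm.
by move=> /KE[/andP[_ +] _]; rewrite gerDl leNgt d0.
Qed.

Definition side s := (fun y => ch (s, y)) @` `]B s, T s[%classic.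

(** A point of [K] strictly between the two graphs and the two vertical lines is
    interior, because all four strict inequalities persist nearby. *)
Lemma frontier_sub : frontier K `<=`
  ((fun r => ch (r, T r)) @` `[0, 1]%classic `|`
   (fun r => ch (r, B r)) @` `[0, 1]%classic) `|`
  ((fun y => ch (0, y)) @` `[B 0, T 0]%classic `|`
   (fun y => ch (1, y)) @` `[B 1, T 1]%classic).
Proof.
move=> z [Kz zK].
have Kz' : K z.
  have [cK _ _] := hK; have /closure_id KE' : closed K by exact: compact_closed.
  by rewrite KE'.
move: Kz'; rewrite -[z](@unchartK _ u x0 L L0 u1).
case zE : (unch z) => [s y] /KE[/andP[s0 s1] /andP[By yT]].
have [sE|sN0] := eqVneq s 0.
  by right; left; exists y; rewrite ?sE//= in_itv/= -sE By.
have [sE|sN1] := eqVneq s 1.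
  by right; right; exists y; rewrite ?sE//= in_itv/= -sE By.
have [yE|yNT] := eqVneq y (T s).
  by left; left; exists s; rewrite ?yE//= in_itv/= s0.
have [yE|yNB] := eqVneq y (B s).
  by left; right; exists s; rewrite ?yE//= in_itv/= s0.
exfalso; apply: zK.
have c1 : {for z, continuous (fun w => (unch w).1)}.
  by apply: (@continuous_comp _ _ _ unch fst); [exact: continuous_unchart|exact: cvg_fst].
have c2 : {for z, continuous (fun w => (unch w).2)}.
  by apply: (@continuous_comp _ _ _ unch snd); [exact: continuous_unchart|exact: cvg_snd].
have s_gt0 : 0 < (unch z).1 by rewrite zE/= lt_neqAle eq_sym sN0.
have s_lt1 : (unch z).1 < 1 by rewrite zE/= lt_neqAle sN1.
have gapT : 0 < T (unch z).1 - (unch z).2 by rewrite zE/= subr_gt0 lt_neqAle yNT.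
have gapB : 0 < (unch z).2 - B (unch z).1 by rewrite zE/= subr_gt0 lt_neqAle eq_sym yNB.
have cgT : {for z, continuous (fun w => T (unch w).1 - (unch w).2)}.
  by apply: cvgB; [apply: (continuous_comp c1); exact: cT|exact: c2].
have cgB : {for z, continuous (fun w => (unch w).2 - B (unch w).1)}.
  by apply: cvgB; [exact: c2|apply: (continuous_comp c1); exact: cB].
rewrite /interior/=; near=> w.
rewrite -[w](@unchartK _ u x0 L L0 u1); case wE : (unch w) => [s' y'].
apply/KE; have -> : s' = (unch w).1 by rewrite wE.
have -> : y' = (unch w).2 by rewrite wE.
split; apply/andP; split.
- by apply: ltW; near: w; exact: cvgr_gt c1 _ s_gt0.
- by apply: ltW; near: w; exact: cvgr_lt c1 _ s_lt1.
- by rewrite -subr_ge0; apply: ltW; near: w; exact: cvgr_gt cgB _ gapB.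
- by rewrite -subr_ge0; apply: ltW; near: w; exact: cvgr_gt cgT _ gapT.
Unshelve. all: by end_near. Qed.

Local Notation graph_arc := (graph_arc u x0 L).

Let upper_set_caratheodory :
  hausdorff1.-caratheodory [set z | T (unch z).1 <= (unch z).2].
Proof.
apply: borel_caratheodory; apply: closed_measurable_plane.
rewrite (_ : [set z | _] = (fun z => (unch z).2 - T (unch z).1) @^-1` [set x | 0 <= x]).
  apply: preimage_closed; last exact: closed_ge.
  move=> z _; apply: cvgB.
    by apply: (@continuous_comp _ _ _ unch snd); [exact: continuous_unchart|exact: cvg_snd].
  apply: (@continuous_comp _ _ _ (fun w => (unch w).1) T); last exact: cT.
  by apply: (@continuous_comp _ _ _ unch fst); [exact: continuous_unchart|exact: cvg_fst].
by apply/seteqP; split => z /=; rewrite subr_ge0.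
Qed.

(** The closed set above the graph of [T] contains the upper arc and misses the
    lower one. *)
Lemma two_arcs s t : 0 <= s -> t <= 1 ->
  (hausdorff1 (graph_arc T s t) + hausdorff1 (graph_arc B s t) <=
   hausdorff1 (graph_arc T s t `|` graph_arc B s t))%E.
Proof.
move=> s0 t1; apply: (hausdorff1_separate upper_set_caratheodory).
  by move=> _ [r _ <-]; rewrite /mkset chartK.
move=> _ [r rI <-]; rewrite /setC /mkset chartK//=; move: rI.
rewrite /= in_itv/= => /andP[sr rt]; apply/negP; rewrite -ltNge BT//.
by rewrite (le_lt_trans s0)// (lt_le_trans rt).
Qed.

Let half_plane (a b : R) : a ^+ 2 <= 1 ->
  hausdorff1.-caratheodory [set z | L * b < L * (a * (unch z).1 + 0 * (unch z).2)].
Proof.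
move=> a1; have ab : a ^+ 2 + 0 ^+ 2 <= 1 by rewrite expr0n addr0.
exact: caratheodory_half_plane (fun z w => chart_functional_lip x0 L0 u1 z w ab) (L * b).
Qed.

Lemma left_side_arcs t : (hausdorff1 (graph_arc T 0%R t `|` graph_arc B 0%R t) + hausdorff1 (side 0%R) <=
  hausdorff1 ((graph_arc T 0%R t `|` graph_arc B 0%R t) `|` side 0%R))%E.
Proof.
have a1 : (1 : R) ^+ 2 <= 1 by rewrite expr1n.
apply: (hausdorff1_separate (half_plane 0 a1)).
  by move=> _ [] [r rI <-]; rewrite /mkset chartK// ltr_pM2l// mul1r mul0r addr0;
    move: rI; rewrite /= in_itv/= => /andP[].
by move=> _ [y _ <-]; rewrite /setC /mkset chartK// ltr_pM2l// mul1r mul0r addr0 ltxx.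
Qed.

Lemma right_side_arcs t : (hausdorff1 (graph_arc T t 1%R `|` graph_arc B t 1%R) + hausdorff1 (side 1%R) <=
  hausdorff1 ((graph_arc T t 1%R `|` graph_arc B t 1%R) `|` side 1%R))%E.
Proof.
have a1 : (-1 : R) ^+ 2 <= 1 by rewrite sqrrN expr1n.
apply: (hausdorff1_separate (half_plane (-1) a1)).
  by move=> _ [] [r rI <-]; rewrite /mkset chartK// ltr_pM2l// mulN1r mul0r addr0 ltrN2;
    move: rI; rewrite /= in_itv/= => /andP[].
by move=> _ [y _ <-]; rewrite /setC /mkset chartK// ltr_pM2l// mulN1r mul0r addr0 ltxx.
Qed.

Lemma side_length_ge s : 0 <= s <= 1 -> ((L * (T s - B s))%:E <= hausdorff1 (side s))%E.
Proof.
move=> s01; have := hausdorff1_path_ge x0 L0 u1 (P1 := fun=> s) (P2 := id) _ _ (BT01 s01).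
rewrite subrr expr0n add0r sqrtr_sqr ger0_norm ?subr_ge0 ?BT01//; apply.
  by move=> x; exact: cvg_cst.
by move=> x; exact: cvg_id.
Qed.

Lemma length_left_ge t : 0 < t < 1 ->
  (hausdorff1 (graph_arc T 0%R t) + hausdorff1 (graph_arc B 0%R t) + hausdorff1 (side 0%R) <=
   hausdorff1 (frontier K `&` [set z | (dotp u z <= x0 + L * t)%R]))%E.
Proof.
move=> /andP[t0 t1]; apply: le_trans (leeD (two_arcs (lexx _) (ltW t1)) (lexx _)) _.
apply: le_trans (left_side_arcs t) _; apply: le_hausdorff1 => z.
have dle r y : 0 <= r <= t -> dotp u (ch (r, y)) <= x0 + L * t.
  by rewrite dotp_chart//= => /andP[_ rt]; rewrite lerD2l ler_pM2l.
move=> [[]|] [r rI <-]; move: rI; rewrite /= in_itv/= => /andP[r0 rt].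
- by split; [apply: frontier_top; lra|apply: dle; lra].
- by split; [apply: frontier_bottom; lra|apply: dle; lra].
- by split; [apply: frontier_left; lra|apply: dle; lra].
Qed.

Lemma length_right_ge t : 0 < t < 1 ->
  (hausdorff1 (graph_arc T t 1%R) + hausdorff1 (graph_arc B t 1%R) + hausdorff1 (side 1%R) <=
   hausdorff1 (frontier K `&` [set z | (x0 + L * t < dotp u z)%R]))%E.
Proof.
move=> /andP[t0 t1]; apply: le_trans (leeD (two_arcs (ltW t0) (lexx _)) (lexx _)) _.
apply: le_trans (right_side_arcs t) _; apply: le_hausdorff1 => z.
have dlt r y : t < r -> x0 + L * t < dotp u (ch (r, y)).
  by rewrite dotp_chart//= => tr; rewrite ltrD2l ltr_pM2l.
move=> [[]|] [r rI <-]; move: rI; rewrite /= in_itv/= => /andP[r0 rt].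
- by split; [apply: frontier_top; lra|exact: dlt].
- by split; [apply: frontier_bottom; lra|exact: dlt].
- by split; [apply: frontier_right; lra|exact: dlt].
Qed.

End boundary.

(** * The boundary length seen by finitely many functionals *)

Section directions.
Context {R : realType}.
Local Notation int01 := (integ (0 : R) 1).

(** For each functional of the discrete Crofton formula, [W j] is half of its
    variation along the whole boundary, and [W j + D j t], [W j - D j t] are its
    variations along the parts to the left and to the right of [t]. Left
    and right vertical sides enter through the boundary values of the gap
    between the two graphs. *)
Lemma boundary_directions (K : set (R * R)) (u : R * R) (x0 L : R)
    (T B : R -> R) (k : R) :
  convex_body K -> 0 < L -> u.1 ^+ 2 + u.2 ^+ 2 = 1 ->
  continuous T -> continuous B -> concave01 T -> concave01 (fun s => - B s) ->
  (forall s y, K (chart u x0 L (s, y)) <-> 0 <= s <= 1 /\ B s <= y <= T s) ->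
  (forall s, 0 < s < 1 -> B s < T s) -> 0 < k < 1 ->
  exists n (W : 'I_n -> R) (D : 'I_n -> R -> R),
  [/\ 0 < \sum_j W j,
      forall j, [/\ 0 < W j, bmeas (D j),
        forall t, 0 <= t <= 1 -> `|D j t| <= W j &
        int01 (fun t => (T t - B t) * (((1 - t) ^+ 3 + t ^+ 3) / 3)) <=
        int01 (fun t => T t - B t) * int01 (fun t => (1 - (D j t / W j) ^+ 2) / 4)],
      (hausdorff1 (frontier K) <= (L / k * \sum_j (2 * W j))%R%:E)%E &
      forall t, 0 < t < 1 ->
        ((L * \sum_j (W j + D j t))%R%:E <=
           hausdorff1 (frontier K `&` [set z | (dotp u z <= x0 + L * t)%R]))%E /\
        ((L * \sum_j (W j - D j t))%R%:E <=
           hausdorff1 (frontier K `&` [set z | (x0 + L * t < dotp u z)%R]))%E].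
Proof.
move=> hK L0 u1 cT cB ccT ccB KE BT /andP[k0 k1].
have BT01 s : 0 <= s <= 1 -> 0 <= T s - B s.
  apply: (@continuous_ge0_on_closure _ (fun s => T s - B s)) => [x|x /BT]; last by rewrite subr_gt0.
  by apply: cvgB; [exact: cT|exact: cB].
have e0 : 0 < 1 - k by rewrite subr_gt0.
have [n [alpha [beta [beta0 crofton]]]] := finite_crofton e0.
pose g j r := alpha j * r + beta j * T r.
pose h j r := - alpha j * r + - beta j * B r.
have crofton_le x y : \sum_j `|alpha j * x + beta j * y| <= Num.sqrt (x ^+ 2 + y ^+ 2).
  by have /andP[] := crofton x y.
have croftonN x y : \sum_j `|- alpha j * x + - beta j * y| =
    \sum_j `|alpha j * x + beta j * y|.
  by apply: eq_bigr => j _; rewrite !mulNr -opprD normrN.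
have crofton_leN x y : \sum_j `|- alpha j * x + - beta j * y| <= Num.sqrt (x ^+ 2 + y ^+ 2).
  by rewrite croftonN.
have crofton_ge x y : k * Num.sqrt (x ^+ 2 + y ^+ 2) <= \sum_j `|alpha j * x + beta j * y|.
  by have /andP[] := crofton x y; rewrite subKr.
have crofton_geN x y : k * Num.sqrt (x ^+ 2 + y ^+ 2) <=
    \sum_j `|- alpha j * x + - beta j * y| by rewrite croftonN.
have cg j : continuous (g j).
  move=> x; apply: cvgD; apply: cvgM; by [exact: cvg_cst|exact: cvg_id|exact: cT].
have ch j : continuous (h j).
  move=> x; apply: cvgD; apply: cvgM; by [exact: cvg_cst|exact: cvg_id|exact: cB].
have ccg j : concave01 (g j).
  move=> x y l x01 y01 l01; have := ccT x y l x01 y01 l01.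
  rewrite -(ler_pM2l (beta0 j)) /g; move: (T _) (T x) (T y) => *; lra.
have cch j : concave01 (h j).
  move=> x y l x01 y01 l01; have := ccB x y l x01 y01 l01.
  rewrite -(ler_pM2l (beta0 j)) /h; move: (B _) (B x) (B y) => *; lra.
have [m mg] := choice (fun j => argmax01_exists (cg j)).
have [m' mh] := choice (fun j => argmax01_exists (ch j)).
pose W j := g j (m j) + h j (m' j).
pose D j := variation_sum (g j) (h j) (m j) (m' j).
have ghE j t : g j t + h j t = beta j * (T t - B t) by rewrite /g /h; ring.
have half01 : 0 <= (2^-1 : R) <= 1 by lra.
have f_half : 0 < T 2^-1 - B 2^-1 by rewrite subr_gt0 BT//; apply/andP; split; lra.
have W_ge j : beta j * (T 2^-1 - B 2^-1) <= W j.
  by rewrite -ghE lerD//; [have [_] := mg j|have [_] := mh j]; exact.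
have W0 j : 0 < W j by apply: lt_le_trans (W_ge j); rewrite mulr_gt0.
have beta_sum : k <= \sum_j beta j /\ \sum_j beta j <= 1.
  have := crofton 0 1; rewrite subKr expr0n expr1n add0r sqrtr1 mulr1.
  under eq_bigr do rewrite mulr0 add0r mulr1 gtr0_norm//.
  by move=> /andP[].
have [beta_ge beta_le] := beta_sum.
have sv0 (p : R -> R) q : argmax01 p q -> signed_variation p q 0 = p 0 - p q.
  by move=> [/andP[q0 q1] _]; rewrite /signed_variation /rising /falling min_l// max_r.
have sv1 (p : R -> R) q : argmax01 p q -> signed_variation p q 1 = p q - p 1.
  by move=> [/andP[q0 q1] _]; rewrite /signed_variation /rising /falling min_r// max_l.
have D_left j t : signed_variation (g j) (m j) t - signed_variation (g j) (m j) 0 +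
    (signed_variation (h j) (m' j) t - signed_variation (h j) (m' j) 0) +
    beta j * (T 0 - B 0) = W j + D j t.
  by rewrite -ghE !sv0// /D /variation_sum /W; ring.
have D_right j t : signed_variation (g j) (m j) 1 - signed_variation (g j) (m j) t +
    (signed_variation (h j) (m' j) 1 - signed_variation (h j) (m' j) t) +
    beta j * (T 1 - B 1) = W j - D j t.
  by rewrite -ghE !sv1// /D /variation_sum /W; ring.
have i0 : 0 <= (0 : R) <= 1 by rewrite lexx ler01.
have i1 : 0 <= (1 : R) <= 1 by rewrite lexx ler01.
have sideL s : 0 <= s <= 1 -> ((L * \sum_j (beta j * (T s - B s)))%:E <=
    hausdorff1 (side u x0 L T B s))%E.
  move=> s01; apply: le_trans (side_length_ge x0 L0 u1 cT cB BT s01).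
  rewrite lee_fin ler_pM2l// -mulr_suml -[X in _ <= X]mul1r.
  by rewrite ler_wpM2r ?BT01.
exists n, W, D; split.
- apply: (@lt_le_trans _ _ (\sum_j (beta j * (T 2^-1 - B 2^-1)))).
    by rewrite -mulr_suml mulr_gt0// (lt_le_trans k0).
  by apply: ler_sum => j _; exact: W_ge.
- move=> j; have [D1 D2] := profile_inequality (cg j) (ch j) (ccg j) (cch j) (mg j) (mh j)
    (continuous_bmeas (f := fun t => T t - B t) (fun x => cvgB (cT x) (cB x)))
    (beta0 j) (W0 j) (fun t _ => ghE j t) BT01.
  split => //; apply: continuous_bmeas => x.
  by apply: cvgD; apply: cvgB; first [exact: continuous_rising|exact: continuous_falling].
- have BT0 : B 0 <= T 0 by rewrite -subr_ge0 BT01.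
  have BT1 : B 1 <= T 1 by rewrite -subr_ge0 BT01.
  apply: le_trans (le_hausdorff1 (frontier_sub hK L0 u1 cT cB KE)) _.
  apply: le_trans (outer_measureU2 hausdorff1 _ _) _.
  apply: le_trans (leeD (outer_measureU2 hausdorff1 _ _) (outer_measureU2 hausdorff1 _ _)) _.
  apply: le_trans (leeD (leeD (graph_length_le x0 L0 u1 k0 crofton_ge ccg mg)
    (graph_length_le x0 L0 u1 k0 crofton_geN cch mh))
    (leeD (side_length_le x0 L0 u1 0 BT0) (side_length_le x0 L0 u1 1 BT1))) _.
  rewrite -!EFinD lee_fin.
  have bound s : 0 <= s <= 1 -> L * (T s - B s) <= L / k * \sum_j (beta j * (T s - B s)).
    move=> s01; rewrite -mulr_suml mulrA ler_wpM2r ?BT01//.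
    by rewrite -[X in X <= _]mulr1 -mulrA ler_pM2l// ler_pdivlMl// mulr1.
  apply: le_trans (lerD (lexx _) (lerD (bound 0 i0) (bound 1 i1))) _.
  rewrite -!mulrDr -!big_split/= ler_pM2l ?divr_gt0//.
  apply: ler_sum => j _; rewrite -!ghE -/(g j) -/(h j) (sv0 _ _ (mg j)) (sv0 _ _ (mh j)) (sv1 _ _ (mg j)) (sv1 _ _ (mh j)).
  by rewrite /W; move: (g j 0) (g j 1) (h j 0) (h j 1) => *; lra.
- move=> t /[dup] t01 /andP[t0 t1]; split.
  + apply: le_trans (length_left_ge L0 u1 cT cB KE BT t01).
    apply: le_trans (leeD (leeD
      (arc_length_ge x0 L0 u1 cT crofton_le ccg mg (lexx 0) (ltW t0) (ltW t1))
      (arc_length_ge x0 L0 u1 cB crofton_leN cch mh (lexx 0) (ltW t0) (ltW t1)))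
      (sideL 0 i0)).
    rewrite -!EFinD lee_fin -!mulrDr -!big_split/= ler_pM2l//.
    by apply: ler_sum => j _; rewrite -D_left.
  + apply: le_trans (length_right_ge L0 u1 cT cB KE BT t01).
    apply: le_trans (leeD (leeD
      (arc_length_ge x0 L0 u1 cT crofton_le ccg mg (ltW t0) (ltW t1) (lexx 1))
      (arc_length_ge x0 L0 u1 cB crofton_leN cch mh (ltW t0) (ltW t1) (lexx 1)))
      (sideL 1 i1)).
    rewrite -!EFinD lee_fin -!mulrDr -!big_split/= ler_pM2l//.
    by apply: ler_sum => j _; rewrite -D_right.
Qed.

End directions.

(** * Comparison of the two projections *)

Section conclusion.
Context {R : realType}.
Local Notation int01 := (integ (0 : R) 1).

(** Jensen's inequality for the concave function [(1 - x ^+ 2) / 4], with weights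
    [W j / \sum_i W i] at the points [D j / W j]. *)
Lemma mixture_jensen n (W D : 'I_n -> R) : (forall j, 0 < W j) -> 0 < \sum_j W j ->
  \sum_j (W j / (\sum_i W i) * ((1 - (D j / W j) ^+ 2) / 4)) <=
  (\sum_j (W j + D j) / (2 * \sum_j W j)) * (\sum_j (W j - D j) / (2 * \sum_j W j)).
Proof.
move=> W0 S0; set S := \sum_j W j in S0 *.
have SN0 : S != 0 by rewrite gt_eqF.
set x := (\sum_j D j) / S.
have -> : \sum_j (W j + D j) / (2 * S) = (1 + x) / 2.
  by rewrite -mulr_suml big_split/= -/S /x; field.
have -> : \sum_j (W j - D j) / (2 * S) = (1 - x) / 2.
  by rewrite -mulr_suml sumrB/= -/S /x; field.
have sq : 0 <= \sum_j (W j / S * (D j / W j - x) ^+ 2).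
  by apply: sumr_ge0 => j _; rewrite mulr_ge0 ?sqr_ge0// ltW// divr_gt0.
have sqE : \sum_j (W j / S * (D j / W j - x) ^+ 2) =
    \sum_j (W j / S * (D j / W j) ^+ 2) - x ^+ 2.
  have -> : \sum_j (W j / S * (D j / W j - x) ^+ 2) =
      \sum_j (W j / S * (D j / W j) ^+ 2 - 2 * x * (D j / S) + x ^+ 2 * (W j / S)).
    by apply: eq_bigr => j _; field; rewrite SN0 gt_eqF.
  rewrite big_split sumrB/= -!mulr_sumr -!mulr_suml -/S -/x divff//; ring.
have -> : \sum_j W j / S * ((1 - (D j / W j) ^+ 2) / 4) =
    (1 - \sum_j (W j / S * (D j / W j) ^+ 2)) / 4.
  have -> : \sum_j W j / S * ((1 - (D j / W j) ^+ 2) / 4) =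
    \sum_j (4^-1 * (W j / S) - 4^-1 * (W j / S * (D j / W j) ^+ 2)).
    by apply: eq_bigr => j _; field; rewrite SN0 gt_eqF.
  by rewrite sumrB -!mulr_sumr -mulr_suml -/S divff//; ring.
by move: sq; rewrite sqE; lra.
Qed.

(** The distribution function of the boundary projection and its complement are
    at least [k] times those of the mixture of the one-functional profiles. Jensen's
    inequality reduces the mixture to the single profiles, for which
    [profile_inequality] gives the same bound whatever the functional. *)
Lemma gini_arclength_projection_ge (K : set (R * R)) (u : R * R) (x0 L : R)
    (T B : R -> R) (k : R) :
  convex_body K -> 0 < L -> u.1 ^+ 2 + u.2 ^+ 2 = 1 ->
  continuous T -> continuous B -> concave01 T -> concave01 (fun s => - B s) ->
  (forall s y, K (chart u x0 L (s, y)) <-> 0 <= s <= 1 /\ B s <= y <= T s) ->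
  (forall s, 0 < s < 1 -> B s < T s) -> 0 < k < 1 ->
  0 < int01 (fun t => T t - B t) ->
  ((k ^+ 2 * (2 * L * (int01 (fun t => (T t - B t) * (((1 - t) ^+ 3 + t ^+ 3) / 3)) /
             int01 (fun t => T t - B t))))%R%:E <=
   gini_mean_difference (arclength_projection K u))%E.
Proof.
move=> hK L0 u1 cT cB ccT ccB KE BT k01 A0; have /andP[k0 k1] := k01.
have [n [W [D [S0 WD upper lower]]]] :=
  boundary_directions hK L0 u1 cT cB ccT ccB KE BT k01.
set S := \sum_j W j in S0 *; set A := int01 _ in A0 *; set Q := int01 _.
have W0 j : 0 < W j by have [] := WD j.
have half01 : 0 < (2^-1 : R) < 1 by apply/andP; split; lra.
have fin_len X : X `<=` frontier K -> hausdorff1 X \is a fin_num.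
  move=> XK; rewrite ge0_fin_numE ?hausdorff1_ge0//.
  exact: le_lt_trans (le_trans (le_hausdorff1 XK) upper) (ltry _).
have [M ME] : exists M, hausdorff1 (frontier K) = M%:E.
  by exists (fine (hausdorff1 (frontier K))); rewrite fineK// fin_len.
have M_le : M <= L / k * (2 * S) by move: upper; rewrite ME lee_fin -mulr_sumr.
have M0 : 0 < M.
  have [l1 l2] := lower _ half01.
  have h1 : L * \sum_j (W j + D j 2^-1) <= M.
    by rewrite -lee_fin -ME; apply: le_trans l1 _; apply: le_hausdorff1 => ? [].
  have h2 : L * \sum_j (W j - D j 2^-1) <= M.
    by rewrite -lee_fin -ME; apply: le_trans l2 _; apply: le_hausdorff1 => ? [].
  have LS : 0 < L * S by rewrite mulr_gt0.
  move: h1 h2; rewrite big_split sumrB/= -/S !mulrDr mulrN; lra.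
have mF := measurable_frontier K.
have qE (I : set R) : measurable I -> arclength_projection K u I =
    (hausdorff1 (frontier K `&` [set z | I (dotp u z)]) * (M^-1)%:E)%E.
  by move=> mI; exact: (projection_normalized (nu := arclength) mF u mI M0 ME).
pose len I := fine (hausdorff1 (frontier K `&` [set z | I (dotp u z)])).
have qlen (I : set R) : measurable I -> arclength_projection K u I = (len I / M)%:E.
  by move=> mI; rewrite qE// EFinM /len fineK// fin_len// => ? [].
pose F s := len `]-oo, (x0 + L * s)%R]%classic / M.
have qF s : arclength_projection K u `]-oo, (x0 + L * s)%R]%classic = (F s)%:E.
  by rewrite qlen.
have qF' s : 1 - F s = len `](x0 + L * s)%R, +oo[%classic / M.
  apply: EFin_inj; rewrite -qlen// EFinB -qF.
  by rewrite -setCitvl probability_setC.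
have F_ge (X : R) I : 0 <= X -> ((L * X)%:E <=
      hausdorff1 (frontier K `&` [set z | I (dotp u z)]))%E ->
    k * (X / (2 * S)) <= len I / M.
  move=> X0 XI; rewrite ler_pdivlMr//; apply: (@le_trans _ _ (L * X)); last first.
    by rewrite -lee_fin /len fineK// fin_len// => ? [].
  have kX : 0 <= k * (X / (2 * S)).
    by rewrite mulr_ge0 ?divr_ge0// ltW// mulr_gt0.
  apply: le_trans (ler_wpM2l kX M_le) _.
  rewrite le_eqVlt; apply/orP; left; apply/eqP; field.
  by rewrite !gt_eqF.
pose Bd t := k ^+ 2 * \sum_j (W j / S * ((1 - (D j t / W j) ^+ 2) / 4)).
have bterm j : bmeas (fun t => (1 - (D j t / W j) ^+ 2) / 4).
  have [_ bD _ _] := WD j.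
  apply: bmeasM; last exact: bmeas_cst.
  apply: bmeasB; first exact: bmeas_cst.
  by apply: bmeasX; apply: bmeasM => //; exact: bmeas_cst.
have bsum : bmeas (fun t => \sum_j (W j / S * ((1 - (D j t / W j) ^+ 2) / 4))).
  by apply: bmeas_sum => j; apply: bmeasM => //; exact: bmeas_cst.
have bBd : bmeas Bd by apply: bmeasM => //; exact: bmeas_cst.
have main t : 0 < t < 1 -> 0 <= Bd t <= F t * (1 - F t).
  move=> t01; have t01' : 0 <= t <= 1 by have /andP[? ?] := t01; rewrite !ltW.
  have DW j : `|D j t| <= W j by have [_ _ + _] := WD j; exact.
  apply/andP; split.
    apply: mulr_ge0; first exact: sqr_ge0.
    apply: sumr_ge0 => j _; apply: mulr_ge0; first by rewrite ltW// divr_gt0.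
    apply: divr_ge0 => //; rewrite subr_ge0 -real_normK ?num_real// expr_le1//.
    by rewrite normrM normfV [`|W j|]gtr0_norm// ler_pdivrMr// mul1r.
  have [l1 l2] := lower t t01.
  have p1 : 0 <= \sum_j (W j + D j t).
    by apply: sumr_ge0 => j _; have := DW j; rewrite ler_norml; lra.
  have p2 : 0 <= \sum_j (W j - D j t).
    by apply: sumr_ge0 => j _; have := DW j; rewrite ler_norml; lra.
  have f1 : k * ((\sum_j (W j + D j t)) / (2 * S)) <= F t.
    have := (F_ge _ `]-oo, (x0 + L * t)%R]%classic p1); apply.
    apply: le_trans l1 _; apply: le_hausdorff1 => z [Kz zt].
    by split => //=; rewrite in_itv.
  have f2 : k * ((\sum_j (W j - D j t)) / (2 * S)) <= 1 - F t.
    rewrite qF'; have := (F_ge _ `](x0 + L * t)%R, +oo[%classic p2); apply.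
    apply: le_trans l2 _; apply: le_hausdorff1 => z [Kz zt].
    by split => //=; rewrite in_itv/= andbT.
  apply: (@le_trans _ _ ((k * ((\sum_j (W j + D j t)) / (2 * S))) *
      (k * ((\sum_j (W j - D j t)) / (2 * S))))); last first.
    by apply: ler_pM => //; rewrite mulr_ge0 ?divr_ge0// ltW// mulr_gt0.
  rewrite mulrACA -expr2 ler_wpM2l ?sqr_ge0//.
  have := mixture_jensen (fun j => D j t) W0 S0.
  by rewrite -/S -!mulr_suml.
apply: le_trans (gini_ge L0 qF bBd main).
rewrite lee_fin.
have -> : int01 Bd = k ^+ 2 * \sum_j (W j / S * int01 (fun t => (1 - (D j t / W j) ^+ 2) / 4)).
  rewrite integZ// integ_sum//; last by move=> j; apply: bmeasM => //; exact: bmeas_cst.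
  by congr (_ * _); apply: eq_bigr => j _; rewrite integZ.
rewrite [X in _ <= X]mulrCA ler_wpM2l ?sqr_ge0// ler_pM2l ?mulr_gt0//.
have -> : Q / A = \sum_j (W j / S * (Q / A)).
  by rewrite -!mulr_suml divff ?mul1r// gt_eqF.
apply: ler_sum => j _; rewrite ler_wpM2l//; first by rewrite ltW// divr_gt0.
by rewrite ler_pdivrMr// mulrC; have [] := WD j.
Qed.

Lemma gini_ge0 (rho : probability R R) : (0 <= gini_mean_difference rho)%E.
Proof. by apply: integral_ge0 => z _; rewrite lee_fin. Qed.

Lemma le_of_sqr_scaling (c : R) (g : \bar R) : (0 <= g)%E ->
  (forall k, 0 < k < 1 -> ((k ^+ 2 * c)%R%:E <= g)%E) -> (c%:E <= g)%E.
Proof.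
case: g => [g|_ _|//]; last exact: leey.
rewrite !lee_fin => g0 cg; rewrite leNgt; apply/negP => gc.
have c0 : 0 < c by exact: le_lt_trans gc.
(* [(1 - d) ^+ 2 * c >= c - (c - g) / 2], which is larger than [g] *)
pose d := (c - g) / (4 * c).
have dc : d * c = (c - g) / 4 by rewrite /d; field; rewrite gt_eqF.
have d0 : 0 < d by rewrite /d divr_gt0 ?mulr_gt0// subr_gt0.
have d1 : d < 1 by rewrite /d ltr_pdivrMr ?mulr_gt0//; lra.
have k01 : 0 < 1 - d < 1 by lra.
have := cg _ k01; rewrite lee_fin; have : 0 <= d ^+ 2 * c by rewrite mulr_ge0 ?sqr_ge0// ltW.
have -> : (1 - d) ^+ 2 * c = c - 2 * (d * c) + d ^+ 2 * c by ring.
rewrite dc; lra.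
Qed.

End conclusion.

Theorem theorem1p2 (R : realType) (K : set (R * R)) (u : R * R)
  (hK : convex_body K) (hu : eucl_norm u = 1) :
  (gini_mean_difference (arclength_projection K u) >=
   gini_mean_difference (area_projection hK u))%E.
Proof.
have u1 := eucl_norm1 hu.
have [x0 [L [T [B [L0 [cT cB] [ccT ccB] KE BT]]]]] := convex_body_chart hK u1.
have A0 : 0 < integ 0 1 (fun t => T t - B t).
  have cf : continuous (fun t => T t - B t) by move=> x; apply: cvgB; [exact: cT|exact: cB].
  apply: int01_concave_gt0.
  - exact: continuous_bmeas.
  - move=> x y l x01 y01 l01; have := ccT x y l x01 y01 l01.
    by have := ccB x y l x01 y01 l01; lra.
  - by apply: continuous_ge0_on_closure => // s /BT; rewrite subr_gt0.
  - by rewrite subr_gt0; apply: BT; apply/andP; split; lra.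
apply: le_trans (gini_area_projection_le hK u1 L0 cT cB ccT ccB KE BT) _.
apply: le_of_sqr_scaling; first exact: gini_ge0.
by move=> k k01; exact: gini_arclength_projection_ge.
Qed.
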